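(* The physical spectrum of the rescaled Schr\''odinger operator $T=-\Delta-2\gamma/r$ (the set of $\lambda\in\mathbb{R}$ with $\mathrm{PhysSol}(\lambda)\neq0$) coincides with the set of all $\lambda\in\mathbb{R}$ for which $\mathrm{RegSol}(\lambda)$ has a nonzero infinitesimally unitary Jantzen quotient. There is in this case a unique infinitesimally unitary Jantzen quotient, and it is the submodule $\mathrm{PhysSol}(\lambda)$ of $\mathrm{RegSol}(\lambda)$.
   Context: Fix a real constant $\gamma>0$. Put $\mathbb{R}^3_0=\mathbb{R}^3\setminus\{0\}$, $r=\|x\|$, and $T=-\Delta-2\gamma/r$, viewed in the algebra of linear partial differential operators on $\mathbb{R}^3_0$ with smooth coefficients. Let $\mathcal{O}=\mathbb{C}[T]$ (viewed as polynomial functions of $\lambda\in\mathbb{C}$). Let $L_1=x_2\partial_3-x_3\partial_2$, $L_2=x_3\partial_1-x_1\partial_3$, $L_3=x_1\partial_2-x_2\partial_1$, and let the Runge-Lenz operators be $R_1=\sqrt{-1}(L_3\partial_2-L_2\partial_3-\partial_1+\gamma x_1/r)$, $R_2=\sqrt{-1}(L_1\partial_3-L_3\partial_1-\partial_2+\gamma x_2/r)$, $R_3=\sqrt{-1}(L_2\partial_1-L_1\partial_2-\partial_3+\gamma x_3/r)$. All commute with $T$. $\mathfrak{g}$ is the $\mathcal{O}$-linear span of the $L_i,R_i$; it is a Lie algebra over $\mathcal{O}$ under the commutator, free on these six elements, with $[L_i,L_j]=-\varepsilon_{ijk}L_k$, $[R_i,R_j]=\varepsilon_{ijk}TL_k$,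 $[L_i,R_j]=-\varepsilon_{ijk}R_k$. The fiber is $\mathfrak{g}|_\lambda=\mathfrak{g}/(T-\lambda)\mathfrak{g}$; for real $\lambda$ it has the real form spanned over $\mathbb{R}$ by the $L_i$ and $R_i$. $K=O(3,\mathbb{C})$ (compact form $O(3)$). $O(3)$ acts on $\mathbb{R}^3_0$ by $A\colon v\mapsto\det(A)^{-1}Av$, hence on functions and, by conjugation, on $\mathfrak{g}$; this extends algebraically to $K$. The infinitesimal action identifies $\mathfrak{k}=\mathfrak{so}(3,\mathbb{C})$ with the span of the $L_i$. Families of modules below are free $\mathcal{O}$-modules with compatible locally finite $K$-action and $\mathcal{O}$-linear $\mathfrak{g}$-action. For $\lambda\in\mathbb{C}$, $\mathrm{Sol}(\lambda)=\{\psi\in C^\infty(\mathbb{R}^3_0)_{\mathrm{fin}}: T\psi=\lambda\psi\}$ (fin denotes $K$-finite functions). The radial equation is $r^2\psi''+2r\psi'-\ell(\ell+1)\psi+2\gamma r\psi+\lambda r^2\psi=0$. $F_{\ell,\lambda}$ is its unique solution extending to an entire function of $r$ with $F_{\ell,\lambda}(r)=r^\ell+\text{higher-order terms}$; $G_{\ell,\lambda}$ is a second solution $H_{\ell,\lambda}+C_{\ell,\lambda}\log(r)F_{\ell,\lambda}$, $H_{\ell,\lambda}$ meromorphic with a pole of order $\ell+1$ at $0$, normalized to have $r^{-(\ell+1)}$-coefficient $1$. $\mathrm{RegSol}(\lambda)\subseteq\mathrm{Sol}(\lambda)$ is the span of the $F_{\ell,\lambda}(r)Y_\ell$ ($Y_\ell$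 a spherical harmonic of degree $\ell$, $\ell\ge0$), a $(\mathfrak{g}|_\lambda,K)$-submodule; $\mathrm{SingSol}(\lambda)=\mathrm{Sol}(\lambda)/\mathrm{RegSol}(\lambda)$. For $\lambda\in\mathbb{R}$, $\mathrm{PhysSol}(\lambda)$ is the space of those functions in $\mathrm{RegSol}(\lambda)$ that converge to zero at infinity. $\mathcal{R}$ is the span of the sections $\lambda\mapsto p(\lambda)F_{\ell,\lambda}Y_\ell\in\mathrm{RegSol}(\lambda)$ and $\mathcal{S}$ the span of the sections $\lambda\mapsto[p(\lambda)G_{\ell,\lambda}Y_\ell]\in\mathrm{SingSol}(\lambda)$, $p$ polynomial. $T$ acts as multiplication by $\lambda$; $\mathfrak{g}$ and $K$ act pointwise in $\lambda$. The fibers of $\mathcal{R}$, $\mathcal{S}$ at $\lambda$ are $\mathrm{RegSol}(\lambda)$, $\mathrm{SingSol}(\lambda)$. $\mathcal{A}\colon\mathcal{S}\to\mathcal{R}$ denotes the $\mathcal{O}$-linear, $K$- and $\mathfrak{g}$-equivariant morphism that is an isomorphism on the $K$-fixed ($\ell=0$) parts; it is unique up to a nonzero complex scalar. The Jantzen filtration of $\mathrm{RegSol}(\lambda)$ determined by $\mathcal{A}$ is the increasing filtration in which, for $p\in\mathbb{Z}$, $\mathrm{RegSol}(\lambda)^{(p)}$ is the image in the fiber $\mathrm{RegSol}(\lambda)$ of the space of all $h\in\mathcal{R}$ such that $(T-\lambda)^p h$ belongs to the image of $\mathcal{A}$. The Jantzen quotients are the $(\mathfrak{g}|_\lambda,K)$-modules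 $\mathrm{RegSol}(\lambda)^{(p)}/\mathrm{RegSol}(\lambda)^{(p-1)}$. A $(\mathfrak{g}|_\lambda,K)$-module ($\lambda$ real) is infinitesimally unitary if it carries a positive-definite Hermitian inner product that is invariant under the compact group $O(3)$ and for which the operators $L_i$ and $R_i$ are skew-symmetric. (For Jantzen quotients the relevant form is the invariant nondegenerate Hermitian form $\langle\mathcal{A}^{(p)}[\alpha],[\varphi]\rangle=c\cdot((T-\lambda)^{-p}\alpha(\varphi))|_\lambda$, for suitable $c\in\mathbb{C}^\times$. It arises by identifying $\mathcal{S}$ with the $\sigma$-twisted dual of $\mathcal{R}$, i.e. the complex conjugate of $\mathrm{Hom}_{\mathcal{O}}(\mathcal{R},\mathcal{O})_{\mathrm{fin}}$ with actions twisted by the conjugate-linear involutions fixing $T,L_i,R_i$ and $O(3)$, where $\mathcal{A}^{(p)}$ is induced by $(T-\lambda)^{-p}\mathcal{A}$.) *)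

(* Defs.v *)
From HB Require Import structures.
From mathcomp Require Import all_boot all_order all_algebra.
From mathcomp Require Import all_classical all_reals all_analysis.
From mathcomp Require Import complex ring_quotient sesquilinear.

Set Implicit Arguments.
Unset Strict Implicit.
Unset Printing Implicit Defensive.

Import Order.TTheory GRing.Theory Num.Theory.
Import numFieldNormedType.Exports.

#[local] Obligation Tactic := idtac.

Local Open Scope classical_set_scope.
Local Open Scope ring_scope.
Local Open Scope complex_scope.
Local Open Scope quotient_scope.

Section Span.
Variables (K : pzRingType) (V : lmodType K).

Definition lspan (S : set V) : set V :=
  [set v | exists n (c : 'I_n -> K) (w : 'I_n -> V),
     (forall i, S (w i)) /\ v = \sum_i c i *: w i].

Lemma lspan0 S : lspan S 0.
Proof.
by exists 0%N, (fun=> 0), (fun=> 0); split=> [[]//|]; rewrite big_ord0.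
Qed.

Lemma lspan_linear S a u v :
  lspan S u -> lspan S v -> lspan S (a *: u + v).
Proof.
move=> [n [c [w [Sw ->]]]] [m [d [z [Sz ->]]]].
exists (n + m)%N,
  (fun i => match fintype.split i with inl j => a * c j | inr k => d k end),
  (fun i => match fintype.split i with inl j => w j | inr k => z k end).
split=> [i|]; first by case: fintype.splitP.
rewrite big_split_ord /= scaler_sumr; congr (_ + _); apply: eq_bigr => i _.
  by rewrite (unsplitK (inl i)) scalerA.
by rewrite (unsplitK (inr i)).
Qed.

Definition lspan_pred (S : set V) : {pred V} := [pred v | `[< lspan S v >]].

Lemma lspan_submod S : GRing.submod_closed (lspan_pred S).
Proof.
split=> [|a u v]; first by apply/asboolP; exact: lspan0.
by move=> /asboolP uS /asboolP vS; apply/asboolP; exact: lspan_linear.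
Qed.

HB.instance Definition _ S :=
  GRing.isSubmodClosed.Build K V (lspan_pred S) (lspan_submod S).

Record submod (S : set V) :=
  Submod { submod_val :> V; _ : submod_val \in lspan_pred S }.

HB.instance Definition _ S := [isSub for @submod_val S].
HB.instance Definition _ S := [Choice of submod S by <:].
HB.instance Definition _ S :=
  [SubChoice_isSubLmodule of submod S by <:].

End Span.

(* The module U / W for sets U and W of vectors of V.  It is the literal      *)
(* quotient when U and W are submodules with W included in U; submodularity   *)
(* is not required, spans being taken, so that no closure proof is needed in  *)
(* order to form the type.                                                    *)
Section Subquotient.
Variables (K : pzRingType) (V : lmodType K) (U W : set V).

Definition sub_pred : {pred submod U} := [pred u | val u \in lspan_pred W].

Lemma sub_pred_submod : GRing.submod_closed sub_pred.
Proof.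
by split=> [|a u v uW vW]; [exact: rpred0|exact: rpredD (rpredZ _ uW) vW].
Qed.

HB.instance Definition _ :=
  GRing.isSubmodClosed.Build K (submod U) sub_pred sub_pred_submod.

Definition subquot : Type := Quotient.quot sub_pred.

HB.instance Definition _ : EqQuotient _ (Quotient.equiv sub_pred) subquot :=
  EqQuotient.on subquot.
HB.instance Definition _ := GRing.Zmodule.on subquot.

Let cls : submod U -> subquot := \pi_subquot.

Let clsD u v : cls u + cls v = cls (u + v).
Proof. by apply/esym; apply: (@Quotient.pi_add _ sub_pred). Qed.

Let clsP x : exists u, x = cls u.
Proof. by exists (repr x); rewrite /cls reprK. Qed.

Definition subquot_scale (a : K) (x : subquot) : subquot := cls (a *: repr x).

Fact subquot_scale_cls a u : subquot_scale a (cls u) = cls (a *: u).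
Proof.
apply/eqP; rewrite -Quotient.idealrBE -scalerBr rpredZ //.
by rewrite Quotient.idealrBE reprK.
Qed.

Fact subquot_scaleA a b x :
  subquot_scale a (subquot_scale b x) = subquot_scale (a * b) x.
Proof. by have [u ->] := clsP x; rewrite !subquot_scale_cls scalerA. Qed.

Fact subquot_scale1 : left_id 1 subquot_scale.
Proof.
by move=> x; have [u ->] := clsP x; rewrite subquot_scale_cls scale1r.
Qed.

Fact subquot_scaleDr : right_distributive subquot_scale +%R.
Proof.
move=> a x y; have [[u ->] [v ->]] := (clsP x, clsP y).
by rewrite clsD !subquot_scale_cls clsD scalerDr.
Qed.

Fact subquot_scaleDl x : {morph subquot_scale^~ x : a b / a + b}.
Proof.
move=> a b; have [u ->] := clsP x.
by rewrite !subquot_scale_cls clsD scalerDl.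
Qed.

HB.instance Definition _ := GRing.Zmodule_isLmodule.Build K subquot
  subquot_scaleA subquot_scale1 subquot_scaleDr subquot_scaleDl.

(* The class modulo W of a vector of U (and 0 outside U). *)
Definition sqcls (v : V) : subquot := cls (insubd 0 v).

(* The map induced on U / W by a linear map X preserving both U and W. *)
Definition sqmap (X : V -> V) (c : subquot) : subquot :=
  sqcls (X (val (repr c))).

End Subquotient.

Section Sections.
Variables (K : pzRingType) (I : Type) (M : I -> lmodType K).

Definition sections : Type := forall i, M i.

HB.instance Definition _ := Choice.copy sections (forall i, M i).

Let sec0 : sections := fun=> 0.
Let sec_opp (s : sections) : sections := fun i => - s i.
Let sec_add (s t : sections) : sections := fun i => s i + t i.
Let sec_scale (a : K) (s : sections) : sections := fun i => a *: s i.

Fact sec_addA : associative sec_add.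
Proof.
by move=> s t u; apply: functional_extensionality_dep => i; exact: addrA.
Qed.
Fact sec_addC : commutative sec_add.
Proof.
by move=> s t; apply: functional_extensionality_dep => i; exact: addrC.
Qed.
Fact sec_add0 : left_id sec0 sec_add.
Proof.
by move=> s; apply: functional_extensionality_dep => i; exact: add0r.
Qed.
Fact sec_addN : left_inverse sec0 sec_opp sec_add.
Proof.
by move=> s; apply: functional_extensionality_dep => i; exact: addNr.
Qed.

HB.instance Definition _ := GRing.isZmodule.Build sections
  sec_addA sec_addC sec_add0 sec_addN.

Fact sec_scaleA a b s : sec_scale a (sec_scale b s) = sec_scale (a * b) s.
Proof.
by apply: functional_extensionality_dep => i; exact: scalerA.
Qed.
Fact sec_scale1 : left_id 1 sec_scale.
Proof.
by move=> s; apply: functional_extensionality_dep => i; exact: scale1r.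
Qed.
Fact sec_scaleDr : right_distributive sec_scale +%R.
Proof.
by move=> a s t; apply: functional_extensionality_dep => i; exact: scalerDr.
Qed.
Fact sec_scaleDl s : {morph sec_scale^~ s : a b / a + b}.
Proof.
by move=> a b; apply: functional_extensionality_dep => i; exact: scalerDl.
Qed.

HB.instance Definition _ := GRing.Zmodule_isLmodule.Build K sections
  sec_scaleA sec_scale1 sec_scaleDr sec_scaleDl.

End Sections.

Section Operators.
Variable R : realType.
Local Notation C := R[i].

Definition space0 := {x : 'cV[R]_3 | x != 0}.
Definition fn := space0 -> C.

HB.instance Definition _ := GRing.Lmodule.copy fn (space0 -> C).

Definition rad (x : space0) : R := Num.sqrt (\sum_i val x i 0 ^+ 2).

(* Extension by zero: only its germs at nonzero points are ever used. *)
Definition ext (f : fn) (y : 'cV[R]_3) : C := oapp f 0 (insub y).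

Definition partial (i : 'I_3) (f : fn) : fn := fun x =>
  'D_(delta_mx i 0) (@complex.Re R \o ext f) (val x) +i*
  'D_(delta_mx i 0) (@complex.Im R \o ext f) (val x).

(* All iterated partial derivatives exist and are Frechet differentiable. *)
Definition smooth (f : fn) := forall (s : seq 'I_3) (x : space0),
  differentiable (@complex.Re R \o ext (foldr partial f s)) (val x) /\
  differentiable (@complex.Im R \o ext (foldr partial f s)) (val x).

Definition laplacian (f : fn) : fn := fun x =>
  \sum_i partial i (partial i f) x.

Definition schrodinger (g : R) (f : fn) : fn := fun x =>
  - laplacian f x - (2 * g / rad x)%:C * f x.

(* The indices 0, 1, 2 of 'I_3 stand for 1, 2, 3 and addition is modulo 3, so *)
(* that i, i + 1, i + 2 are in cyclic order.                                  *)
Definition angmom (i : 'I_3) (f : fn) : fn := fun x =>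
  (val x (i + 1) 0)%:C * partial (i + 2%:R) f x
  - (val x (i + 2%:R) 0)%:C * partial (i + 1) f x.

Definition rungelenz (g : R) (i : 'I_3) (f : fn) : fn := fun x =>
  'i * (angmom (i + 2%:R) (partial (i + 1) f) x
        - angmom (i + 1) (partial (i + 2%:R) f) x
        - partial i f x + (g * val x i 0 / rad x)%:C * f x).

Definition O3 : set 'M[R]_3 := [set k | k *m k^T = 1%:M].

(* The default value of insubd is never used when k is invertible. *)
Definition space0_act (k : 'M[R]_3) (x : space0) : space0 :=
  insubd x ((\det k)^-1 *: (k *m val x)).

Definition fn_act (k : 'M[R]_3) (f : fn) : fn :=
  fun x => f (space0_act (invmx k) x).

Definition Kfinite (f : fn) := exists n (e : 'I_n -> fn),
  forall k, O3 k -> lspan (range e) (fn_act k f).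

Definition Sol (g : R) (l : C) : set fn :=
  [set f : fn | [/\ smooth f, Kfinite f & schrodinger g f = l *: f]].

Definition homogeneous (l : nat) : set fn :=
  lspan [set f : fn | exists m : 'I_3 -> nat, (\sum_i m i)%N = l /\
                 f = fun x => \prod_i (val x i 0)%:C ^+ m i].

(* Spherical harmonics of degree l, as functions of x / |x|. *)
Definition spherical (l : nat) : set fn :=
  [set Y : fn | exists P, [/\ homogeneous l P, laplacian P = 0 &
                         Y = fun x => P x / (rad x)%:C ^+ l]].

Definition rderiv (f : R -> C) : R -> C := fun r =>
  derive1 (@complex.Re R \o f) r +i* derive1 (@complex.Im R \o f) r.

Definition radial_eq (g : R) (l : nat) (la : C) (psi : R -> C) :=
  forall r : R, 0 < r ->
    (r ^+ 2)%:C * rderiv (rderiv psi) r + (2 * r)%:C * rderiv psi r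
    - (l * l.+1)%:R * psi r + (2 * g * r)%:C * psi r
    + la * (r ^+ 2)%:C * psi r = 0.

(* The coefficients a define an entire function, of which cpseries a is the   *)
(* restriction to the real line.                                              *)
Definition entire (a : nat -> C) :=
  forall r : R, cvgn (pseries (fun k => complex.Re `|a k|) r).

Definition cpseries (a : nat -> C) (r : R) : C :=
  limn (pseries (@complex.Re R \o a) r)
  +i* limn (pseries (@complex.Im R \o a) r).

Definition regular_radial (g : R) (l : nat) (la : C) (F : R -> C) :=
  radial_eq g l la F /\
  exists a, [/\ entire a, forall k, (k < l)%N -> a k = 0, a l = 1 &
                F = cpseries a].

(* Such a G is only determined up to a multiple of the regular solution.  The *)
(* meromorphic part, whose only pole is 0, is r^{-(l+1)} times an entire      *)
(* function with value 1 at 0.                                                *)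
Definition singular_radial (g : R) (l : nat) (la : C) (G : R -> C) :=
  radial_eq g l la G /\
  exists h c F, [/\ entire h, h 0%N = 1, regular_radial g l la F &
    forall r, 0 < r ->
      G r = cpseries h r / r%:C ^+ l.+1 + c * (ln r)%:C * F r].

Definition RegSol (g : R) (la : C) : set fn :=
  lspan [set f : fn | exists l F Y,
    [/\ regular_radial g l la F, spherical l Y &
        f = fun x => F (rad x) * Y x]].

Definition SingSol (g : R) (la : C) := subquot (Sol g la) (RegSol g la).

Definition PhysSol (g : R) (la : R) : set fn :=
  [set f : fn | RegSol g la%:C f /\
     forall e : R, 0 < e ->
       exists M : R, forall x, M < rad x -> `|f x| < e%:C].

Definition physical_spectrum (g : R) : set R :=
  [set la | exists2 f, PhysSol g la f & f != 0].

Definition RegSections (g : R) : set (C -> fn) :=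
  lspan [set h : C -> fn | exists l (p : {poly C}) (F : C -> R -> C) Y,
    [/\ forall la, regular_radial g l la (F la), spherical l Y &
        h = fun la x => p.[la] * (F la (rad x) * Y x)]].

Definition SingSections (g : R) : set (sections (SingSol g)) :=
  lspan [set s : sections (SingSol g) |
    exists l (p : {poly C}) (G : C -> R -> C) Y,
    [/\ forall la, singular_radial g l la (G la), spherical l Y &
        s = fun la => p.[la] *: sqcls (Sol g la) (RegSol g la)
                                  (fun x => G la (rad x) * Y x)]].

Definition secmap (g : R) (X : fn -> fn) (s : sections (SingSol g)) :
  sections (SingSol g) := fun la => sqmap X (s la).

(* By O-linearity, equivariance under the generators L_i, R_i amounts to      *)
(* equivariance under their O-linear span; an action of O(3,C) being the      *)
(* algebraic extension of one of O(3), equivariance under O(3) amounts to     *)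
(* equivariance under O(3,C).                                                 *)
Record intertwiner (g : R) (A : sections (SingSol g) -> C -> fn) : Prop := {
  intw_map : forall s, SingSections s -> RegSections g (A s);
  intw_add : forall s t, SingSections s -> SingSections t ->
    A (s + t) = A s + A t;
  intw_scale : forall (p : {poly C}) s, SingSections s ->
    A (fun la => p.[la] *: s la) = fun la => p.[la] *: A s la;
  intw_act : forall k s, O3 k -> SingSections s ->
    A (secmap (fn_act k) s) = fun la => fn_act k (A s la);
  intw_angmom : forall i s, SingSections s ->
    A (secmap (angmom i) s) = fun la => angmom i (A s la);
  intw_rungelenz : forall i s, SingSections s ->
    A (secmap (rungelenz g i) s) = fun la => rungelenz g i (A s la);
  intw_fixed : set_bij
    [set s | SingSections s /\ forall k, O3 k -> secmap (fn_act k) s = s]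
    [set h | RegSections g h /\
             forall k, O3 k -> (fun la => fn_act k (h la)) = h]
    A
}.

(* For p < 0, (T - la)^p h lies in the image of A when h lies in its image    *)
(* under (T - la)^(-p).                                                       *)
Definition jantzen (g : R) (A : sections (SingSol g) -> C -> fn)
    (la : C) (p : int) : set fn :=
  [set h la | h in [set h | RegSections g h /\
     exists2 s, SingSections s &
       match p with
       | Posz n => (fun mu => (mu - la) ^+ n *: h mu) = A s
       | Negz n => h = fun mu => (mu - la) ^+ n.+1 *: A s mu
       end]].

Definition jquot (g : R) (A : sections (SingSol g) -> C -> fn)
    (la : C) (p : int) :=
  subquot (jantzen A la p) (jantzen A la (p - 1)).

Definition inf_unitary (M : lmodType C)
    (act : 'M[R]_3 -> M -> M) (L Rl : 'I_3 -> M -> M) :=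
  exists B : {dot M for Num.conj},
    [/\ forall k u v, O3 k -> B (act k u) (act k v) = B u v,
        forall i u v, B (L i u) v = - B u (L i v) &
        forall i u v, B (Rl i u) v = - B u (Rl i v)].

Definition unitary_jquot (g : R) (A : sections (SingSol g) -> C -> fn)
    (la : C) (p : int) :=
  @inf_unitary (jquot A la p)
    (fun k => sqmap (fn_act k)) (fun i => sqmap (angmom i))
    (fun i => sqmap (rungelenz g i)).

Definition nontrivial (M : lmodType C) := exists u : M, u != 0.

End Operators.

(* Main.v *)
(* Write F_l = r^l phi_l. RegSol(la) is spanned by the functions phi_l P with P
   harmonic and homogeneous of degree l. The Runge-Lenz operators raise the degree
   with coefficient D_l = (la (l+1)^2 + g^2) / ((2l+3) (l+1)) and lower it with a
   nonzero one. Wronskians show that they raise the singular classes with a coefficient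
   that never vanishes, so equivariance forces A to act in degree l as
   D_0 ... D_(l-1), up to a nowhere vanishing factor. The D_j have simple zeros at
   distinct points, hence the filtration is 0, then the sum J0 of the degrees l with
   D_j <> 0 for all j < l, then RegSol(la).

   Fischer products weighted by the D_j give an invariant Hermitian form on J0, which
   is positive when la >= 0 or when some D_n vanishes at la. In the other nonzero
   quotients la < 0, and the sum of the squares of the Runge-Lenz operators is a
   positive scalar in high degrees, which excludes unitarity.

   F_l tends to 0 when la >= 0 by an energy estimate. When la < 0, decay is
   preserved by lowering, and by raising if D_l <> 0; if D_n = 0 then u = r F_n solves
   a first order equation and is bounded, while in high degrees u is convex where
   positive and grows. So F_l tends to 0 if and only if D_n = 0 for some n >= l. *)
Require Import Defs.
From HB Require Import structures.
From mathcomp Require Import all_boot all_order all_algebra.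
From mathcomp Require Import all_classical all_reals all_analysis.
From mathcomp Require Import complex ring_quotient.
From mathcomp Require Import ring lra.

Set Implicit Arguments.
Unset Strict Implicit.
Unset Printing Implicit Defensive.

Import Order.TTheory GRing.Theory Num.Theory.
Import numFieldNormedType.Exports.

Local Open Scope classical_set_scope.
Local Open Scope ring_scope.
Local Open Scope complex_scope.

Lemma near_eq_differentiable (K : numFieldType) (V W : normedModType K)
    (f g : V -> W) (x : V) :
  (\near x, f x = g x) -> differentiable f x -> differentiable g x.
Proof.
move=> fg /diff_locallyP[dfc dfE].
have gE : g \o shift x = cst (g x) + 'd f x +o_ 0 id.
  apply: eqaddoE; apply/eqaddoP => _/posnumP[e].
  move/eqaddoP: dfE => /(_ e%:num (gt0 e)) dfE.
  have fg0 : \forall h \near (0 : V), f (h + x) = g (h + x).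
    by move: fg; rewrite [X in X -> _](near_shift 0) subr0.
  apply: filterS2 fg0 dfE => h /= fgh; rewrite /= !fctE /= /cst fgh.
  by rewrite (nbhs_singleton fg).
apply/diff_locallyP; have dE := diff_unique dfc gE.
by split; rewrite dE.
Qed.

(** * Derivatives of complex-valued functions *)

Section ComplexDerivative.
Variables (R : realType) (V : normedModType R).
Local Notation C := R[i].
Local Notation re := (@complex.Re R).
Local Notation im := (@complex.Im R).

Definition cdiff (f : V -> C) (x : V) :=
  differentiable (re \o f) x /\ differentiable (im \o f) x.

Definition cD (v : V) (f : V -> C) (x : V) : C :=
  'D_v (re \o f) x +i* 'D_v (im \o f) x.

Definition has_cD (v : V) (f : V -> C) (x : V) (d : C) :=
  cdiff f x /\ cD v f x = d.

Lemma has_cDP v f x d : has_cD v f x d <->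
  [/\ cdiff f x, is_derive x v (re \o f) (re d) & is_derive x v (im \o f) (im d)].
Proof.
split=> [[[dr di] <-]|[df [_ er] [_ ei]]].
  by split=> //; apply: derivableP; exact: diff_derivable.
by split=> //; rewrite /cD er ei; case: (d).
Qed.

Lemma has_cD_ext v f g x d : f =1 g -> has_cD v f x d -> has_cD v g x d.
Proof. by move=> /funext ->. Qed.

Lemma has_cD_near v f g x d :
  (\near x, f x = g x) -> has_cD v f x d -> has_cD v g x d.
Proof.
move=> fg /has_cDP[[dr di] Dr Di].
have fgr : \near x, (re \o f) x = (re \o g) x.
  by apply: filterS fg => y /= ->.
have fgi : \near x, (im \o f) x = (im \o g) x.
  by apply: filterS fg => y /= ->.
apply/has_cDP; split.
- split; [exact: near_eq_differentiable dr|exact: near_eq_differentiable di].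
- exact: near_eq_is_derive Dr.
- exact: near_eq_is_derive Di.
Qed.

Lemma has_cD_cst v c x : has_cD v (cst c) x 0.
Proof.
apply/has_cDP; split; first by split; exact: differentiable_cst.
  exact: is_derive_cst.
exact: is_derive_cst.
Qed.

Lemma has_cDD v f g x df dg :
  has_cD v f x df -> has_cD v g x dg -> has_cD v (f \+ g) x (df + dg).
Proof.
move=> /has_cDP[[fr fi] Fr Fi] /has_cDP[[gr gi] Gr Gi].
have er : re \o (f \+ g) = (re \o f) + (re \o g).
  by apply/funext => y; rewrite /= !fctE /=; case: (f y) => ? ?; case: (g y) => ? ?.
have ei : im \o (f \+ g) = (im \o f) + (im \o g).
  by apply/funext => y; rewrite /= !fctE /=; case: (f y) => ? ?; case: (g y) => ? ?.
apply/has_cDP; split; rewrite ?er ?ei.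
- by split; rewrite ?er ?ei; exact: differentiableD.
- by apply: is_derive_eq; case: (df); case: (dg).
- by apply: is_derive_eq; case: (df); case: (dg).
Qed.

Lemma has_cDM v f g x df dg : has_cD v f x df -> has_cD v g x dg ->
  has_cD v (f \* g) x (df * g x + f x * dg).
Proof.
move=> /has_cDP[[fr fi] Fr Fi] /has_cDP[[gr gi] Gr Gi].
have er : re \o (f \* g) = (re \o f) * (re \o g) - (im \o f) * (im \o g).
  by apply/funext => y; rewrite /= !fctE /=; case: (f y) => ? ?; case: (g y) => ? ?.
have ei : im \o (f \* g) = (re \o f) * (im \o g) + (im \o f) * (re \o g).
  by apply/funext => y; rewrite /= !fctE /=; case: (f y) => ? ?; case: (g y) => ? ?.
apply/has_cDP; split; rewrite ?er ?ei.
- split; rewrite ?er ?ei.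
    by apply: differentiableB; exact: differentiableM.
  by apply: differentiableD; exact: differentiableM.
- apply: is_derive_eq; move: (df) (dg) => [a b] [c d] /=.
  by case: (f x) => ? ?; case: (g x) => ? ? /=; rewrite /GRing.scale /=; ring.
- apply: is_derive_eq; move: (df) (dg) => [a b] [c d] /=.
  by case: (f x) => ? ?; case: (g x) => ? ? /=; rewrite /GRing.scale /=; ring.
Qed.

Lemma has_cD_real v (f : V -> R) x d : differentiable f x -> is_derive x v f d ->
  has_cD v (fun y => (f y)%:C) x d%:C.
Proof.
move=> df Df; apply/has_cDP; split=> //=.
- by split=> //; exact: differentiable_cst.
- exact: is_derive_cst.
Qed.

Lemma has_cDZ v f x df c : has_cD v f x df ->
  has_cD v (fun y => c * f y) x (c * df).
Proof.
move=> Df; have := has_cDM (has_cD_cst v c x) Df.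
by rewrite mul0r add0r.
Qed.

Lemma has_cD_uniq v f x d d' : has_cD v f x d -> has_cD v f x d' -> d = d'.
Proof. by move=> [_ <-] [_ <-]. Qed.

End ComplexDerivative.

Lemma has_cD_comp (R : realType) (V : normedModType R) (h : R -> R[i])
    (N : V -> R) (v x : V) dh dN :
  has_cD (1 : R) h (N x) dh -> differentiable N x -> is_derive x v N dN ->
  has_cD v (h \o N) x (dh * dN%:C).
Proof.
move=> /has_cDP[[hr hi] Hr Hi] dN' DN.
have cmp (k : R -> R) dk : differentiable k (N x) -> is_derive (N x) 1 k dk ->
    differentiable (k \o N) x /\ is_derive x v (k \o N) (dk * dN).
  move=> dfk Dk; have dkN : differentiable (k \o N) x.
    exact: differentiable_comp.
  split=> //; apply: DeriveDef; first exact: diff_derivable.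
  rewrite deriveE // diff_comp //=.
  have <- : 'd N x v = dN by rewrite -deriveE //; exact: derive_val.
  have <- : 'd k (N x) 1 = dk by rewrite -deriveE //; exact: derive_val.
  rewrite -[in LHS](mulr1 ('d N x v)).
  by rewrite -[_ * 1]/(('d N x v) *: (1:R)) linearZ /= mulrC.
have [d1 D1] := cmp _ _ hr Hr; have [d2 D2] := cmp _ _ hi Hi.
apply/has_cDP; split=> //.
  by move: (dh) D1 => [a b] /=; rewrite mulr0 subr0.
by move: (dh) D2 => [a b] /=; rewrite mulr0 add0r.
Qed.

Section RadialDerivative.
Variable R : realType.
Local Notation C := R[i].
Implicit Types f g : R -> C.

Definition cder f f' := forall r : R, 0 < r -> has_cD (1 : R) f r (f' r).

Lemma near_pos (r : R) : 0 < r -> \forall y \near r, 0 < y.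
Proof.
move=> r0; exact: lt_nbhsr.
Qed.

Lemma realC_neq0 (r : R) : 0 < r -> r%:C != 0.
Proof. by move=> r0; rewrite fmorph_eq0 lt0r_neq0. Qed.

Lemma cder_ext f g f' g' : (forall r, 0 < r -> f r = g r) ->
  (forall r, 0 < r -> f' r = g' r) -> cder f f' -> cder g g'.
Proof.
move=> fg fg' ff' r r0; rewrite -fg' //; apply: has_cD_near (ff' r r0).
by apply: filterS (near_pos r0) => y; exact: fg.
Qed.

Lemma cder_uniq f f1 f2 : cder f f1 -> cder f f2 -> forall r, 0 < r -> f1 r = f2 r.
Proof. by move=> h1 h2 r r0; exact: has_cD_uniq (h1 r r0) (h2 r r0). Qed.

Lemma cderD f g f' g' : cder f f' -> cder g g' -> cder (f \+ g) (f' \+ g').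
Proof. by move=> ff gg r r0; exact: has_cDD (ff r r0) (gg r r0). Qed.

Lemma cderM f g f' g' : cder f f' -> cder g g' ->
  cder (f \* g) (fun r => f' r * g r + f r * g' r).
Proof. by move=> ff gg r r0; exact: has_cDM (ff r r0) (gg r r0). Qed.

Lemma cderZ f f' c : cder f f' -> cder (fun r => c * f r) (fun r => c * f' r).
Proof. by move=> ff r r0; exact: has_cDZ (ff r r0). Qed.

Lemma cder_cst c : cder (fun=> c) (fun=> 0).
Proof. by move=> r _; exact: has_cD_cst. Qed.

Lemma cder_real (f f' : R -> R) :
  (forall r : R, 0 < r -> is_derive r (1 : R) f (f' r)) ->
  cder (fun r => (f r)%:C) (fun r => (f' r)%:C).
Proof.
move=> ff r r0; have D := ff r r0; apply: has_cD_real => //.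
by apply/derivable1_diffP.
Qed.

Lemma cder_id : cder (fun r => r%:C) (fun=> 1).
Proof. by have := @cder_real id (fun=> 1); apply => r _; exact: is_derive_id. Qed.

Lemma cder_inv : cder (fun r => r%:C^-1) (fun r => - r%:C ^- 2).
Proof.
apply: (@cder_ext (fun r => (r^-1)%:C) _ (fun r => (- r ^- 2)%:C)).
- by move=> r _; rewrite fmorphV.
- by move=> r _; rewrite rmorphN fmorphV rmorphXn.
- apply: cder_real => r r0.
  have := @is_deriveV R id r 1 1 (lt0r_neq0 r0) (is_derive_id _ _).
  by rewrite /GRing.scale /= mulr1.
Qed.

Lemma cder_exp n : cder (fun r => r%:C ^+ n) (fun r => n%:R * r%:C ^+ n / r%:C).
Proof.
elim: n => [|n IHn].
  by apply: cder_ext (cder_cst 1) => r _; rewrite ?expr0 ?mul0r.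
apply: cder_ext (cderM cder_id IHn) => r r0 /=; first by rewrite exprS.
by rewrite exprS; field; exact: realC_neq0.
Qed.

Lemma cder_ln : cder (fun r => (ln r)%:C) (fun r => r%:C^-1).
Proof.
apply: (@cder_ext (fun r => (ln r)%:C) _ (fun r => (r^-1)%:C)) => //.
- by move=> r _; rewrite fmorphV.
- by apply: cder_real => r r0; exact: is_derive1_ln.
Qed.

Fixpoint cCn (n : nat) f : Prop :=
  if n is n'.+1 then exists2 f', cder f f' & cCn n' f' else True.

Definition rsmooth f := forall n, cCn n f.

Lemma cCn_ext n f g : (forall r, 0 < r -> f r = g r) -> cCn n f -> cCn n g.
Proof.
case: n => // n fg [f' ff' Cf']; exists f' => //.
exact: cder_ext ff'.
Qed.

Lemma cCnS n f : cCn n.+1 f -> cCn n f.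
Proof.
by elim: n f => // n IHn f [f' ff' /IHn Cf']; exists f'.
Qed.

Lemma cCnD n f g : cCn n f -> cCn n g -> cCn n (f \+ g).
Proof.
elim: n f g => // n IHn f g [f' ff' Cf'] [g' gg' Cg'].
by exists (f' \+ g'); [exact: cderD|exact: IHn].
Qed.

Lemma cCnM n f g : cCn n f -> cCn n g -> cCn n (f \* g).
Proof.
elim: n f g => // n IHn f g Cf Cg.
have := Cf; have := Cg => -[g' gg' Cg'] [f' ff' Cf'].
exists (fun r => f' r * g r + f r * g' r); first exact: cderM.
have := cCnD (IHn _ _ Cf' (cCnS Cg)) (IHn _ _ (cCnS Cf) Cg').
exact: cCn_ext.
Qed.

Lemma cCn_cst n c : cCn n (fun=> c).
Proof. by elim: n c => // n IHn c; exists (fun=> 0) => //; exact: cder_cst. Qed.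

Lemma cCnZ n c f : cCn n f -> cCn n (fun r => c * f r).
Proof. by move=> Cf; exact: cCnM (cCn_cst n c) Cf. Qed.

Lemma cCn_inv n : cCn n (fun r => r%:C^-1).
Proof.
elim: n => // n IHn; exists (fun r => - r%:C ^- 2); first exact: cder_inv.
apply: cCn_ext (cCnZ (-1) (cCnM IHn IHn)) => r _ /=.
by rewrite mulN1r expr2 invfM.
Qed.

Lemma rsmooth_der f f' : rsmooth f -> cder f f' -> rsmooth f'.
Proof.
move=> Sf ff' n; have [g fg Cg] := Sf n.+1.
by apply: cCn_ext Cg; exact: cder_uniq fg ff'.
Qed.

Lemma rsmooth_ex f : rsmooth f -> exists2 f', cder f f' & rsmooth f'.
Proof. by move=> Sf; have [f' ff' _] := Sf 1%N; exists f' => //; exact: rsmooth_der ff'. Qed.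

Lemma rsmooth_ext f g : (forall r, 0 < r -> f r = g r) -> rsmooth f -> rsmooth g.
Proof. by move=> fg Sf n; exact: cCn_ext (Sf n). Qed.

Lemma rsmoothM f g : rsmooth f -> rsmooth g -> rsmooth (f \* g).
Proof. by move=> Sf Sg n; exact: cCnM. Qed.

Lemma rsmooth_inv : rsmooth (fun r => r%:C^-1).
Proof. by move=> n; exact: cCn_inv. Qed.

Lemma rsmooth_cst c : rsmooth (fun=> c).
Proof. by move=> n; exact: cCn_cst. Qed.

(* Composition with exp reduces this to functions on the whole line. *)
Lemma cder_0_cst f : cder f (fun=> 0) -> forall r s, 0 < r -> 0 < s -> f r = f s.
Proof.
move=> f0 r s r0 s0.
have D (x : R) : has_cD (1 : R) (f \o expR) x 0.
  have := @has_cD_comp _ (R : normedModType R) f expR 1 x 0 (expR x) (f0 _ (expR_gt0 x)).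
  rewrite mul0r; apply; first by apply/derivable1_diffP; exact: derivable_expR.
have e x : f (expR x) = f (expR 0).
  have := D; move=> D'.
  have Er y : is_derive y (1 : R) ((@complex.Re R) \o (f \o expR)) 0.
    by have /has_cDP[] := D y.
  have Ei y : is_derive y (1 : R) ((@complex.Im R) \o (f \o expR)) 0.
    by have /has_cDP[] := D y.
  have /= := is_derive_0_is_cst x 0 Er; have /= := is_derive_0_is_cst x 0 Ei.
  by case: (f (expR x)) => ? ?; case: (f (expR 0)) => ? ? /= -> ->.
by rewrite -(lnK r0) -(lnK s0) e [RHS]e.
Qed.

End RadialDerivative.

Section LinearSpan.
Variables (K : pzRingType) (V : lmodType K).
Implicit Types (S T : set V).

Lemma lspan_gen S v : S v -> lspan S v.
Proof.
move=> Sv; exists 1%N, (fun=> 1), (fun=> v); split=> //.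
by rewrite big_ord1 scale1r.
Qed.

Lemma lspanD S u v : lspan S u -> lspan S v -> lspan S (u + v).
Proof. by move=> Su Sv; rewrite -[u]scale1r; exact: lspan_linear. Qed.

Lemma lspanZ S a u : lspan S u -> lspan S (a *: u).
Proof. by move=> Su; rewrite -[_ *: _]addr0; apply: lspan_linear => //; exact: lspan0. Qed.

Lemma lspanB S u v : lspan S u -> lspan S v -> lspan S (u - v).
Proof. by move=> Su Sv; rewrite addrC -scaleN1r; exact: lspan_linear. Qed.

Lemma lspan_sum S (I : Type) (r : seq I) (P : pred I) (F : I -> V) :
  (forall i, P i -> lspan S (F i)) -> lspan S (\sum_(i <- r | P i) F i).
Proof.
move=> SF; elim/big_rec: _ => [|i x Pi Sx]; first exact: lspan0.
by apply: lspanD => //; exact: SF.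
Qed.

Lemma lspan_ind S (T : V -> Prop) : T 0 ->
  (forall a u v, T u -> T v -> T (a *: u + v)) ->
  (forall v, S v -> T v) -> forall v, lspan S v -> T v.
Proof.
move=> T0 Tlin ST v [n [c [w [Sw ->]]]].
elim: n c w Sw => [|n IHn] c w Sw; first by rewrite big_ord0.
rewrite big_ord_recl; apply: Tlin; first exact/ST.
by apply: (IHn (fun i => c (lift ord0 i)) (fun i => w (lift ord0 i))) => i; exact: Sw.
Qed.

Lemma lspan_sub S T : (forall v, S v -> lspan T v) -> forall v, lspan S v -> lspan T v.
Proof.
move=> ST; apply: lspan_ind => //; first exact: lspan0.
by move=> a u v; exact: lspan_linear.
Qed.

Lemma lspan_predE S v : (v \in lspan_pred S) <-> lspan S v.
Proof. by split=> [/asboolP|?]; [|apply/asboolP]. Qed.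

End LinearSpan.

(** * Polynomial functions and harmonics *)

Section Functions.
Variable R : realType.
Local Notation C := R[i].
Local Notation fn := (fn R).
Local Notation space0 := (space0 R).
Local Notation rad := (@Defs.rad R).
Implicit Types (f g P Q : fn) (x : space0) (i j k : 'I_3).

(* Locked, so that conversion never unfolds derivatives of functions. *)
Definition pd : 'I_3 -> fn -> fn := locked (@partial R).
Definition xm : 'I_3 -> fn -> fn := locked (fun i f x => (val x i 0)%:C * f x).
Definition rp : (R -> C) -> fn -> fn := locked (fun psi P x => psi (rad x) * P x).
Definition fdiff f := forall x, cdiff (ext f) (val x).

Lemma fnP f g : (forall x, f x = g x) -> f = g.
Proof. by move=> fg; exact/funext. Qed.

Lemma fnD f g x : (f + g) x = f x + g x. Proof. by []. Qed.
Lemma fnN f x : (- f) x = - f x. Proof. by []. Qed.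
Lemma fnZ a f x : (a *: f) x = a * f x. Proof. by []. Qed.
Lemma fn0 x : (0 : fn) x = 0. Proof. by []. Qed.
Lemma fn_sum (I : Type) (r : seq I) (P : pred I) (F : I -> fn) x :
  (\sum_(i <- r | P i) F i) x = \sum_(i <- r | P i) F i x.
Proof. by elim/big_rec2: _ => // i a b Pi <-. Qed.

Lemma xmE i f x : xm i f x = (val x i 0)%:C * f x.
Proof. by rewrite /xm -lock. Qed.

Lemma rpE psi P x : rp psi P x = psi (rad x) * P x.
Proof. by rewrite /rp -lock. Qed.

Lemma pdE : @partial R = pd.
Proof. by rewrite /pd -lock. Qed.

Definition fnE := (fnD, fnN, fnZ, fn0, fn_sum, xmE, rpE).

Lemma ext_val f x : ext f (val x) = f x.
Proof. by rewrite /ext valK. Qed.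

Lemma near_neq0 x : \forall y \near val x, y != 0.
Proof.
have x0 : 0 < `|val x| by rewrite normr_gt0 (valP x).
apply: filterS (nbhsx_ballx (val x) _ x0) => y.
by rewrite -ball_normE /=; apply: contraTneq => ->; rewrite subr0 ltxx.
Qed.

Lemma has_cD_ext0 (F : 'cV[R]_3 -> C) f v x d : (forall x, F (val x) = f x) ->
  has_cD v F (val x) d -> has_cD v (ext f) (val x) d.
Proof.
move=> Ff; apply: has_cD_near; apply: filterS (near_neq0 x) => y y0.
by rewrite /ext insubT /= -Ff.
Qed.

Lemma partialE i f x d : has_cD (delta_mx i 0) (ext f) (val x) d -> pd i f x = d.
Proof. by rewrite -pdE; case. Qed.

Lemma has_partial i f x : fdiff f -> has_cD (delta_mx i 0) (ext f) (val x) (pd i f x).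
Proof. by rewrite -pdE. Qed.

Lemma has_partial_lin i a f g x : fdiff f -> fdiff g ->
  has_cD (delta_mx i 0) (ext (a *: f + g)) (val x) (a * pd i f x + pd i g x).
Proof.
move=> df dg; have := has_cDD (has_cDZ a (has_partial i x df)) (has_partial i x dg).
by apply: has_cD_ext0 => y /=; rewrite !ext_val.
Qed.

Lemma fdiff_lin a f g : fdiff f -> fdiff g -> fdiff (a *: f + g).
Proof. by move=> df dg x; have [] := has_partial_lin 0 a x df dg. Qed.

Lemma partial_lin i a f g : fdiff f -> fdiff g ->
  pd i (a *: f + g) = a *: pd i f + pd i g.
Proof. by move=> df dg; apply: fnP => x; exact/partialE/has_partial_lin. Qed.

Lemma is_derive_coord i (v y : 'cV[R]_3) :
  is_derive y v (fun y : 'cV[R]_3 => y i 0) (v i 0).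
Proof.
have @f : {linear 'cV[R]_3 -> R}.
  by exists (fun N : 'cV[R]_3 => N i 0); do 2![eexists]; do ?[constructor];
     rewrite ?mxE// => ? *; rewrite ?mxE//; move=> ?; rewrite !mxE.
have df := @differentiable_coord R 3 1 y i 0.
apply: DeriveDef; first exact: diff_derivable.
rewrite deriveE // (_ : (fun y : 'cV[R]_3 => y i 0) = f) // diff_lin //.
exact: coord_continuous.
Qed.

Lemma has_cD_coord i (v y : 'cV[R]_3) :
  has_cD v (fun y : 'cV[R]_3 => (y i 0)%:C) y (v i 0)%:C.
Proof.
apply: has_cD_real; first exact: differentiable_coord.
exact: is_derive_coord.
Qed.

Lemma has_partial_xm i j f x : fdiff f ->
  has_cD (delta_mx j 0) (ext (xm i f)) (val x)
    ((i == j)%:R * f x + (val x i 0)%:C * pd j f x).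
Proof.
move=> df; have := has_cDM (has_cD_coord i (delta_mx j 0) (val x)) (has_partial j x df).
rewrite ext_val mxE eqxx andbT.
have -> : ((i == j)%:R : R)%:C = (i == j)%:R by case: (i == j).
by apply: has_cD_ext0 => y /=; rewrite ext_val fnE.
Qed.

Lemma fdiff_xm i f : fdiff f -> fdiff (xm i f).
Proof. by move=> df x; have [] := has_partial_xm i 0 x df. Qed.

Lemma partial_xm i j f : fdiff f ->
  pd j (xm i f) = (i == j)%:R *: f + xm i (pd j f).
Proof.
move=> df; apply: fnP => x; rewrite (partialE (has_partial_xm i j x df)).
by rewrite !fnE.
Qed.

Lemma has_partial_cst i c x : has_cD (delta_mx i 0) (ext (fun=> c : C)) (val x) 0.
Proof. by apply: has_cD_ext0 (has_cD_cst _ c _) => y. Qed.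

Lemma fdiff_cst c : fdiff (fun=> c).
Proof. by move=> x; have [] := has_partial_cst 0 c x. Qed.

Lemma partial_cst i (c : C) : pd i (fun=> c) = (0 : fn).
Proof. by apply: fnP => x; exact/partialE/has_partial_cst. Qed.

Definition nrm (y : 'cV[R]_3) : R := Num.sqrt (\sum_i y i 0 ^+ 2).

Lemma sum_sqr_gt0 x : 0 < \sum_i val x i 0 ^+ 2.
Proof.
rewrite lt_neqAle sumr_ge0 => [|i _]; last exact: sqr_ge0.
rewrite andbT eq_sym; apply: contra (valP x) => /eqP /psumr_eq0P.
move=> /(_ (fun i _ => sqr_ge0 _)) x0; apply/eqP/matrixP => i j.
by rewrite (ord1 j) mxE; apply/eqP; rewrite -sqrf_eq0 x0.
Qed.

Lemma rad_gt0 x : 0 < rad x.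
Proof. by rewrite sqrtr_gt0 sum_sqr_gt0. Qed.

Lemma rad_sqr x : rad x ^+ 2 = \sum_i val x i 0 ^+ 2.
Proof. by rewrite sqr_sqrtr // ltW // sum_sqr_gt0. Qed.

Lemma rad_sqrC x : (rad x)%:C ^+ 2 = \sum_i (val x i 0)%:C ^+ 2.
Proof. by rewrite -rmorphXn rad_sqr rmorph_sum; apply: eq_bigr => i _; rewrite rmorphXn. Qed.

Lemma nrm_derive i x : differentiable nrm (val x) /\
  is_derive (val x) (delta_mx i 0 : 'cV[R]_3) nrm (val x i 0 / rad x).
Proof.
pose s (y : 'cV[R]_3) := \sum_j y j 0 ^+ 2.
have ds j : differentiable (fun y : 'cV[R]_3 => y j 0 ^+ 2) (val x).
  have dj := @differentiable_coord R 3 1 (val x) j 0.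
  rewrite (_ : (fun y : 'cV[R]_3 => y j 0 ^+ 2) =
    (fun y : 'cV[R]_3 => y j 0) * (fun y : 'cV[R]_3 => y j 0)) //.
  exact: differentiableM.
have sE : s = \sum_(j < 3) (fun y : 'cV[R]_3 => y j 0 ^+ 2).
  by apply/funext => y; rewrite fct_sumE.
have dS : differentiable s (val x) by rewrite sE; exact: differentiable_sum.
have DS : is_derive (val x) (delta_mx i 0 : 'cV[R]_3) s (2 * val x i 0).
  have D j := is_deriveX 2 (is_derive_coord j (delta_mx i 0) (val x)).
  rewrite sE; apply: (is_derive_eq (is_derive_sum D)).
  rewrite (bigD1 i) //= big1 ?addr0 => [|j ji]; last first.
    by rewrite mxE (negbTE ji) /GRing.scale /= mulr0.
  by rewrite mxE !eqxx /GRing.scale /= expr1 mulr1.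
have sx : 0 < s (val x) := sum_sqr_gt0 x.
have dq : differentiable (@Num.sqrt R) (s (val x)).
  by apply/derivable1_diffP; have [] := is_derive1_sqrt sx.
have dn : differentiable nrm (val x).
  by apply: (@differentiable_comp _ _ _ _ s (@Num.sqrt R)).
split=> //; apply: DeriveDef; first exact: diff_derivable.
have := @has_cD_comp _ _ (fun r => (Num.sqrt r)%:C) s (delta_mx i 0) (val x)
  (((2 * Num.sqrt (s (val x)))^-1)%:C) (2 * val x i 0).
move=> /(_ _ dS DS); case.
  by apply: has_cD_real => //; exact: is_derive1_sqrt.
move=> _; rewrite -rmorphM /cD => -[-> _].
by rewrite /rad -/(s _); field; rewrite gt_eqF // sqrtr_gt0.
Qed.

Lemma has_cD_rad i (psi psi' : R -> C) x : cder psi psi' ->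
  has_cD (delta_mx i 0) (psi \o nrm) (val x)
    (psi' (rad x) / (rad x)%:C * (val x i 0)%:C).
Proof.
move=> /(_ _ (rad_gt0 x)) D; have [dn Dn] := nrm_derive i x.
have := @has_cD_comp _ _ psi nrm _ _ _ _ D dn Dn.
by rewrite rmorphM fmorphV -mulrA [X in _ * X]mulrC.
Qed.

Lemma has_partial_rp i (psi psi' : R -> C) P x : cder psi psi' -> fdiff P ->
  has_cD (delta_mx i 0) (ext (rp psi P)) (val x)
    (rp (fun r => psi' r / r%:C) (xm i P) x + rp psi (pd i P) x).
Proof.
move=> D dP; have := has_cDM (has_cD_rad i x D) (has_partial i x dP).
rewrite ext_val [X in has_cD _ _ _ X](_ : _ =
  rp (fun r => psi' r / r%:C) (xm i P) x + rp psi (pd i P) x); last first.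
  by rewrite !fnE mulrA.
by apply: has_cD_ext0 => y /=; rewrite ext_val fnE.
Qed.

Lemma fdiff_rp psi psi' P : cder psi psi' -> fdiff P -> fdiff (rp psi P).
Proof. by move=> D dP x; have [] := has_partial_rp 0 x D dP. Qed.

Lemma partial_rp i (psi psi' : R -> C) P : cder psi psi' -> fdiff P ->
  pd i (rp psi P) =
  rp (fun r => psi' r / r%:C) (xm i P) + rp psi (pd i P).
Proof. by move=> D dP; apply: fnP => x; exact/partialE/has_partial_rp. Qed.

Lemma partial0 i : pd i (0 : fn) = 0.
Proof. exact: partial_cst. Qed.

Lemma fdiff0 : fdiff 0.
Proof. exact: fdiff_cst. Qed.

Lemma fdiffD f g : fdiff f -> fdiff g -> fdiff (f + g).
Proof. by move=> df dg; rewrite -[f]scale1r; exact: fdiff_lin. Qed.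

Lemma fdiffZ a f : fdiff f -> fdiff (a *: f).
Proof. by move=> df; rewrite -[_ *: _]addr0; exact: fdiff_lin fdiff0. Qed.

Lemma partialD i f g : fdiff f -> fdiff g -> pd i (f + g) = pd i f + pd i g.
Proof. by move=> df dg; rewrite -[f]scale1r partial_lin // !scale1r. Qed.

Lemma partialZ i a f : fdiff f -> pd i (a *: f) = a *: pd i f.
Proof.
move=> df; have := partial_lin i a df fdiff0.
by rewrite partial0 !addr0.
Qed.

Lemma partialB i f g : fdiff f -> fdiff g -> pd i (f - g) = pd i f - pd i g.
Proof.
move=> df dg; rewrite partialD //; last by rewrite -scaleN1r; exact: fdiffZ.
by rewrite -[- g]scaleN1r partialZ // scaleN1r.
Qed.

Lemma fdiff_sum (I : Type) (r : seq I) (F : I -> fn) :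
  (forall a, fdiff (F a)) -> fdiff (\sum_(k <- r) F k).
Proof.
by move=> dF; elim/big_rec: _ => [|k f _ df]; [exact: fdiff0|exact: fdiffD].
Qed.

Lemma partial_sum (I : Type) (r : seq I) (F : I -> fn) i :
  (forall a, fdiff (F a)) ->
  pd i (\sum_(k <- r) F k) = \sum_(k <- r) pd i (F k).
Proof.
move=> dF; elim: r => [|k r IHr]; first by rewrite !big_nil partial0.
by rewrite !big_cons partialD ?IHr //; exact: fdiff_sum.
Qed.

Lemma xm_lin i a f g : xm i (a *: f + g) = a *: xm i f + xm i g.
Proof. by apply: fnP => x; rewrite !fnE; ring. Qed.

Lemma xm0 i : xm i 0 = 0.
Proof. by apply: fnP => x; rewrite !fnE mulr0. Qed.

Lemma xmD i f g : xm i (f + g) = xm i f + xm i g.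
Proof. by apply: fnP => x; rewrite !fnE; ring. Qed.

Lemma xmZ i a f : xm i (a *: f) = a *: xm i f.
Proof. by apply: fnP => x; rewrite !fnE; ring. Qed.

Lemma xmC i j f : xm i (xm j f) = xm j (xm i f).
Proof. by apply: fnP => x; rewrite !fnE; ring. Qed.

Lemma xm_sum (I : Type) (r : seq I) (F : I -> fn) i :
  xm i (\sum_(a <- r) F a) = \sum_(a <- r) xm i (F a).
Proof. by apply: fnP => x; rewrite !fnE mulr_sumr; apply: eq_bigr => a _; rewrite fnE. Qed.

Lemma rpD psi P Q : rp psi (P + Q) = rp psi P + rp psi Q.
Proof. by apply: fnP => x; rewrite !fnE; ring. Qed.

Lemma rpZ psi a P : rp psi (a *: P) = a *: rp psi P.
Proof. by apply: fnP => x; rewrite !fnE; ring. Qed.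

Lemma rp0 psi : rp psi 0 = 0.
Proof. by apply: fnP => x; rewrite !fnE mulr0. Qed.

Lemma rp_ext phi psi P : (forall r, 0 < r -> phi r = psi r) -> rp phi P = rp psi P.
Proof. by move=> e; apply: fnP => x; rewrite !fnE e // rad_gt0. Qed.

Section Polynomials.
Local Notation homogeneous := (@homogeneous R).

Definition mono (m : 'I_3 -> nat) : fn := fun x => \prod_i (val x i 0)%:C ^+ m i.

Lemma mono_xm i m : xm i (mono m) = mono (fun j => (i == j) + m j)%N.
Proof.
apply: fnP => x; rewrite xmE /mono (bigD1 i) //= [RHS](bigD1 i) //= eqxx add1n exprS.
rewrite mulrA; congr (_ * _); apply: eq_bigr => j ji.
by rewrite eq_sym (negbTE ji).
Qed.

Lemma homogeneous_xm l i f : homogeneous l f -> homogeneous l.+1 (xm i f).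
Proof.
move: f; apply: lspan_ind.
- by rewrite xm0; exact: lspan0.
- by move=> a f g hf hg; rewrite xm_lin; exact: lspan_linear.
- move=> f [m [ml ->]]; rewrite [xm _ _](mono_xm i m).
  apply: lspan_gen; exists (fun j => (i == j) + m j)%N; split=> //.
  rewrite big_split /= ml (bigD1 i) //= eqxx big1 // => j ji.
  by rewrite eq_sym (negbTE ji).
Qed.

Lemma homogeneous_cst c : homogeneous 0 (fun=> c).
Proof.
rewrite (_ : (fun=> c) = c *: mono (fun=> 0%N)); last first.
  by apply: fnP => x; rewrite fnE /mono big1 ?mulr1.
apply: lspanZ; apply: lspan_gen; exists (fun=> 0%N); split=> //.
by rewrite big1.
Qed.

Lemma homogeneous_ind (T : nat -> fn -> Prop) :
  (forall c, T 0%N (fun=> c)) ->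
  (forall l a f g, homogeneous l f -> homogeneous l g ->
     T l f -> T l g -> T l (a *: f + g)) ->
  (forall l i f, homogeneous l f -> T l f -> T l.+1 (xm i f)) ->
  forall l f, homogeneous l f -> T l f.
Proof.
move=> Tc Tl Tx l f hf.
suff [] : homogeneous l f /\ T l f by [].
have T0 m : T m 0.
  by elim: m => [|m IHm]; [exact: Tc|rewrite -(xm0 0); apply: Tx => //; exact: lspan0].
move: f hf; apply: lspan_ind.
- by split=> //; exact: lspan0.
- by move=> a f g [hf Tf] [hg Tg]; split; [exact: lspan_linear|exact: Tl].
move=> f [m [ml ->]]; rewrite -/(mono m).
elim: l m ml => [|l IHl] m ml.
  have -> : mono m = fun=> 1.
    apply: fnP => x; rewrite /mono big1 // => i _.
    by have /eqP := ml; rewrite sum_nat_eq0 => /forallP/(_ i)/eqP ->.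
  by split; [exact: homogeneous_cst|exact: Tc].
have [i mi] : exists i, (0 < m i)%N.
  apply/existsP; apply: contraT; rewrite negb_exists => /forallP m0.
  move: ml; rewrite big1 // => i _; move: (m0 i); by rewrite -eqn0Ngt => /eqP.
pose m' j := (m j - (i == j))%N.
have -> : mono m = xm i (mono m').
  rewrite mono_xm; congr mono; apply/funext => j; rewrite /m'.
  by have [<-|] := eqVneq i j; rewrite ?subn0 // subnKC.
have [hm Tm] : homogeneous l (mono m') /\ T l (mono m').
  apply: IHl; rewrite /m'; move: ml; rewrite (bigD1 i) //= [X in _ -> X = _](bigD1 i) //= eqxx.
  move=> ml; apply/eqP; rewrite -(eqn_add2l 1) addnA subnKC // add1n -ml; apply/eqP.
  congr (_ + _)%N; apply: eq_bigr => j ji.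
  by rewrite eq_sym (negbTE ji) subn0.
by split; [exact: homogeneous_xm|exact: Tx].
Qed.

Lemma hom_diff_partial l f : homogeneous l f -> fdiff f /\ forall i,
  if l is l'.+1 then homogeneous l' (pd i f) else pd i f = 0.
Proof.
move: l f; apply: homogeneous_ind => [c|l a f g _ _ [df pf] [dg pg]|l i f hf [df pf]].
- by split=> [|i]; [exact: fdiff_cst|exact: partial_cst].
- split=> [|i]; first exact: fdiff_lin.
  rewrite partial_lin //; case: l pf pg => [|l] pf pg.
    by rewrite pf pg scaler0 addr0.
  exact: lspan_linear (pf i) (pg i).
split=> [|j]; first exact: fdiff_xm.
rewrite partial_xm //; apply: lspanD; first exact: lspanZ.
case: l pf hf => [|l] pf hf; last exact: homogeneous_xm.
by rewrite pf xm0; exact: lspan0.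
Qed.

Lemma hom_diff l f : homogeneous l f -> fdiff f.
Proof. by case/hom_diff_partial. Qed.

Lemma hom_partial l i f : homogeneous l.+1 f -> homogeneous l (pd i f).
Proof. by case/hom_diff_partial. Qed.

Lemma hom0_partial i f : homogeneous 0 f -> pd i f = 0.
Proof. by case/hom_diff_partial. Qed.

Lemma hom_partial_pred l i f : homogeneous l f -> homogeneous l.-1 (pd i f).
Proof.
case: l => [/hom0_partial ->|l]; first exact: lspan0.
exact: hom_partial.
Qed.

Lemma hom_partial_diff l i f : homogeneous l f -> fdiff (pd i f).
Proof. by move=> /(hom_partial_pred i)/hom_diff. Qed.

Lemma hom_partialC l f i j : homogeneous l f ->
  pd i (pd j f) = pd j (pd i f).
Proof.
move: l f; apply: homogeneous_ind => [c|l a f g hf hg Ef Eg|l k f hf Ef].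
- by rewrite !partial_cst.
- have [df dg] := (hom_diff hf, hom_diff hg).
  have dpf m := hom_partial_diff m hf; have dpg m := hom_partial_diff m hg.
  by rewrite !(partial_lin _ _ df dg) !(partial_lin _ _ (dpf _) (dpg _)) Ef Eg.
- have df := hom_diff hf; have dpf m := hom_partial_diff m hf.
  have E m n : pd m (pd n (xm k f)) =
      (k == n)%:R *: pd m f + ((k == m)%:R *: pd n f + xm k (pd m (pd n f))).
    rewrite (partial_xm _ _ df) partialD; last 2 first.
    + exact: fdiffZ.
    + exact: fdiff_xm.
    by rewrite (partialZ _ _ df) (partial_xm _ _ (dpf n)).
  by rewrite !E Ef; exact: addrCA.
Qed.

Definition euler f : fn := \sum_i xm i (pd i f).

Lemma hom_euler l f : homogeneous l f -> euler f = l%:R *: f.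
Proof.
move: l f; apply: homogeneous_ind => [c|l a f g hf hg Ef Eg|l k f hf Ef].
- rewrite scale0r /euler big1 // => i _.
  by rewrite partial_cst xm0.
- have -> : euler (a *: f + g) = a *: euler f + euler g.
    rewrite /euler scaler_sumr -big_split; apply: eq_bigr => i _.
    by rewrite partial_lin ?xm_lin //; [exact: hom_diff hf|exact: hom_diff hg].
  by rewrite Ef Eg scalerDr !scalerA mulrC.
- have -> : euler (xm k f) = xm k f + xm k (euler f).
    rewrite /euler xm_sum (eq_bigr (fun i =>
      (k == i)%:R *: xm i f + xm k (xm i (pd i f)))); last first.
      by move=> i _; rewrite partial_xm ?xmD ?xmZ 1?[xm i (xm k _)]xmC //; exact: hom_diff hf.
    rewrite big_split /=; congr (_ + _); rewrite (bigD1 k) //= eqxx scale1r big1 ?addr0 //.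
    by move=> i ik; rewrite eq_sym (negbTE ik) scale0r.
  by rewrite Ef xmZ -[X in X + _]scale1r -scalerDl nat1r.
Qed.

End Polynomials.

End Functions.

Section Harmonics.
Variable R : realType.
Local Notation C := R[i].
Local Notation fn := (fn R).
Local Notation space0 := (space0 R).
Local Notation rad := (@Defs.rad R).
Local Notation homogeneous := (@homogeneous R).
Implicit Types (f g P Q : fn) (x : space0) (i j k : 'I_3).

Lemma ord3D (i : 'I_3) : [/\ i + 1 + 1 = i + 2%:R, i + 1 + 2%:R = i,
  i + 2%:R + 1 = i & i + 2%:R + 2%:R = i + 1].
Proof. by case: i => [[|[|[|]]]] // p; split; exact/val_inj. Qed.

Lemma sum_cyc (V : nmodType) (F : 'I_3 -> V) i :
  \sum_j F j = F i + F (i + 1) + F (i + 2%:R).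
Proof.
rewrite (bigD1 i) //= (bigD1 (i + 1)) /=; last by case: i => [[|[|[|]]]].
rewrite (bigD1 (i + 2%:R)) /=; last by case: i => [[|[|[|]]]].
rewrite big1 ?addr0 ?addrA // => j; move: i j.
by do 2![case=> [[|[|[|]]]] // ?].
Qed.

Definition lap f : fn := \sum_i pd i (pd i f).

Definition ang i f : fn := xm (i + 1) (pd (i + 2%:R) f) - xm (i + 2%:R) (pd (i + 1) f).

Lemma laplacianE f : @laplacian R f = lap f.
Proof. by apply: fnP => x; rewrite /lap fn_sum /laplacian pdE. Qed.

Lemma angmomE i f : @angmom R i f = ang i f.
Proof. by apply: fnP => x; rewrite /angmom pdE /ang !fnE. Qed.

Definition rsq f : fn := \sum_i xm i (xm i f).

Lemma rsq_rad f x : rsq f x = (rad x)%:C ^+ 2 * f x.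
Proof.
rewrite /rsq fn_sum rad_sqrC mulr_suml; apply: eq_bigr => i _.
by rewrite !fnE mulrA expr2.
Qed.

Lemma hom_lin l a f g : homogeneous l f -> homogeneous l g -> homogeneous l (a *: f + g).
Proof. exact: lspan_linear. Qed.

Lemma hom0 l : homogeneous l 0. Proof. exact: lspan0. Qed.
Lemma homZ l a f : homogeneous l f -> homogeneous l (a *: f). Proof. exact: lspanZ. Qed.
Lemma homB l f g : homogeneous l f -> homogeneous l g -> homogeneous l (f - g).
Proof. exact: lspanB. Qed.
Lemma hom_sum l (I : Type) (r : seq I) (F : I -> fn) :
  (forall a, homogeneous l (F a)) -> homogeneous l (\sum_(a <- r) F a).
Proof. by move=> hF; apply: lspan_sum => a _; exact: hF. Qed.

Lemma hom_rsq l f : homogeneous l f -> homogeneous l.+2 (rsq f).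
Proof. by move=> hf; apply: hom_sum => i; do 2!apply: homogeneous_xm. Qed.

Lemma hom_euler_partial l i f : homogeneous l f ->
  euler (pd i f) = (l%:R - 1) *: pd i f.
Proof.
case: l => [|l] hf.
  rewrite hom0_partial // scaler0 /euler big1 // => j _.
  by rewrite partial0 xm0.
by rewrite (hom_euler (hom_partial i hf)) -natr1 addrK.
Qed.

Lemma lap_lin l m a f g : homogeneous l f -> homogeneous m g ->
  lap (a *: f + g) = a *: lap f + lap g.
Proof.
move=> hf hg; rewrite /lap scaler_sumr -big_split; apply: eq_bigr => i _ /=.
have [df dg] := (hom_diff hf, hom_diff hg).
rewrite partial_lin // partial_lin //.
  exact: hom_partial_diff hf.
exact: hom_partial_diff hg.
Qed.

Lemma lap0 : lap 0 = 0.
Proof. by rewrite /lap big1 // => i _; rewrite !partial0. Qed.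

Lemma lapZ l a f : homogeneous l f -> lap (a *: f) = a *: lap f.
Proof. by move=> hf; rewrite -[a *: f]addr0 (lap_lin _ hf (hom0 0)) lap0 addr0. Qed.

Lemma lapD l m f g : homogeneous l f -> homogeneous m g ->
  lap (f + g) = lap f + lap g.
Proof. by move=> hf hg; rewrite -[f]scale1r (lap_lin _ hf hg) !scale1r. Qed.

Lemma lapB l m f g : homogeneous l f -> homogeneous m g ->
  lap (f - g) = lap f - lap g.
Proof. by move=> hf hg; rewrite addrC -scaleN1r (lap_lin _ hg hf) scaleN1r addrC. Qed.

Lemma lap_sum l (I : Type) (r : seq I) (F : I -> fn) :
  (forall a, homogeneous l (F a)) ->
  lap (\sum_(a <- r) F a) = \sum_(a <- r) lap (F a).
Proof.
move=> hF; elim: r => [|a r IHr]; first by rewrite !big_nil lap0.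
by rewrite !big_cons (lapD (hF a) (hom_sum r hF)) IHr.
Qed.

Lemma lap_partial l i f : homogeneous l f ->
  lap (pd i f) = pd i (lap f).
Proof.
move=> hf; rewrite /lap partial_sum => [|j].
  apply: eq_bigr => j _; rewrite (hom_partialC j i hf).
  by rewrite (hom_partialC j i (hom_partial_pred j hf)).
exact: hom_partial_diff (hom_partial_pred j hf).
Qed.

Lemma lap_xm l i f : homogeneous l f ->
  lap (xm i f) = 2%:R *: pd i f + xm i (lap f).
Proof.
move=> hf; rewrite /lap xm_sum.
have df := hom_diff hf; have dpf m := hom_partial_diff m hf.
rewrite (eq_bigr (fun j => (i == j)%:R *: (2%:R *: pd j f) + xm i (pd j (pd j f)))); last first.
  move=> j _; rewrite (partial_xm _ _ df) partialD; last 2 first.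
  - exact: fdiffZ.
  - exact: fdiff_xm.
  rewrite (partialZ _ _ df) (partial_xm _ _ (dpf j)) addrA -scalerDl scalerA.
  by congr (_ *: _ + _); rewrite mulr_natr mulr2n.
rewrite big_split /=; congr (_ + _); rewrite (bigD1 i) //= eqxx scale1r big1 ?addr0 //.
by move=> j ji; rewrite eq_sym (negbTE ji) scale0r.
Qed.

Lemma lap_rsq l f : homogeneous l f ->
  lap (rsq f) = (6 + 4 * l%:R) *: f + rsq (lap f).
Proof.
move=> hf; have hxf i := homogeneous_xm i hf.
rewrite /rsq (@lap_sum l.+2); last by move=> i; exact: homogeneous_xm.
rewrite (eq_bigr (fun i => 2%:R *: f + (4%:R *: xm i (pd i f)) + xm i (xm i (lap f)))).
  rewrite !big_split /= -!scaler_sumr -/(euler f) (hom_euler hf); congr (_ + _).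
  rewrite sumr_const card_ord -[f *+ 3]scaler_nat !scalerA -scalerDl.
  by congr (_ *: _); ring.
move=> i _; rewrite (lap_xm _ (hxf i)) (lap_xm _ hf) (partial_xm _ _ (hom_diff hf)) eqxx.
by apply: fnP => x; rewrite !fnE /=; ring.
Qed.

Definition harm l P := homogeneous l P /\ lap P = 0.

Lemma harm_lin l a P Q : harm l P -> harm l Q -> harm l (a *: P + Q).
Proof.
move=> [hP lP] [hQ lQ]; split; first exact: hom_lin.
by rewrite (lap_lin _ hP hQ) lP lQ scaler0 addr0.
Qed.

Lemma harm0 l : harm l 0. Proof. by split; [exact: hom0|exact: lap0]. Qed.
Lemma harmZ l a P : harm l P -> harm l (a *: P).
Proof. by move=> hP; rewrite -[_ *: _]addr0; apply: harm_lin (harm0 l). Qed.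
Lemma harmD l P Q : harm l P -> harm l Q -> harm l (P + Q).
Proof. by move=> hP hQ; rewrite -[P]scale1r; exact: harm_lin. Qed.
Lemma harm_sum l (I : Type) (r : seq I) (p : pred I) (F : I -> fn) :
  (forall a, p a -> harm l (F a)) -> harm l (\sum_(a <- r | p a) F a).
Proof.
by move=> hF; elim/big_rec: _ => [|a P pa hP]; [exact: harm0|apply: harmD => //; exact: hF].
Qed.

Lemma harm_partial l i P : harm l.+1 P -> harm l (pd i P).
Proof.
move=> [hP lP]; split; first exact: hom_partial.
by rewrite (lap_partial i hP) lP partial0.
Qed.

Lemma harm_partial_pred l i P : harm l P -> harm l.-1 (pd i P).
Proof.
case: l => [[/hom0_partial -> _]|l]; first exact: harm0.
exact: harm_partial.
Qed.

Lemma harm_cst c : harm 0 (fun=> c).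
Proof.
split; first exact: homogeneous_cst.
by rewrite /lap big1 // => i _; rewrite !partial_cst.
Qed.

(* The projection of [x_i P] to the harmonic polynomials of degree [l + 1]. *)
Definition Zproj l i P : fn := xm i P - (2 * l%:R + 1)^-1 *: rsq (pd i P).

Lemma neq0_2l1 l : (2 * l%:R + 1 : C) != 0.
Proof. by rewrite -natrM natr1 pnatr_eq0. Qed.

Lemma hom_rsq_partial l i P : homogeneous l P -> homogeneous l.+1 (rsq (pd i P)).
Proof.
case: l => [/hom0_partial ->|l hP]; last exact/hom_rsq/hom_partial.
rewrite (_ : rsq 0 = 0); first exact: hom0.
by rewrite /rsq big1 // => j _; rewrite !xm0.
Qed.

Lemma harm_Zproj l i P : harm l P -> harm l.+1 (Zproj l i P).
Proof.
move=> [hP lP]; have hx := homogeneous_xm i hP; have hr := hom_rsq_partial i hP.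
split; first by apply: homB => //; exact: homZ.
rewrite /Zproj (lapB hx (homZ _ hr)) (lapZ _ hr) (lap_xm i hP) lP xm0 addr0.
case: l => [|l] in hP hx hr *.
  have -> : pd i P = 0 by exact: hom0_partial.
  have -> : rsq 0 = 0 by rewrite /rsq big1 // => j _; rewrite !xm0.
  by rewrite lap0 !scaler0 subrr.
rewrite (lap_rsq (hom_partial i hP)) (lap_partial i hP) lP partial0.
rewrite (_ : rsq 0 = 0) ?addr0; last by rewrite /rsq big1 // => j _; rewrite !xm0.
rewrite scalerA -scalerBl (_ : 2 - _ = 0) ?scale0r //.
by rewrite -natr1; have := neq0_2l1 l.+1; rewrite -natr1 => ?; field.
Qed.

Lemma sum_partial_partial P : \sum_i pd i (pd i P) = lap P.
Proof. by rewrite /lap. Qed.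

Lemma rsq_sum (I : Type) (r : seq I) (F : I -> fn) :
  rsq (\sum_(a <- r) F a) = \sum_(a <- r) rsq (F a).
Proof. by apply: fnP => x; rewrite rsq_rad !fnE mulr_sumr; apply: eq_bigr => a _; rewrite rsq_rad. Qed.

Lemma rsqZ a P : rsq (a *: P) = a *: rsq P.
Proof. by apply: fnP => x; rewrite fnE !rsq_rad fnE; ring. Qed.

Lemma rsq0 : rsq 0 = 0.
Proof. by rewrite /rsq big1 // => j _; rewrite !xm0. Qed.

Lemma sum_Zproj_partial l m P : harm m P -> \sum_i Zproj l i (pd i P) = m%:R *: P.
Proof.
move=> [hP lP]; rewrite sumrB -scaler_sumr -rsq_sum sum_partial_partial lP rsq0 scaler0 subr0.
exact: hom_euler hP.
Qed.

Lemma partial_Zproj l i j P : homogeneous l P ->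
  pd j (Zproj l i P) = (i == j)%:R *: P + xm i (pd j P)
    - (2 * l%:R + 1)^-1 *: (2%:R *: xm j (pd i P) + rsq (pd j (pd i P))).
Proof.
move=> hP; have dP := hom_diff hP.
have dpP m := hom_partial_diff m hP.
have dr : fdiff (rsq (pd i P)) by exact: hom_diff (hom_rsq_partial i hP).
rewrite partialB; last 2 first.
- exact: fdiff_xm.
- exact: fdiffZ.
rewrite (partialZ _ _ dr) (partial_xm _ _ dP) /rsq; congr (_ - _ *: _).
rewrite partial_sum => [|k]; last by do 2!apply: fdiff_xm.
rewrite (eq_bigr (fun k => (k == j)%:R *: (2%:R *: xm k (pd i P)) + xm k (xm k (pd j (pd i P))))).
  rewrite big_split /=; congr (_ + _); rewrite (bigD1 j) //= eqxx scale1r big1 ?addr0 //.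
  by move=> k kj; rewrite (negbTE kj) scale0r.
move=> k _; rewrite partial_xm; last exact: fdiff_xm.
by rewrite partial_xm //; apply: fnP => x; rewrite !fnE; ring.
Qed.

Lemma sum_partial_Zproj l P : harm l P ->
  \sum_i pd i (Zproj l i P) = ((2 * l%:R + 3) * (l%:R + 1) / (2 * l%:R + 1)) *: P.
Proof.
move=> [hP lP]; under eq_bigr => i _ do rewrite (partial_Zproj i i hP) eqxx scale1r.
rewrite sumrB big_split /= -scaler_sumr big_split /= -scaler_sumr -/(euler P).
rewrite (hom_euler hP) sumr_const card_ord -rsq_sum sum_partial_partial lP rsq0 addr0.
rewrite -scaler_nat !scalerA -!scalerDl -scaleNr -scalerDl; congr (_ *: _).
by have := neq0_2l1 l => ?; field.
Qed.

Lemma sum_Zproj_Zproj l P : harm l P -> \sum_i Zproj l.+1 i (Zproj l i P) = 0.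
Proof.
move=> hP; rewrite sumrB -scaler_sumr -rsq_sum (sum_partial_Zproj hP).
have [hP1 lP] := hP.
apply: fnP => x; rewrite fnD fnN.
have -> : (\sum_i xm i (Zproj l i P)) x =
    (rad x)%:C ^+ 2 * (P x - (2 * l%:R + 1)^-1 * (euler P) x).
  rewrite fn_sum /euler fn_sum mulrBr rad_sqrC mulr_suml.
  rewrite !mulr_sumr -sumrB; apply: eq_bigr => i _.
  rewrite /Zproj !fnE rsq_rad rad_sqrC.
  ring.
rewrite (hom_euler hP1) !fnE rsqZ fnE rsq_rad.
by have := neq0_2l1 l; have := neq0_2l1 l.+1; rewrite -!natr1 => ? ?; field; apply/andP.
Qed.

Lemma angmom_lin i a f g : fdiff f -> fdiff g ->
  ang i (a *: f + g) = a *: ang i f + ang i g.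
Proof.
move=> df dg; rewrite /ang !(partial_lin _ _ df dg).
by apply: fnP => x; rewrite !fnE; ring.
Qed.

Lemma hom_angmom l i P : homogeneous l P -> homogeneous l (ang i P).
Proof.
case: l => [hP|l hP].
  by rewrite /ang !(hom0_partial _ hP) !xm0 subrr; exact: hom0.
by rewrite /ang; apply: homB; apply: homogeneous_xm; exact: hom_partial.
Qed.

Lemma harm_angmom l i P : harm l P -> harm l (ang i P).
Proof.
move=> [hP lP]; split; first exact: hom_angmom.
have hp j := hom_partial_pred j hP.
rewrite /ang (lapB (homogeneous_xm _ (hp _)) (homogeneous_xm _ (hp _))).
rewrite !(lap_xm _ (hp _)) !(lap_partial _ hP) lP !partial0 !xm0 !addr0.
by rewrite (hom_partialC _ _ hP) subrr.
Qed.

Lemma angmom_casimir l P : harm l P ->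
  \sum_i ang i (ang i P) = (- (l%:R * (l%:R + 1))) *: P.
Proof.
move=> [hP lP].
have dp j : fdiff (pd j P) by exact: hom_partial_diff hP.
have E i x : ang i (ang i P) x =
   (val x (i + 1) 0)%:C ^+ 2 * pd (i + 2%:R) (pd (i + 2%:R) P) x
   + (val x (i + 2%:R) 0)%:C ^+ 2 * pd (i + 1) (pd (i + 1) P) x
   - (val x (i + 1) 0)%:C * pd (i + 1) P x - (val x (i + 2%:R) 0)%:C * pd (i + 2%:R) P x
   - (val x (i + 1) 0)%:C * (val x (i + 2%:R) 0)%:C *
      (pd (i + 1) (pd (i + 2%:R) P) x + pd (i + 2%:R) (pd (i + 1) P) x).
  have n12 : (i + 1 == i + 2%:R) = false by case: (i) => [[|[|[|]]]].
  rewrite /ang.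
  rewrite !partialB; do ?[by apply: fdiff_xm].
  rewrite !partial_xm // n12 eq_sym n12 !eqxx !fnE /=; ring.
apply: fnP => x; rewrite fn_sum (sum_cyc _ 0) !E.
have [-> -> -> ->] := ord3D 0; rewrite add0r.
have e0 := congr1 (fun f => f x) (hom_euler hP).
have e1 i := congr1 (fun f => f x) (hom_euler_partial i hP).
have e2 := congr1 (fun f => f x) lP.
move: e0 e2; rewrite /lap /euler !fnE !(sum_cyc _ 0) !add0r !fnE => e0 e2.
have := e1 0; have := e1 1; have := e1 2%:R.
rewrite /euler !fnE !(sum_cyc _ 0) !add0r !fnE => f2 f1 f0.
move: f0 f1 f2 e0 e2.
set d0 := pd 0 P x; set d1 := pd 1 P x; set d2 := pd 2%:R P x.
set x0 := (val x 0 0)%:C; set x1 := (val x 1 0)%:C; set x2 := (val x 2%:R 0)%:C.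
move=> f0 f1 f2 e0 e2.
set lhs := LHS.
have -> : lhs = (x0 ^+ 2 + x1 ^+ 2 + x2 ^+ 2) * 0 - x0 * ((l%:R - 1) * d0)
   - x1 * ((l%:R - 1) * d1) - x2 * ((l%:R - 1) * d2) - 2 * (l%:R * P x).
  by rewrite -f0 -f1 -f2 -e0 -e2 /lhs; ring.
have -> : - (l%:R * (l%:R + 1)) * P x = - (l%:R - 1) * (l%:R * P x) - 2 * (l%:R * P x) by ring.
by rewrite -e0; ring.
Qed.

End Harmonics.

Section Fischer.
Variable R : realType.
Local Notation C := R[i].
Local Notation fn := (fn R).
Local Notation space0 := (space0 R).
Local Notation rad := (@Defs.rad R).
Local Notation homogeneous := (@homogeneous R).
Implicit Types (f g P Q : fn) (x : space0) (i j k : 'I_3).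

Lemma const1_neq0 : (const_mx 1 : 'cV[R]_3) != 0.
Proof. by apply/eqP => /matrixP/(_ 0 0); rewrite !mxE => /eqP; rewrite oner_eq0. Qed.

Definition pt0 : space0 := exist (fun x : 'cV[R]_3 => is_true (x != 0)) _ const1_neq0.

Lemma hom0_const P : homogeneous 0 P -> forall x y, P x = P y.
Proof.
have H : forall l Q, homogeneous l Q -> l = 0%N -> forall x y, Q x = Q y; last first.
  by move=> hP; exact: H hP _.
apply: homogeneous_ind => //.
by move=> l a f g _ _ hf hg l0 x y; rewrite !fnE (hf l0 x y) (hg l0 x y).
Qed.

(* Up to the factor [l!] this is the Fischer product of polynomials of degree [l], for which multiplication by [x_i] is adjoint to the derivation [d/dx_i]. *)
Fixpoint fis l P Q : C :=
  if l is l'.+1 then \sum_i fis l' (pd i P) (pd i Q)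
  else P pt0 * Num.conj (Q pt0).

Lemma fis_conj l P Q : Num.conj (fis l P Q) = fis l Q P.
Proof.
elim: l P Q => [|l IHl] P Q /=; first by rewrite rmorphM /= conjCK mulrC.
by rewrite rmorph_sum; apply: eq_bigr => i _; exact: IHl.
Qed.

Lemma fis_linl l a P P' Q : homogeneous l P -> homogeneous l P' ->
  fis l (a *: P + P') Q = a * fis l P Q + fis l P' Q.
Proof.
elim: l P P' Q => [|l IHl] P P' Q hP hP' /=; first by rewrite !fnE; ring.
rewrite mulr_sumr -big_split; apply: eq_bigr => i _ /=.
rewrite partial_lin; [|exact: hom_diff hP|exact: hom_diff hP'].
by rewrite IHl //; exact: hom_partial.
Qed.

Lemma fis_linr l a P Q Q' : homogeneous l Q -> homogeneous l Q' ->
  fis l P (a *: Q + Q') = Num.conj a * fis l P Q + fis l P Q'.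
Proof.
move=> hQ hQ'; rewrite -fis_conj fis_linl // rmorphD rmorphM /=.
by rewrite !fis_conj.
Qed.

Lemma fis0l l Q : fis l 0 Q = 0.
Proof.
elim: l Q => [|l IHl] Q /=; first by rewrite fnE mul0r.
by rewrite big1 // => i _; rewrite partial0 IHl.
Qed.

Lemma fis0r l Q : fis l Q 0 = 0.
Proof. by rewrite -fis_conj fis0l rmorph0. Qed.

Lemma fisZl l a P Q : homogeneous l P -> fis l (a *: P) Q = a * fis l P Q.
Proof. by move=> hP; rewrite -[a *: P]addr0 fis_linl ?fis0l ?addr0 //; exact: hom0. Qed.

Lemma fisZr l a P Q : homogeneous l Q -> fis l P (a *: Q) = Num.conj a * fis l P Q.
Proof. by move=> hP; rewrite -[a *: Q]addr0 fis_linr ?fis0r ?addr0 //; exact: hom0. Qed.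

Lemma fisDl l P P' Q : homogeneous l P -> homogeneous l P' ->
  fis l (P + P') Q = fis l P Q + fis l P' Q.
Proof. by move=> hP hP'; rewrite -[P]scale1r fis_linl // scale1r mul1r. Qed.

Lemma fisBl l P P' Q : homogeneous l P -> homogeneous l P' ->
  fis l (P - P') Q = fis l P Q - fis l P' Q.
Proof. by move=> hP hP'; rewrite addrC -scaleN1r fis_linl // mulN1r addrC. Qed.

Lemma fisBr l P Q Q' : homogeneous l Q -> homogeneous l Q' ->
  fis l P (Q - Q') = fis l P Q - fis l P Q'.
Proof. by move=> hP hP'; rewrite addrC -scaleN1r fis_linr // rmorphN1 mulN1r addrC. Qed.

Lemma fis_suml l (I : Type) (r : seq I) (F : I -> fn) Q :
  (forall a, homogeneous l (F a)) ->
  fis l (\sum_(a <- r) F a) Q = \sum_(a <- r) fis l (F a) Q.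
Proof.
move=> hF; elim: r => [|a r IHr]; first by rewrite !big_nil fis0l.
by rewrite !big_cons fisDl ?IHr //; exact: hom_sum.
Qed.

Lemma fis_sumr l (I : Type) (r : seq I) (F : I -> fn) P :
  (forall a, homogeneous l (F a)) ->
  fis l P (\sum_(a <- r) F a) = \sum_(a <- r) fis l P (F a).
Proof.
move=> hF; rewrite -fis_conj fis_suml // rmorph_sum; apply: eq_bigr => a _.
exact: fis_conj.
Qed.

Lemma fis_ge0 l P : 0 <= fis l P P.
Proof.
elim: l P => [|l IHl] P /=; first exact: mul_conjC_ge0.
by apply: sumr_ge0 => i _; exact: IHl.
Qed.

Lemma fis_eq0 l P : homogeneous l P -> fis l P P = 0 -> P = 0.
Proof.
elim: l P => [|l IHl] P hP /=.
  move=> /eqP; rewrite mul_conjC_eq0 => /eqP P0; apply: fnP => x.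
  by rewrite (hom0_const hP x pt0) P0.
move=> /psumr_eq0P => /(_ (fun i _ => fis_ge0 l _)) H.
have pP i : pd i P = 0 by apply: IHl; [exact: hom_partial|exact: H].
have /eqP := hom_euler hP; rewrite /euler big1 => [|i _]; last by rewrite pP xm0.
by rewrite eq_sym scaler_eq0 pnatr_eq0 /= => /eqP.
Qed.

Lemma fis_xm l i P Q : homogeneous l P -> homogeneous l.+1 Q ->
  fis l.+1 (xm i P) Q = l.+1%:R * fis l P (pd i Q).
Proof.
elim: l P Q => [|l IHl] P Q hP hQ.
  rewrite /= (bigD1 i) //= big1 ?addr0 => [|j ji].
    rewrite (partial_xm _ _ (hom_diff hP)) eqxx scale1r hom0_partial // xm0 addr0.
    by rewrite mul1r.
  rewrite (partial_xm _ _ (hom_diff hP)) eq_sym (negbTE ji) scale0r add0r.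
  by rewrite hom0_partial // xm0 fnE mul0r.
rewrite [LHS]/= (eq_bigr (fun j => fis l.+1 ((i == j)%:R *: P) (pd j Q) +
   l.+1%:R * fis l (pd j P) (pd j (pd i Q)))); last first.
  move=> j _; rewrite -[LHS]/(fis l.+1 (pd j (xm i P)) (pd j Q)).
  rewrite (partial_xm _ _ (hom_diff hP)) fisDl; last 2 first.
  - exact: homZ.
  - by apply: homogeneous_xm; exact: hom_partial.
  rewrite IHl; [|exact: hom_partial|exact: hom_partial].
  by rewrite (hom_partialC i j hQ).
rewrite big_split -mulr_sumr; cbv beta; rewrite (bigD1 i) //; cbv beta.
rewrite eqxx scale1r big1 => [|j ji]; last by rewrite eq_sym (negbTE ji) scale0r fis0l.
rewrite -[LHS]/(fis l.+1 P (pd i Q) + 0 + l.+1%:R * fis l.+1 P (pd i Q)).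
by rewrite addr0 -[l.+2%:R]natr1 mulrDl mul1r addrC.
Qed.

Lemma fis_pd l i P Q : homogeneous l.+1 P -> homogeneous l Q ->
  fis l.+1 P (xm i Q) = l.+1%:R * fis l (pd i P) Q.
Proof. by move=> hP hQ; rewrite -fis_conj fis_xm // rmorphM /= rmorph_nat fis_conj. Qed.

Lemma fis_ang l i P Q : homogeneous l P -> homogeneous l Q ->
  fis l (ang i P) Q = - fis l P (ang i Q).
Proof.
case: l => [|l] hP hQ.
  by rewrite /ang !hom0_partial // !xm0 subrr fis0l fis0r oppr0.
have hp j := hom_partial j hP; have hq j := hom_partial j hQ.
rewrite /ang fisBl ?fisBr; do ?[exact: homogeneous_xm].
by rewrite !fis_xm // !fis_pd //; ring.
Qed.

Lemma fis_Zproj l i P Q : harm l P -> harm l.+1 Q ->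
  fis l.+1 (Zproj l i P) Q = l.+1%:R * fis l P (pd i Q).
Proof.
move=> [hP lP] [hQ lQ]; have hr := hom_rsq_partial i hP.
rewrite /Zproj fisBl; [|exact: homogeneous_xm|exact: homZ].
rewrite fisZl // fis_xm // [X in _ - _ * X](_ : _ = 0) ?mulr0 ?subr0 //.
case: l hP lP hQ lQ hr => [|l] hP lP hQ lQ hr.
  by rewrite hom0_partial // rsq0 fis0l.
have hp := hom_partial i hP.
rewrite /rsq fis_suml => [|j]; last by do 2!apply: homogeneous_xm.
rewrite (eq_bigr (fun j => l.+2%:R * (l.+1%:R * fis l (pd i P) (pd j (pd j Q))))) => [|j _].
  rewrite -!mulr_sumr -fis_sumr => [|j]; last by do 2!apply: hom_partial.
  by rewrite -/(lap Q) lQ fis0r !mulr0.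
rewrite fis_xm //; last exact: homogeneous_xm.
by rewrite fis_xm //; exact: hom_partial.
Qed.

Section Rotation.
Variables (m : 'M[R]_3) (mm : m *m m^T = 1%:M).

Lemma rot_neq0 x : m *m val x != 0.
Proof.
have mu : m \in unitmx by case/mulmx1_unit: mm.
by apply: contra (valP x) => /eqP m0; rewrite -(mulKmx mu (val x)) m0 mulmx0.
Qed.

Definition rotp x : space0 := exist (fun x : 'cV[R]_3 => is_true (x != 0)) _ (rot_neq0 x).
Definition rotf f : fn := fun x => f (rotp x).

Lemma rad_rot x : rad (rotp x) = rad x.
Proof.
have sE (y : 'cV[R]_3) : \sum_i y i 0 ^+ 2 = (y^T *m y) 0 0.
  by rewrite mxE; apply: eq_bigr => i _; rewrite mxE expr2.
by rewrite /rad !sE /= trmx_mul -mulmxA [in LHS](mulmxA m^T) (mulmx1C mm) mul1mx.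
Qed.

Lemma rot_rp psi P : rotf (rp psi P) = rp psi (rotf P).
Proof. by apply: fnP => x; rewrite /rotf !rpE rad_rot. Qed.

Lemma rot_lin a f g : rotf (a *: f + g) = a *: rotf f + rotf g.
Proof. by []. Qed.

Lemma rot0 : rotf 0 = 0. Proof. by []. Qed.
Lemma rot_sum (I : Type) (r : seq I) (F : I -> fn) :
  rotf (\sum_(a <- r) F a) = \sum_(a <- r) rotf (F a).
Proof. by apply: fnP => x; rewrite /rotf !fn_sum. Qed.

Lemma rot_xm i f : rotf (xm i f) = \sum_k (m i k)%:C *: xm k (rotf f).
Proof.
apply: fnP => x; rewrite /rotf fn_sum xmE /= mxE rmorph_sum mulr_suml.
by apply: eq_bigr => k _; rewrite !fnE rmorphM mulrA.
Qed.

Lemma hom_rot l f : homogeneous l f -> homogeneous l (rotf f).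
Proof.
move: l f; apply: homogeneous_ind => [c|l a f g _ _|l i f _ hf].
- exact: homogeneous_cst.
- by rewrite rot_lin; exact: hom_lin.
- by rewrite rot_xm; apply: hom_sum => k; apply/homZ/homogeneous_xm.
Qed.

Lemma pd_rot l i f : homogeneous l f -> pd i (rotf f) = \sum_a (m a i)%:C *: rotf (pd a f).
Proof.
move=> hf; move: l f hf i; apply: (@homogeneous_ind R (fun l f => forall i, pd i (rotf f) = \sum_a (m a i)%:C *: rotf (pd a f))).
- move=> c i; rewrite [LHS]partial_cst big1 // => a _.
  by rewrite partial_cst rot0 scaler0.
- move=> l a f g hf hg Ef Eg i; have [hrf hrg] := (hom_rot hf, hom_rot hg).
  rewrite rot_lin (partial_lin _ _ (hom_diff hrf) (hom_diff hrg)) Ef Eg scaler_sumr -big_split.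
  apply: eq_bigr => b _ /=; rewrite (partial_lin _ _ (hom_diff hf) (hom_diff hg)) rot_lin.
  by apply: fnP => x; rewrite !fnE; ring.
- move=> l j f hf Ef i; have drf := hom_diff (hom_rot hf).
  rewrite rot_xm partial_sum => [|a]; last exact/fdiffZ/fdiff_xm.
  rewrite (eq_bigr (fun k => (k == i)%:R *: ((m j k)%:C *: rotf f) + (m j k)%:C *: xm k (pd i (rotf f)))).
    rewrite big_split /= (bigD1 i) //= eqxx scale1r big1 ?addr0 => [|k ki]; last first.
      by rewrite (negbTE ki) scale0r.
    rewrite (eq_bigr (fun k => \sum_a (m a i)%:C *: ((m j k)%:C *: xm k (rotf (pd a f))))).
      rewrite exchange_big /=.
      rewrite (eq_bigr (fun a => (m a i)%:C *: rotf (xm j (pd a f)))) => [|a _]; last first.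
        by rewrite -scaler_sumr rot_xm.
      rewrite [RHS](eq_bigr (fun a => (j == a)%:R *: ((m a i)%:C *: rotf f) + (m a i)%:C *: rotf (xm j (pd a f)))).
        rewrite big_split /= [X in _ = X + _](bigD1 j) //= eqxx scale1r [X in _ = _ + X + _]big1 ?addr0 // => a aj.
        by rewrite eq_sym (negbTE aj) scale0r.
      move=> a _; rewrite (partial_xm _ _ (hom_diff hf)) rot_lin.
      by apply: fnP => x; rewrite !fnE; ring.
    move=> k _; rewrite Ef xm_sum scaler_sumr; apply: eq_bigr => a _.
    by rewrite xmZ !scalerA mulrC.
  move=> k _; rewrite partialZ; last exact: fdiff_xm.
  rewrite (partial_xm _ _ drf).
  by apply: fnP => x; rewrite !fnE; ring.
Qed.

Lemma lap_rot l f : homogeneous l f -> lap (rotf f) = rotf (lap f).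
Proof.
move=> hf; rewrite /lap.
have hp a := hom_partial_pred a hf.
have E i : pd i (pd i (rotf f)) = \sum_a \sum_b ((m a i * m b i)%:C *: rotf (pd b (pd a f))).
  rewrite (pd_rot i hf) partial_sum => [|a]; last first.
    exact/fdiffZ/hom_diff/hom_rot.
  apply: eq_bigr => a _; rewrite partialZ; last exact/hom_diff/hom_rot.
  rewrite (pd_rot i (hp a)) scaler_sumr; apply: eq_bigr => b _.
  by rewrite scalerA -rmorphM.
rewrite (eq_bigr _ (fun i _ => E i)) exchange_big rot_sum; apply: eq_bigr => a _ /=.
rewrite exchange_big (bigD1 a) //= [X in _ + X]big1 ?addr0 => [|b ba].
  rewrite -scaler_suml -rmorph_sum; have /matrixP/(_ a a) := mm.
  rewrite !mxE eqxx => E1; under eq_bigr => i _ do [].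
  rewrite (_ : \sum_i _ = 1) ?scale1r // -[RHS]E1.
  by apply: eq_bigr => i _; rewrite !mxE.
rewrite -scaler_suml -rmorph_sum (_ : \sum_i _ = 0) ?scale0r //.
have /matrixP/(_ a b) := mm; rewrite !mxE eq_sym (negbTE ba) => E0; rewrite -[RHS]E0.
by apply: eq_bigr => i _; rewrite !mxE.
Qed.

Lemma harm_rot l P : harm l P -> harm l (rotf P).
Proof.
by move=> [hP lP]; split; [exact: hom_rot|rewrite (lap_rot hP) lP rot0].
Qed.

Lemma conj_real (r : R) : Num.conj (r%:C) = r%:C.
Proof. by apply: conj_Creal; rewrite complex_real. Qed.

Lemma fis_rot l P Q : homogeneous l P -> homogeneous l Q ->
  fis l (rotf P) (rotf Q) = fis l P Q.
Proof.
elim: l P Q => [|l IHl] P Q hP hQ.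
  by rewrite /= /rotf (hom0_const hP _ pt0) (hom0_const hQ _ pt0).
have hp a := hom_rot (hom_partial a hP); have hq a := hom_rot (hom_partial a hQ).
have E i : fis l (pd i (rotf P)) (pd i (rotf Q)) =
    \sum_a \sum_b (m a i * m b i)%:C * fis l (pd a P) (pd b Q).
  rewrite (pd_rot i hP) (pd_rot i hQ) fis_suml => [|a]; last exact: homZ.
  apply: eq_bigr => a _; rewrite fis_sumr => [|b]; last exact: homZ.
  apply: eq_bigr => b _; rewrite fisZl // fisZr // IHl; [|exact: hom_partial..].
  by rewrite conj_real rmorphM mulrA.
rewrite /= (eq_bigr _ (fun i _ => E i)) exchange_big; apply: eq_bigr => a _ /=.
rewrite exchange_big (bigD1 a) //= [X in _ + X]big1 ?addr0 => [|b ba].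
  rewrite -mulr_suml -rmorph_sum (_ : \sum_i _ = 1) ?mul1r //.
  have /matrixP/(_ a a) := mm; rewrite !mxE eqxx => E1; rewrite -[RHS]E1.
  by apply: eq_bigr => i _; rewrite !mxE.
rewrite -mulr_suml -rmorph_sum (_ : \sum_i _ = 0) ?mul0r //.
have /matrixP/(_ a b) := mm; rewrite !mxE eq_sym (negbTE ba) => E0; rewrite -[RHS]E0.
by apply: eq_bigr => i _; rewrite !mxE.
Qed.

End Rotation.

Lemma fn_act_rot (k : 'M[R]_3) : O3 k ->
  exists2 m : 'M[R]_3, m *m m^T = 1%:M & forall mm f, fn_act k f = @rotf m mm f.
Proof.
move=> kk; have ku : k \in unitmx by case/mulmx1_unit: kk.
have kV : invmx k = k^T by rewrite -[RHS](mulKmx ku) kk mulmx1.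
have d2 : \det k * \det k = 1.
  by have := congr1 determinant kk; rewrite det_mulmx det_tr det1.
exists ((\det (invmx k))^-1 *: invmx k).
  rewrite kV det_tr linearZ /= -scalemxAl -scalemxAr trmxK scalerA (mulmx1C kk).
  by rewrite -invfM d2 invr1 scale1r.
move=> mm f; apply: fnP => x; rewrite /fn_act /rotf; congr f; apply: val_inj.
have ne := rot_neq0 mm x.
by rewrite /space0_act val_insubd scalemxAl ne.
Qed.

End Fischer.

(** * The radial equation and its solutions *)

Section RadialOperators.
Variable R : realType.
Local Notation C := R[i].
Local Notation fn := (fn R).
Local Notation space0 := (space0 R).
Local Notation rad := (@Defs.rad R).
Local Notation homogeneous := (@homogeneous R).
Implicit Types (f P Q : fn) (x : space0) (i j k : 'I_3) (psi : R -> C).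

Lemma radC_neq0 x : (rad x)%:C != 0.
Proof. by apply: realC_neq0; exact: rad_gt0. Qed.

Definition radial_products : set fn :=
  [set f | exists psi P l, [/\ rsmooth psi, homogeneous l P & f = rp psi P]].

Lemma radial_products_pd f : lspan radial_products f ->
  fdiff f /\ forall i, lspan radial_products (pd i f).
Proof.
move: f; apply: lspan_ind.
- by split=> [|i]; [exact: fdiff0|rewrite partial0; exact: lspan0].
- move=> a f g [df pf] [dg pg]; split=> [|i]; first exact: fdiff_lin.
  by rewrite partial_lin //; exact: lspan_linear.
- move=> _ [psi [P [l [Spsi hP ->]]]]; have [psi1 D S1] := rsmooth_ex Spsi.
  split=> [|i]; first exact: fdiff_rp D (hom_diff hP).
  rewrite (partial_rp _ D (hom_diff hP)); apply: lspanD; apply: lspan_gen.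
    exists (fun r => psi1 r / r%:C), (xm i P), l.+1; split=> //.
      exact: rsmoothM S1 (@rsmooth_inv R).
    exact: homogeneous_xm.
  by exists psi, (pd i P), l.-1; split=> //; exact: hom_partial_pred.
Qed.

Lemma smooth_radial_products f : lspan radial_products f -> smooth f.
Proof.
move=> Sf s x.
suff /radial_products_pd[+ _] : lspan radial_products (foldr (@partial R) f s) by apply.
by elim: s => //= i s /radial_products_pd[_]; rewrite pdE; apply.
Qed.

Lemma smooth_rp psi P l : rsmooth psi -> homogeneous l P -> smooth (rp psi P).
Proof. by move=> Sp hP; apply/smooth_radial_products/lspan_gen; exists psi, P, l. Qed.

Lemma smooth_fdiff f : smooth f -> fdiff f.
Proof. by move=> sf x; exact: (sf [::] x). Qed.

Lemma smooth_pd i f : smooth f -> smooth (pd i f).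
Proof. by move=> sf s x; have := sf (rcons s i) x; rewrite foldr_rcons pdE. Qed.

Lemma smooth_lin a f g : smooth f -> smooth g -> smooth (a *: f + g).
Proof.
move=> sf sg s.
have fdf t h : smooth h -> fdiff (foldr (@partial R) h t) by move=> sh x; exact: sh.
have E t : foldr (@partial R) (a *: f + g) t =
    a *: foldr (@partial R) f t + foldr (@partial R) g t.
  elim: t => //= i t ->; rewrite pdE partial_lin // -pdE; exact: fdf.
by rewrite E; apply: fdiff_lin; exact: fdf.
Qed.

Lemma smooth0 : smooth (0 : fn).
Proof. by apply: smooth_radial_products; exact: lspan0. Qed.

Lemma ang_lin2 i a f g : smooth f -> smooth g ->
  ang i (a *: f + g) = a *: ang i f + ang i g.
Proof. by move=> sf sg; apply: angmom_lin; exact: smooth_fdiff. Qed.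

Lemma ang_rp i psi psi' P : cder psi psi' -> fdiff P ->
  ang i (rp psi P) = rp psi (ang i P).
Proof.
move=> D dP; rewrite /ang !(partial_rp _ D dP).
by apply: fnP => x; rewrite !fnE; ring.
Qed.

Lemma cder_over psi psi1 psi2 : cder psi psi1 -> cder psi1 psi2 ->
  cder (fun r => psi1 r / r%:C) (fun r => psi2 r / r%:C - psi1 r / r%:C ^+ 2).
Proof.
move=> D1 D2; apply: cder_ext (cderM D2 (@cder_inv R)) => // r r0.
by rewrite mulrN.
Qed.

Lemma lap_rp l psi psi1 psi2 P : cder psi psi1 -> cder psi1 psi2 ->
  homogeneous l P -> lap P = 0 ->
  lap (rp psi P) = rp (fun r => psi2 r + (2 * l%:R + 2) / r%:C * psi1 r) P.
Proof.
move=> D1 D2 hP lP; have D3 := cder_over D1 D2.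
have dP := hom_diff hP; have dp i := hom_partial_diff i hP.
have E i : pd i (pd i (rp psi P)) =
  rp (fun r => (psi2 r / r%:C - psi1 r / r%:C ^+ 2) / r%:C) (xm i (xm i P))
  + rp (fun r => psi1 r / r%:C) (P + 2 *: xm i (pd i P)) + rp psi (pd i (pd i P)).
  rewrite (partial_rp _ D1 dP) partialD; last 2 first.
  - exact: fdiff_rp D3 (fdiff_xm i dP).
  - exact: fdiff_rp D1 (dp i).
  rewrite (partial_rp _ D3 (fdiff_xm i dP)) (partial_rp _ D1 (dp i)).
  rewrite (partial_xm _ _ dP) eqxx scale1r.
  by apply: fnP => x; rewrite !fnE; ring.
apply: fnP => x; rewrite /lap (eq_bigr _ (fun i _ => E i)) !big_split /= !fnE.
have e1 := congr1 (fun f => f x) lP; have e2 := congr1 (fun f => f x) (hom_euler hP).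
move: e1 e2; rewrite /lap /euler !fnE => e1 e2.
have -> : \sum_i (rp (fun r => (psi2 r / r%:C - psi1 r / r%:C ^+ 2) / r%:C) (xm i (xm i P))) x =
    (psi2 (rad x) / (rad x)%:C - psi1 (rad x) / (rad x)%:C ^+ 2) / (rad x)%:C * ((rad x)%:C ^+ 2 * P x).
  rewrite [X in _ * (X * _)]rad_sqrC mulr_suml mulr_sumr; apply: eq_bigr => i _.
  by rewrite !fnE; ring.
have -> : \sum_i (rp (fun r => psi1 r / r%:C) (P + 2 *: xm i (pd i P))) x =
    psi1 (rad x) / (rad x)%:C * (3 * P x + 2 * (l%:R * P x)).
  rewrite -e2 mulrDr; under eq_bigr => i _ do rewrite !fnE mulrDr.
  rewrite big_split /= sumr_const card_ord -mulr_natr; congr (_ + _); first by ring.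
  by rewrite !mulr_sumr; apply: eq_bigr => i _; rewrite fnE.
have -> : \sum_i (rp psi (pd i (pd i P))) x = 0.
  transitivity (psi (rad x) * \sum_i pd i (pd i P) x); last by rewrite e1 mulr0.
  by rewrite mulr_sumr; apply: eq_bigr => i _; rewrite fnE.
by have := radC_neq0 x => ?; field.
Qed.

Lemma euler_rp l psi psi1 P : cder psi psi1 -> homogeneous l P ->
  euler (rp psi P) = rp (fun r => r%:C * psi1 r + l%:R * psi r) P.
Proof.
move=> D hP; have dP := hom_diff hP; apply: fnP => x; rewrite /euler fn_sum.
under eq_bigr => i _ do rewrite (partial_rp _ D dP) !fnE.
have e2 := congr1 (fun f => f x) (hom_euler hP); move: e2; rewrite /euler !fnE => e2.
rewrite (_ : \sum_i _ = psi1 (rad x) / (rad x)%:C * ((rad x)%:C ^+ 2 * P x) +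
  psi (rad x) * (l%:R * P x)).
  by have := radC_neq0 x => ?; field.
rewrite -e2 rad_sqrC mulr_suml !mulr_sumr -big_split; apply: eq_bigr => i _ /=.
by rewrite !fnE; ring.
Qed.

Variable g : R.

Definition rlz i f : fn :=
  'i *: (xm i (lap f) - pd i (euler f) + rp (fun r => g%:C / r%:C) (xm i f)).

Lemma rungelenzE i f : smooth f -> rungelenz g i f = rlz i f.
Proof.
move=> sf; have df := smooth_fdiff sf.
have dp j : fdiff (pd j f) by exact/smooth_fdiff/smooth_pd.
apply: fnP => x; rewrite /rungelenz /rlz !angmomE pdE fnZ; congr (_ * _).
have -> : pd i (euler f) = \sum_j ((j == i)%:R *: pd j f + xm j (pd i (pd j f))).
  rewrite /euler partial_sum => [|j]; last exact: fdiff_xm.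
  by apply: eq_bigr => j _; rewrite partial_xm.
rewrite /lap !(sum_cyc _ i) !eqxx /ang.
have n1 : (i + 1 == i) = false by case: (i) => [[|[|[|]]]].
have n2 : (i + 2%:R == i) = false by case: (i) => [[|[|[|]]]].
have [-> -> -> ->] := ord3D i.
by rewrite n1 n2 /= !fnE !rmorphM fmorphV; field; exact: radC_neq0.
Qed.

Lemma rlz_lin i a f h : smooth f -> smooth h ->
  rlz i (a *: f + h) = a *: rlz i f + rlz i h.
Proof.
move=> sf sh.
have [df dh] := (smooth_fdiff sf, smooth_fdiff sh).
have dpf j : fdiff (pd j f) by exact/smooth_fdiff/smooth_pd.
have dph j : fdiff (pd j h) by exact/smooth_fdiff/smooth_pd.
have El : lap (a *: f + h) = a *: lap f + lap h.
  rewrite /lap scaler_sumr -big_split; apply: eq_bigr => j _.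
  by rewrite (partial_lin _ _ df dh) (partial_lin _ _ (dpf j) (dph j)).
have Ee : euler (a *: f + h) = a *: euler f + euler h.
  rewrite /euler scaler_sumr -big_split; apply: eq_bigr => j _.
  by rewrite (partial_lin _ _ df dh) xm_lin.
rewrite /rlz El Ee partial_lin; [|by apply: fdiff_sum => j; exact: fdiff_xm..].
by apply: fnP => x; rewrite !fnE; ring.
Qed.

Lemma rungelenz_lin i a f h : smooth f -> smooth h ->
  rungelenz g i (a *: f + h) = a *: rungelenz g i f + rungelenz g i h.
Proof. by move=> sf sh; rewrite !rungelenzE ?rlz_lin //; exact: smooth_lin. Qed.

Lemma rungelenz0 i : rungelenz g i 0 = 0.
Proof.
by have := rungelenz_lin i (-1) smooth0 smooth0; rewrite scaler0 addr0 scaleN1r addNr.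
Qed.

Lemma rungelenzZ i a f : smooth f -> rungelenz g i (a *: f) = a *: rungelenz g i f.
Proof. by move=> sf; have := rungelenz_lin i a sf smooth0; rewrite rungelenz0 !addr0. Qed.

Section RadialSolutions.
Variables (l : nat) (la : C).

(* The radial equation for [psi], written for [phi = psi / r^l]. *)
Definition rode (phi phi1 : R -> C) (r : R) : C :=
  - ((2 * l%:R + 2) / r%:C * phi1 r + (2 * g%:C / r%:C + la) * phi r).

Definition is_rsol phi phi1 := cder phi phi1 /\ cder phi1 (rode phi phi1).

Lemma is_rsol_smooth phi phi1 : is_rsol phi phi1 -> rsmooth phi /\ rsmooth phi1.
Proof.
move=> [D1 D2].
have H n : cCn n phi /\ cCn n phi1.
  elim: n => // n [IH1 IH2]; split; first by exists phi1.
  exists (rode phi phi1) => //.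
  have ci := @cCn_inv R n; have cz := cCnZ.
  have c1 := cCnM (cCnZ (- (2 * l%:R + 2)) ci) IH2.
  have c2 := cCnM (cCnD (cCnZ (- (2 * g%:C)) ci) (cCn_cst n (- la))) IH1.
  by apply: cCn_ext (cCnD c1 c2) => r _ /=; rewrite /rode; ring.
by split=> n; have [] := H n.
Qed.

Lemma schrodinger_rp phi phi1 P : is_rsol phi phi1 -> harm l P ->
  schrodinger g (rp phi P) = la *: rp phi P.
Proof.
move=> [D1 D2] [hP lP]; apply: fnP => x.
rewrite /schrodinger laplacianE (lap_rp D1 D2 hP lP) !fnE /rode !rmorphM fmorphV /=.
by have := radC_neq0 x => ?; rewrite rmorph_nat; field.
Qed.

End RadialSolutions.

Definition Hspan n (e : 'I_n -> fn) l := forall P, homogeneous l P -> lspan (range e) P.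

Lemma homogeneous_fin l : exists n (e : 'I_n -> fn), Hspan e l.
Proof.
elim: l => [|l [n [e He]]].
  exists 1%N, (fun _ => fun _ => 1) => P hP.
  rewrite (_ : P = P (pt0 R) *: (fun _ => 1)); last first.
    by apply: fnP => x; rewrite fnE mulr1; exact: hom0_const.
  by apply: lspanZ; apply: lspan_gen; exists ord0.
exists #|{: 'I_3 * 'I_n}|, (fun a => let p := enum_val a in xm p.1 (e p.2)) => P hP.
have -> : P = l.+1%:R^-1 *: euler P.
  by rewrite (hom_euler hP) scalerA mulVf ?scale1r // pnatr_eq0.
apply: lspanZ; apply: lspan_sum => i _; have := He _ (hom_partial i hP).
move: (pd i P); apply: lspan_ind.
- by rewrite xm0; exact: lspan0.
- by move=> a u v Su Sv; rewrite xm_lin; exact: lspan_linear.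
- move=> _ [a _ <-]; apply: lspan_gen; exists (enum_rank (i, a)) => //.
  by rewrite enum_rankK.
Qed.

Lemma Kfinite_rp psi l P : homogeneous l P -> Kfinite (rp psi P).
Proof.
move=> hP; have [n [e He]] := homogeneous_fin l.
exists n, (fun a => rp psi (e a)) => k kO.
have [m mm ->] := fn_act_rot kO; rewrite (rot_rp mm).
have := He _ (hom_rot mm hP); move: (rotf mm P); apply: lspan_ind.
- by rewrite rp0; exact: lspan0.
- move=> a u v Su Sv; rewrite rpD rpZ; exact: lspan_linear.
- by move=> _ [a _ <-]; apply: lspan_gen; exists a.
Qed.

Lemma Sol_rp l la phi phi1 P : is_rsol l la phi phi1 -> harm l P ->
  Sol g la (rp phi P).
Proof.
move=> sphi hP; split.
- by case: hP => hP _; apply: smooth_rp hP; have [] := is_rsol_smooth sphi.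
- by case: hP => hP _; exact: Kfinite_rp hP.
- exact: schrodinger_rp sphi hP.
Qed.

(* The radial parts of the Runge-Lenz operators raising and lowering the degree. *)
Definition rtheta l (phi phi1 : R -> C) (r : R) : C :=
  ((l%:R + 1) * phi1 r + g%:C * phi r) / r%:C.

Definition rtheta1 l la (phi phi1 : R -> C) (r : R) : C :=
  (g%:C / r%:C - (l%:R + 1) * (2 * l%:R + 3) / r%:C ^+ 2) * phi1 r
  - ((l%:R + 1) * la / r%:C + (2 * l%:R + 3) * g%:C / r%:C ^+ 2) * phi r.

Definition rlower l (phi phi1 : R -> C) (r : R) : C :=
  l%:R * r%:C * phi1 r + (l%:R * (2 * l%:R + 1) - g%:C * r%:C) * phi r.

Lemma cder_frac (a b : C) :
  cder (fun r : R => a / r%:C + b / r%:C ^+ 2) (fun r => - a / r%:C ^+ 2 - 2 * b / r%:C ^+ 3).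
Proof.
have D := @cder_inv R.
apply: cder_ext (cderD (cderZ a D) (cderZ b (cderM D D))) => r r0 /=;
  have := realC_neq0 r0 => ?; field; do ?[by []].
Qed.

Lemma rtheta_rsol l la phi phi1 : is_rsol l la phi phi1 ->
  is_rsol l.+1 la (rtheta l phi phi1) (rtheta1 l la phi phi1).
Proof.
move=> [D1 D2]; split.
- have c1 := cderM (cder_frac (l%:R + 1) 0) D2; have c2 := cderM (cder_frac g%:C 0) D1.
  apply: cder_ext (cderD c1 c2) => r r0 /=; rewrite /rtheta /rtheta1 /rode.
    by have := realC_neq0 r0 => ?; field.
  by have := realC_neq0 r0 => ?; field.
- have c1 := cderM (cder_frac g%:C (- ((l%:R + 1) * (2 * l%:R + 3)))) D2.
  have c2 := cderM (cder_frac (- ((l%:R + 1) * la)) (- ((2 * l%:R + 3) * g%:C))) D1.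
  apply: cder_ext (cderD c1 c2) => r r0 /=; rewrite /rtheta /rtheta1 /rode.
    by have := realC_neq0 r0 => ?; field.
  by rewrite -!natr1; have := realC_neq0 r0 => ?; field.
Qed.

Lemma rlz_rp i l la phi phi1 P : is_rsol l la phi phi1 -> harm l P ->
  rlz i (rp phi P) = 'i *: (rp (rtheta l phi phi1) (Zproj l i P)
    - (2 * l%:R + 1)^-1 *: rp (rlower l phi phi1) (pd i P)).
Proof.
move=> sphi hP; have [D1 D2] := sphi; have [hP1 lP] := hP.
have dP := hom_diff hP1.
have De := cderD (cderM (@cder_id R) D2) (cderZ (l%:R + 1) D1).
have De' : cder (fun r => r%:C * phi1 r + l%:R * phi r)
    (fun r => r%:C * rode l la phi phi1 r + (l%:R + 1) * phi1 r).
  apply: cder_ext (cderD (cderM (@cder_id R) D2) (cderZ l%:R D1)) => // r r0 /=; ring.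
rewrite /rlz (lap_rp D1 D2 hP1 lP) (euler_rp D1 hP1) (partial_rp _ De' dP).
congr (_ *: _); apply: fnP => x; rewrite /Zproj !fnE rsq_rad /rode /rtheta /rlower.
by have := radC_neq0 x; have := neq0_2l1 R l => ? ?; field; apply/andP.
Qed.

End RadialOperators.

Section PowerSeries.
Variable R : realType.
Local Notation C := R[i].
Local Notation re := (@complex.Re R).
Local Notation im := (@complex.Im R).
Implicit Types (c : nat -> R) (a b : nat -> C).

Definition ent c := forall r : R, cvgn (pseries c r).
Definition rps c (r : R) := limn (pseries c r).

Lemma ent_norm c r : ent c -> cvgn (pseries (fun k => `|c k|) r).
Proof.
move=> ec; apply: (@is_cvg_pseries_inside_norm _ c (`|r| + 1)); first exact: ec.
by rewrite [X in _ < X]ger0_norm ?addr_ge0 // ltrDl.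
Qed.

Lemma ent_le c (d : nat -> R) : (forall k, `|c k| <= `|d k|) -> ent d -> ent c.
Proof.
move=> cd ed r; apply: normed_cvg.
have H : cvgn (pseries (fun k => `|d k|) `|r|) by exact: ent_norm.
apply: (series_le_cvg _ _ _ H) => k /=; rewrite ?normr_ge0 ?mulr_ge0 //.
by rewrite normrM normrX ler_wpM2r // exprn_ge0.
Qed.

Lemma entZ c (x : R) : ent c -> ent (fun k => x * c k).
Proof.
move=> ec r; rewrite /pseries (_ : (fun _ => _) = x *: (fun k => c k * r ^+ k)).
  by apply: is_cvg_seriesZ; exact: ec.
by apply/funext => k; rewrite -mulrA.
Qed.

Lemma entD c d : ent c -> ent d -> ent (fun k => c k + d k).
Proof.
move=> ec ed r; rewrite /pseries (_ : (fun _ => _) = (fun k => c k * r ^+ k) + (fun k => d k * r ^+ k)).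
  by apply: is_cvg_seriesD; [exact: ec|exact: ed].
by apply/funext => k; rewrite /= mulrDl.
Qed.

Lemma rpsZ c (x : R) r : ent c -> rps (fun k => x * c k) r = x * rps c r.
Proof.
move=> ec; rewrite /rps /pseries (_ : (fun i => _ * _ * _) = x *: (fun k => c k * r ^+ k)).
  by rewrite lim_seriesZ //; exact: ec.
by apply/funext => k; rewrite -mulrA.
Qed.

Lemma rpsD c d r : ent c -> ent d -> rps (fun k => c k + d k) r = rps c r + rps d r.
Proof.
move=> ec ed; rewrite /rps /pseries (_ : (fun i => _ * _) = (fun k => c k * r ^+ k) + (fun k => d k * r ^+ k)).
  by rewrite lim_seriesD //; [exact: ec|exact: ed].
by apply/funext => k; rewrite /= mulrDl.
Qed.

Lemma pseriesS c r n : pseries c r n.+1 = c 0%N + r * pseries (fun k => c k.+1) r n.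
Proof.
rewrite /pseries /series /= big_nat_recl // expr0 mulr1 mulr_sumr; congr (_ + _).
by apply: eq_bigr => k _; rewrite exprS; ring.
Qed.

Lemma pseriesS_fun c r :
  (fun n => pseries c r n.+1) = cst (c 0%N) + r *: pseries (fun k => c k.+1) r.
Proof. by apply/funext => n; rewrite pseriesS. Qed.

Lemma entS c : ent (fun k => c k.+1) -> ent c.
Proof.
move=> ec r; apply/cvg_ex; exists (c 0%N + r *: limn (pseries (fun k => c k.+1) r)).
rewrite -cvg_shiftS pseriesS_fun.
by apply: cvgD; [exact: cvg_cst|apply: cvgZr; exact: ec].
Qed.

Lemma ent_shift c : ent c -> ent (fun k => c k.+1).
Proof.
move=> ec r.
have [->|r0] := eqVneq r 0.
  apply/cvg_ex; exists (c 1%N); rewrite -cvg_shiftS pseriesS_fun scale0r addr0.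
  exact: cvg_cst.
apply/cvg_ex; exists (r^-1 *: (limn (pseries c r) - c 0%N)).
have -> : pseries (fun k => c k.+1) r = r^-1 *: ((fun n => pseries c r n.+1) - cst (c 0%N)).
  by rewrite pseriesS_fun addrAC subrr add0r scalerA mulVf ?scale1r.
apply: cvgZr; apply: cvgB; last exact: cvg_cst.
by rewrite cvg_shiftS; exact: ec.
Qed.

Lemma rps_shift c r : ent c -> rps c r = c 0%N + r * rps (fun k => c k.+1) r.
Proof.
move=> ec; rewrite /rps; apply: (@cvg_lim _ (@Rhausdorff R)).
rewrite -cvg_shiftS pseriesS_fun; apply: cvgD; first exact: cvg_cst.
by apply: cvgZr; exact: (ent_shift ec).
Qed.

Lemma ent_diffs c : ent c -> ent (pseries_diffs c).
Proof.
move=> ec; have e : ent (fun k => 2 ^+ k * c k).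
  move=> r; suff -> : pseries (fun k => 2 ^+ k * c k) r = pseries c (2 * r) by exact: ec.
  apply/funext => n; rewrite /pseries /series /=; apply: eq_bigr => k _.
  by rewrite exprMn mulrCA mulrA.
apply: ent_le (ent_shift e) => k; rewrite /pseries_diffs !normrM ler_wpM2r //.
by rewrite !ger0_norm ?exprn_ge0 // -natrX ler_nat ltnW // ltn_expl.
Qed.

Lemma rps_derive c r : ent c -> is_derive r (1 : R) (rps c) (rps (pseries_diffs c) r).
Proof.
move=> ec; apply: (@pseries_snd_diffs _ c (`|r| + 1)); first exact: ec.
- exact: ent_diffs.
- by apply: ent_diffs; exact: ent_diffs.
- by rewrite [X in _ < X]ger0_norm ?addr_ge0 // ltrDl.
Qed.

Definition cent a := ent (re \o a) /\ ent (im \o a).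

Lemma cpseriesE a r : cpseries a r = rps (re \o a) r +i* rps (im \o a) r.
Proof. by []. Qed.

Lemma Re_norm_ge (z : C) : `|re z| <= re `|z| /\ `|im z| <= re `|z|.
Proof.
rewrite normc_def /=; case: z => x y /=; split; rewrite -sqrtr_sqr ler_wsqrtr //.
  by rewrite lerDl sqr_ge0.
by rewrite lerDr sqr_ge0.
Qed.

Lemma Re_norm_le (z : C) : re `|z| <= `|re z| + `|im z|.
Proof.
rewrite normc_def /=; case: z => x y /=.
rewrite -(@ler_pXn2r _ 2) ?nnegrE ?sqrtr_ge0 ?addr_ge0 // sqr_sqrtr ?addr_ge0 ?sqr_ge0 //.
by rewrite sqrrD !real_normK ?num_real // addrAC lerDl mulrn_wge0 // mulr_ge0.
Qed.

Lemma Re_norm_ge0 (z : C) : 0 <= re `|z|.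
Proof. by have [h _] := Re_norm_ge z; exact: le_trans h. Qed.

Lemma entireP a : entire a <-> cent a.
Proof.
split=> [ea|[er ei]].
  by split; apply: ent_le ea => k /=; rewrite [X in _ <= X]ger0_norm ?Re_norm_ge0 //;
    have [] := Re_norm_ge (a k).
have e : ent (fun k => `|re (a k)| + `|im (a k)|).
  by apply: entD => r; [exact: (@ent_norm (re \o a))|exact: (@ent_norm (im \o a))].
apply: ent_le e => k; rewrite [X in X <= _]ger0_norm ?Re_norm_ge0 // [X in _ <= X]ger0_norm ?addr_ge0 //.
exact: Re_norm_le.
Qed.

Definition cdiffs a k : C := k.+1%:R * a k.+1.

Lemma natC (n : nat) : (n%:R : C) = n%:R +i* 0.
Proof. by rewrite -(rmorph_nat (real_complex R)). Qed.

Lemma re_cdiffs a : re \o cdiffs a = pseries_diffs (re \o a).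
Proof.
by apply/funext => k; rewrite /cdiffs /pseries_diffs /= natC; case: (a k.+1) => x y /=; ring.
Qed.

Lemma im_cdiffs a : im \o cdiffs a = pseries_diffs (im \o a).
Proof.
by apply/funext => k; rewrite /cdiffs /pseries_diffs /= natC; case: (a k.+1) => x y /=; ring.
Qed.

Lemma cent_diffs a : cent a -> cent (cdiffs a).
Proof. by move=> [er ei]; split; rewrite ?re_cdiffs ?im_cdiffs; exact: ent_diffs. Qed.

Lemma cpseries_derive a r : cent a -> has_cD (1 : R) (cpseries a) r (cpseries (cdiffs a) r).
Proof.
move=> [er ei]; have [Dr Di] := (rps_derive r er, rps_derive r ei).
apply/has_cDP; rewrite !cpseriesE re_cdiffs im_cdiffs; split=> //.
by split; apply/derivable1_diffP; [case: Dr|case: Di].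
Qed.

Lemma cent_shift a : cent a -> cent (fun k => a k.+1).
Proof.
by move=> [er ei]; split; [exact: (@ent_shift (re \o a))|exact: (@ent_shift (im \o a))].
Qed.

Lemma centS a : cent (fun k => a k.+1) -> cent a.
Proof. by move=> [er ei]; split; [exact: (@entS (re \o a))|exact: (@entS (im \o a))]. Qed.

Lemma cpseries_shift a r : cent a ->
  cpseries a r = a 0%N + r%:C * cpseries (fun k => a k.+1) r.
Proof.
move=> [er ei]; rewrite !cpseriesE (rps_shift r er) (rps_shift r ei) /=.
rewrite -[re \o (fun k => a k.+1)]/(fun k => (re \o a) k.+1).
rewrite -[im \o (fun k => a k.+1)]/(fun k => (im \o a) k.+1).
by case: (a 0%N) => x y /=; simpc.
Qed.

Lemma cent_lin (x : C) a b : cent a -> cent b -> cent (fun k => x * a k + b k).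
Proof.
move=> [ar ai] [br bi]; split.
  have := entD (entD (@entZ _ (re x) ar) (@entZ _ (- im x) ai)) br; congr ent.
  apply/funext => k /=; case: (x) => ? ?; case: (a k) => ? ?; case: (b k) => ? ? /=; ring.
have := entD (entD (@entZ _ (re x) ai) (@entZ _ (im x) ar)) bi; congr ent.
apply/funext => k /=; case: (x) => ? ?; case: (a k) => ? ?; case: (b k) => ? ? /=; ring.
Qed.

Lemma cpseries_lin (x : C) a b r : cent a -> cent b ->
  cpseries (fun k => x * a k + b k) r = x * cpseries a r + cpseries b r.
Proof.
move=> [ar ai] [br bi]; rewrite !cpseriesE.
rewrite (_ : re \o (fun k => x * a k + b k) = (fun k => (re x * (re \o a) k + (- im x) * (im \o a) k) + (re \o b) k)); last first.
  by apply/funext => k /=; case: (x) => ? ?; case: (a k) => ? ?; case: (b k) => ? ? /=; ring.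
rewrite (_ : im \o (fun k => x * a k + b k) = (fun k => (re x * (im \o a) k + im x * (re \o a) k) + (im \o b) k)); last first.
  by apply/funext => k /=; case: (x) => ? ?; case: (a k) => ? ?; case: (b k) => ? ? /=; ring.
have E1 := @entZ _ (re x) ar; have E2 := @entZ _ (- im x) ai.
have E3 := @entZ _ (re x) ai; have E4 := @entZ _ (im x) ar.
rewrite (@rpsD _ _ r (entD E1 E2) br) (@rpsD _ _ r E1 E2) (@rpsD _ _ r (entD E3 E4) bi).
rewrite (@rpsD _ _ r E3 E4) (@rpsZ _ _ r ar) (@rpsZ _ _ r ai) (@rpsZ _ _ r ai) (@rpsZ _ _ r ar).
by case: (x) => x1 x2 /=; simpc; congr (_ +i* _); ring.
Qed.

Lemma cent0 : cent (fun=> 0).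
Proof.
suff e : ent (fun=> 0) by split.
move=> r; apply/cvg_ex; exists 0; rewrite (_ : pseries _ _ = cst 0); first exact: cvg_cst.
by apply/funext => n; rewrite /pseries /series /= big1 // => k _; rewrite mul0r.
Qed.

Lemma cpseries0 (r : R) : cpseries (fun=> 0) r = 0 :> C.
Proof.
suff e : rps (fun=> 0) r = 0 by rewrite cpseriesE; congr (_ +i* _).
rewrite /rps (_ : pseries _ _ = cst 0) ?lim_cst //.
by apply/funext => n; rewrite /pseries /series /= big1 // => k _; rewrite mul0r.
Qed.

Lemma centZ (x : C) a : cent a -> cent (fun k => x * a k).
Proof.
by move=> ea; have := cent_lin x ea cent0; congr cent; apply/funext => k; rewrite addr0.
Qed.

Lemma cpseriesZ (x : C) a r : cent a -> cpseries (fun k => x * a k) r = x * cpseries a r.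
Proof.
move=> ea; have := cpseries_lin x r ea cent0; rewrite cpseries0 addr0 => <-.
by congr cpseries; apply/funext => k; rewrite addr0.
Qed.

Lemma cpseries_at0 a : cent a -> cpseries a 0 = a 0%N.
Proof. by move=> ea; rewrite cpseries_shift // mul0r addr0. Qed.

Definition cmulX a k : C := if k is k'.+1 then a k' else 0.

Lemma cent_mulX a : cent a -> cent (cmulX a).
Proof. by move=> ea; apply: centS. Qed.

Lemma cpseries_mulX a r : cent a -> cpseries (cmulX a) r = r%:C * cpseries a r.
Proof. by move=> ea; rewrite (cpseries_shift r (cent_mulX ea)) add0r. Qed.

Lemma cpseries_cont a : cent a ->
  {for 0, continuous (re \o cpseries a)} /\ {for 0, continuous (im \o cpseries a)}.
Proof.
move=> ea; have [[dr di] _] := cpseries_derive 0 ea.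
by split; exact: differentiable_continuous.
Qed.

Lemma cont0_pos (f : R -> R) (y : R) : {for 0, continuous f} ->
  (forall r, 0 < r -> f r = y) -> f 0 = y.
Proof.
move=> cf fy; have h : f r @[r --> 0^'+] --> f 0 by apply: cvg_at_right_filter.
have h2 : f r @[r --> 0^'+] --> y.
  apply: cvg_near_cst; near=> r; apply/fy.
  by near: r; exact: nbhs_right_gt.
exact: (cvg_unique _ h h2).
Unshelve. all: by end_near. Qed.

Lemma cpseries_pos_at0 a (y : C) : cent a -> (forall r : R, 0 < r -> cpseries a r = y) -> a 0%N = y.
Proof.
move=> ea ay; rewrite -cpseries_at0 //; have [cr ci] := cpseries_cont ea.
apply/eqP; rewrite eq_complex; apply/andP; split; apply/eqP.
  by apply: (cont0_pos cr) => r r0; exact: (congr1 re (ay r r0)).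
by apply: (cont0_pos ci) => r r0; exact: (congr1 im (ay r r0)).
Qed.

Lemma cpseries_identity a : cent a -> (forall r : R, 0 < r -> cpseries a r = 0) -> forall k, a k = 0.
Proof.
move=> ea a0 k; elim: k a ea a0 => [|k IHk] a ea a0; first exact: cpseries_pos_at0 a0.
apply: (IHk (fun k => a k.+1)); first exact: cent_shift.
move=> r r0; have := a0 r r0; rewrite (cpseries_shift r ea) (cpseries_pos_at0 ea a0) add0r.
by move/eqP; rewrite mulf_eq0 (negbTE (realC_neq0 r0)) => /eqP.
Qed.

End PowerSeries.

Section RegularSolutions.
Variables (R : realType) (g : R).
Local Notation C := R[i].
Local Notation re := (@complex.Re R).
Implicit Types (l : nat) (la : C) (b : nat -> C).

Lemma cder_rderiv (f f' : R -> C) : cder f f' -> forall r, 0 < r -> rderiv f r = f' r.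
Proof. by move=> D r r0; have [_ <-] := D r r0; rewrite /rderiv !derive1E. Qed.

Lemma radial_eqP l la (F phi phi1 phi2 : R -> C) :
  cder phi phi1 -> cder phi1 phi2 -> (forall r, 0 < r -> F r = r%:C ^+ l * phi r) ->
  radial_eq g l la F <-> forall r, 0 < r -> phi2 r = rode g l la phi phi1 r.
Proof.
move=> D1 D2 FE.
have DF : cder F (fun r => r%:C ^+ l * (phi1 r + l%:R / r%:C * phi r)).
  apply: cder_ext (cderM (@cder_exp R l) D1) => r r0; first by rewrite FE.
  by have := realC_neq0 r0 => ?; field.
have Dl : cder (fun r => l%:R / r%:C) (fun r : R => - l%:R / r%:C ^+ 2).
  by apply: cder_ext (cderZ l%:R (@cder_inv R)) => r r0 //=; rewrite mulrN mulNr.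
have DF2 : cder (rderiv F) (fun r => r%:C ^+ l * (phi2 r + 2 * l%:R / r%:C * phi1 r
    + (l%:R * (l%:R - 1)) / r%:C ^+ 2 * phi r)).
  apply: cder_ext (cderM (@cder_exp R l) (cderD D2 (cderM Dl D1))) => r r0 /=.
    by rewrite (cder_rderiv DF).
  by have := realC_neq0 r0 => ?; field.
have E r : 0 < r -> (r ^+ 2)%:C * rderiv (rderiv F) r + (2 * r)%:C * rderiv F r
    - (l * l.+1)%:R * F r + (2 * g * r)%:C * F r + la * (r ^+ 2)%:C * F r =
    r%:C ^+ l * r%:C ^+ 2 * (phi2 r - rode g l la phi phi1 r).
  move=> r0; rewrite (cder_rderiv DF2) // (cder_rderiv DF) // FE // /rode.
  rewrite natrM -natr1 rmorphXn !rmorphM /= rmorph_nat.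
  by have := realC_neq0 r0 => ?; field.
split=> H r r0.
  have := H r r0; rewrite E // => /eqP; rewrite mulf_eq0 mulf_eq0 !expf_eq0 (negbTE (realC_neq0 r0)).
  by rewrite !andbF /= subr_eq0 => /eqP.
by rewrite E // H // subrr mulr0.
Qed.

Definition rec l la b := forall k,
  (k.+1%:R * (k%:R + 2 * l%:R + 2)) * b k.+1 + (2 * g%:C * b k + la * cmulX b k) = 0.

Lemma series_ode l la b : cent b ->
  (forall r : R, 0 < r -> cpseries (cdiffs (cdiffs b)) r =
     rode g l la (cpseries b) (cpseries (cdiffs b)) r) <-> rec l la b.
Proof.
move=> cb; have cb1 := cent_diffs cb; have cb2 := cent_diffs cb1.
pose t k := (k.+1%:R * (k%:R + 2 * l%:R + 2)) * b k.+1 + (2 * g%:C * b k + la * cmulX b k).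
pose t' k := 1 * cmulX (cdiffs (cdiffs b)) k
  + ((2 * l%:R + 2) * cdiffs b k + ((2 * g%:C) * b k + la * cmulX b k)).
have tt' : t = t'.
  apply/funext => k; rewrite /t /t' /cdiffs.
  by case: k => [|k] /=; rewrite -?natr1; ring.
have c0 := centZ la (cent_mulX cb); have c1 := cent_lin (2 * g%:C) cb c0.
have c2 := cent_lin (2 * l%:R + 2) cb1 c1.
have ct : cent t by rewrite tt'; exact: cent_lin (cent_mulX cb2) c2.
have E r : cpseries t r = r%:C * cpseries (cdiffs (cdiffs b)) r
    + ((2 * l%:R + 2) * cpseries (cdiffs b) r + (2 * g%:C * cpseries b r + la * (r%:C * cpseries b r))).
  rewrite tt' (cpseries_lin _ _ (cent_mulX cb2) c2) (cpseries_lin _ _ cb1 c1).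
  rewrite (cpseries_lin _ _ cb c0) (cpseriesZ _ _ (cent_mulX cb)) !cpseries_mulX //.
  by rewrite mul1r.
split=> [H|H r r0].
  apply: (cpseries_identity ct) => r r0; rewrite E H // /rode.
  by have := realC_neq0 r0 => ?; field.
have : cpseries t r = 0.
  by rewrite (_ : t = fun=> 0) ?cpseries0 //; apply/funext => k; exact: H.
rewrite E /rode => /eqP; rewrite addr_eq0 => /eqP e.
have rn := realC_neq0 r0; apply: (mulfI rn); rewrite e.
by field.
Qed.

Lemma series_rsol l la b : cent b -> rec l la b ->
  is_rsol g l la (cpseries b) (cpseries (cdiffs b)).
Proof.
move=> cb rb; split=> [r _|]; first exact: cpseries_derive.
apply: (@cder_ext _ (cpseries (cdiffs b)) _ (cpseries (cdiffs (cdiffs b)))) => //.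
  by apply/series_ode.
by move=> r _; exact: (cpseries_derive r (cent_diffs cb)).
Qed.

(* The coefficients of indices [k] and [k - 1]. *)
Fixpoint bpair l la k : C * C :=
  if k is k'.+1 then
    let p := bpair l la k' in
    (- (2 * g%:C * p.1 + la * p.2) / (k'.+1%:R * (k'%:R + 2 * l%:R + 2)), p.1)
  else (1, 0).

Definition bcoef l la k := (bpair l la k).1.

Lemma bpair2 l la k : (bpair l la k).2 = cmulX (bcoef l la) k.
Proof. by case: k. Qed.

Lemma rec_neq0 l k : (k.+1%:R * (k%:R + 2 * l%:R + 2) : C) != 0.
Proof.
by rewrite -natrM -natrD -natrD -natrM pnatr_eq0 muln_eq0 addn_eq0 andbF.
Qed.

Lemma bcoef_rec l la : rec l la (bcoef l la).
Proof.
move=> k; rewrite {1}/bcoef /= bpair2 -/(bcoef l la k) mulrCA mulfV ?rec_neq0 //.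
by rewrite mulr1 addNr.
Qed.

Lemma rec_uniq l la b : rec l la b -> forall k, b k = b 0%N * bcoef l la k.
Proof.
move=> rb k; suff [] : b k = b 0%N * bcoef l la k /\ cmulX b k = b 0%N * cmulX (bcoef l la) k by [].
elim: k => [|k [IH1 IH2]]; first by rewrite /= mulr0 mulr1.
split=> //=; apply: (mulfI (rec_neq0 l k)).
have /eqP := rb k; rewrite addr_eq0 => /eqP ->; rewrite IH1 IH2.
have /eqP := @bcoef_rec l la k; rewrite addr_eq0 => /eqP e.
transitivity (b 0%N * (k.+1%:R * (k%:R + 2 * l%:R + 2) * bcoef l la k.+1)); last by ring.
by rewrite e; ring.
Qed.

Lemma bcoef_bound l la k :
  `|bcoef l la k| <= (1 + `|2 * g%:C| + `|la|) ^+ k / k`!%:R.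
Proof.
set M := 1 + _ + _; have M1 : 1 <= M by rewrite /M -addrA lerDl addr_ge0.
have M0 : 0 <= M by apply: le_trans M1.
pose u j := M ^+ j / j`!%:R; have u0 j : 0 <= u j by rewrite divr_ge0 ?exprn_ge0 ?ler0n.
suff [] : `|bcoef l la k| <= u k /\ `|cmulX (bcoef l la) k| <= k%:R * u k by [].
elim: k => [|k [IH1 IH2]].
  by rewrite /u /= expr0 invr1 mulr1 normr1 normr0 mul0r.
have uS : k.+1%:R * u k.+1 = M * u k.
  rewrite /u factS natrM exprS; have : (k`!%:R : C) != 0 by rewrite pnatr_eq0 -lt0n fact_gt0.
  have : (k.+1%:R : C) != 0 by rewrite pnatr_eq0.
  by move=> ? ?; field; apply/andP.
split; last by rewrite /= uS; apply: le_trans IH1 _; rewrite ler_peMl.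
rewrite {1}/bcoef /= bpair2 -/(bcoef l la k) mulNr normrN normf_div.
rewrite [`|_%:R * _|]ger0_norm; last by rewrite -!natrM -!natrD -natrM ler0n.
have d0 : 0 < (k.+1%:R * (k%:R + 2 * l%:R + 2) : C).
  by rewrite lt_def rec_neq0 -!natrM -!natrD -natrM ler0n.
rewrite ler_pdivrMr // mulrCA mulrA uS.
apply: le_trans (ler_normD _ _) _; rewrite !normrM -normrM.
apply: le_trans (lerD (ler_wpM2l (normr_ge0 _) IH1) (ler_wpM2l (normr_ge0 _) IH2)) _.
rewrite -subr_ge0 (_ : _ - _ = u k * ((k%:R + 2 * l%:R + 2) + `|2 * g%:C| * (k%:R + 2 * l%:R + 1)
   + `|la| * (2 * l%:R + 2))); last by rewrite /M; ring.
by rewrite mulr_ge0 // !addr_ge0 ?mulr_ge0 ?addr_ge0 ?ler0n ?mulr_ge0 ?ler0n ?normr_ge0.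
Qed.

Lemma normC_Re (z : C) : `|z| = (re `|z|)%:C.
Proof. by rewrite normc_def. Qed.

Lemma cent_bcoef l la : cent (bcoef l la).
Proof.
apply/entireP; pose m := 1 + re `|2 * g%:C| + re `|la|.
have m0 : 0 <= m by rewrite !addr_ge0 ?Re_norm_ge0.
have e : ent (fun k => m ^+ k / k`!%:R).
  move=> r; suff -> : pseries (fun k => m ^+ k / k`!%:R) r = series (exp_coeff (m * r)).
    exact: is_cvg_series_exp_coeff.
  apply/funext => n; rewrite /pseries /series /=; apply: eq_bigr => k _.
  by rewrite /exp_coeff /= exprMn mulrAC.
apply: ent_le e => k; rewrite [X in X <= _]ger0_norm ?Re_norm_ge0 //.
rewrite [X in _ <= X]ger0_norm ?divr_ge0 ?exprn_ge0 ?ler0n //.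
have := bcoef_bound l la k; rewrite normC_Re [`|2 * _|]normC_Re [`|la|]normC_Re.
rewrite -(rmorph1 (real_complex R)) -!rmorphD -/m -rmorphXn -(rmorph_nat (real_complex R)).
by rewrite -fmorphV -rmorphM lecR.
Qed.

Definition phi l la : R -> C := cpseries (bcoef l la).
Definition phi1 l la : R -> C := cpseries (cdiffs (bcoef l la)).

Lemma phi_rsol l la : is_rsol g l la (phi l la) (phi1 l la).
Proof. by apply: series_rsol; [exact: cent_bcoef|exact: bcoef_rec]. Qed.

Lemma series_phi l la b r : cent b -> rec l la b -> cpseries b r = b 0%N * phi l la r.
Proof.
move=> cb rb; rewrite -(cpseriesZ _ _ (cent_bcoef l la)); congr cpseries.
by apply/funext => k; exact: rec_uniq.
Qed.

Lemma rsol_rec l la b phi' : cent b -> is_rsol g l la (cpseries b) phi' -> rec l la b.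
Proof.
move=> cb [D1 D2]; apply/series_ode => // r r0.
have Db : cder (cpseries b) (cpseries (cdiffs b)) by move=> s _; exact: cpseries_derive.
have Db1 : cder (cpseries (cdiffs b)) (cpseries (cdiffs (cdiffs b))).
  by move=> s _; exact: (cpseries_derive s (cent_diffs cb)).
have e := cder_uniq D1 Db.
have D2' := cder_ext e (fun _ _ => erefl) D2.
by rewrite -(cder_uniq D2' Db1 r0) /rode e.
Qed.

Lemma phi0 l la : phi l la 0 = 1.
Proof. by rewrite /phi cpseries_at0 //; exact: cent_bcoef. Qed.

Lemma iter_cmulX l b k : iter l (@cmulX R) b k = if (k < l)%N then 0 else b (k - l)%N.
Proof.
elim: l k => [|l IHl] k; first by rewrite subn0.
case: k => [|k] //=; rewrite IHl ltnS subSS //.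
Qed.

Lemma cent_iter_cmulX l b : cent b -> cent (iter l (@cmulX R) b).
Proof. by move=> cb; elim: l => //= l; exact: cent_mulX. Qed.

Lemma cpseries_iter l b r : cent b -> cpseries (iter l (@cmulX R) b) r = r%:C ^+ l * cpseries b r.
Proof.
move=> cb; elim: l => [|l IHl]; first by rewrite mul1r.
by rewrite iterS cpseries_mulX ?IHl ?exprS ?mulrA //; exact: cent_iter_cmulX.
Qed.

Lemma cent_iter_shift l b : cent b -> cent (fun k => b (k + l)%N).
Proof.
move=> cb; elim: l => [|l /cent_shift]; first by congr cent: cb; apply/funext => k; rewrite addn0.
by congr cent; apply/funext => k; rewrite addSnnS.
Qed.

Lemma regular_radialP l la F :
  regular_radial g l la F <-> F = fun r => r%:C ^+ l * phi l la r.
Proof.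
split=> [[Feq [a [/entireP ca a0 al Fa]]]|->].
  pose b k := a (k + l)%N; have cb : cent b := cent_iter_shift l ca.
  have aE : a = iter l (@cmulX R) b.
    apply/funext => k; rewrite iter_cmulX; case: ltnP => [/a0//|lk].
    by rewrite /b subnK.
  have FE r : F r = r%:C ^+ l * cpseries b r by rewrite Fa aE cpseries_iter.
  have Db : cder (cpseries b) (cpseries (cdiffs b)) by move=> s _; exact: cpseries_derive.
  have Db1 : cder (cpseries (cdiffs b)) (cpseries (cdiffs (cdiffs b))).
    by move=> s _; exact: (cpseries_derive s (cent_diffs cb)).
  have /(series_ode l la cb) rb := (@radial_eqP l la _ _ _ _ Db Db1 (fun r _ => FE r)).1 Feq.
  apply/funext => r; rewrite FE (series_phi r cb rb) /b add0n al mul1r //.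
have [D1 D2] := phi_rsol l la; split.
  by apply/(@radial_eqP l la _ _ _ _ D1 D2).
exists (iter l (@cmulX R) (bcoef l la)); have cb := cent_bcoef l la; split.
- by apply/entireP; exact: cent_iter_cmulX.
- by move=> k kl; rewrite iter_cmulX kl.
- by rewrite iter_cmulX ltnn subnn.
- by apply/funext => r; rewrite cpseries_iter.
Qed.

(* The coefficient of the raising part of the Runge-Lenz operators on regular solutions; in degree [l] its only zero is [la = - (g / (l + 1)) ^ 2]. *)
Definition Dl l la : C := (la * (l%:R + 1) ^+ 2 + g%:C ^+ 2) / ((2 * l%:R + 3) * (l%:R + 1)).

Lemma neq0_l1 l : (l%:R + 1 : C) != 0.
Proof. by rewrite natr1 pnatr_eq0. Qed.
Lemma neq0_2l3 l : (2 * l%:R + 3 : C) != 0.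
Proof. by rewrite -natrM -natrD pnatr_eq0 addn_eq0 andbF. Qed.

Lemma bcoef1 l la : bcoef l la 1 = - g%:C / (l%:R + 1).
Proof.
have := @bcoef_rec l la 0; rewrite /= mulr0 addr0 mulr1 mul1r add0r => /eqP.
rewrite addr_eq0 => /eqP e; have h : (2 * l%:R + 2 : C) != 0.
  by rewrite -natrM -natrD pnatr_eq0 addn_eq0 andbF.
apply: (mulfI h); rewrite e; have := neq0_l1 l => ?; field; done.
Qed.

Lemma bcoef2 l la : bcoef l la 2 = (2 * g%:C ^+ 2 / (l%:R + 1) - la) / (2 * (2 * l%:R + 3)).
Proof.
have := @bcoef_rec l la 1; rewrite /= mulr1 bcoef1 => /eqP.
rewrite addr_eq0 => /eqP e; have h := rec_neq0 l 1.
apply: (mulfI h); rewrite e; have := neq0_l1 l; have := neq0_2l3 l => ? ?; field.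
by apply/andP.
Qed.

Lemma rtheta_phi l la r : 0 < r -> rtheta g l (phi l la) (phi1 l la) r = - Dl l la * phi l.+1 la r.
Proof.
have cb := cent_bcoef l la; have cb1 := cent_diffs cb.
pose t k := (l%:R + 1) * cdiffs (bcoef l la) k + g%:C * bcoef l la k.
have ct : cent t := cent_lin _ cb1 (centZ _ cb).
have tE s : cpseries t s = (l%:R + 1) * phi1 l la s + g%:C * phi l la s.
  by rewrite (cpseries_lin _ _ cb1 (centZ _ cb)) cpseriesZ.
have t0 : t 0%N = 0.
  rewrite /t /cdiffs bcoef1 mul1r; have := neq0_l1 l => ?.
  by rewrite [bcoef l la 0]/(1 : C); field.
have ct' := cent_shift ct.
have E s : 0 < s -> rtheta g l (phi l la) (phi1 l la) s = cpseries (fun k => t k.+1) s.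
  move=> s0; rewrite /rtheta -tE (cpseries_shift s ct) t0 add0r.
  by rewrite mulrC mulKf // realC_neq0.
have [D1 D2] := rtheta_rsol (phi_rsol l la).
have sol : is_rsol g l.+1 la (cpseries (fun k => t k.+1)) (rtheta1 g l la (phi l la) (phi1 l la)).
  split; first exact: cder_ext D1.
  by apply: cder_ext D2 => // s s0; rewrite /rode E.
move=> r0; rewrite E // (series_phi r ct' (rsol_rec ct' sol)); congr (_ * _).
rewrite /t /cdiffs bcoef1 bcoef2 /Dl; have := neq0_l1 l; have := neq0_2l3 l => ? ?.
by field; apply/andP.
Qed.

Definition rlower1 l la (f f1 : R -> C) (r : R) : C :=
  - g%:C * r%:C * f1 r - ((2 * l%:R + 1) * g%:C + l%:R * la * r%:C) * f r.

Lemma cder_affine (a b : C) : cder (fun r : R => a + b * r%:C) (fun=> b).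
Proof.
by apply: cder_ext (cderD (cder_cst a) (cderZ b (@cder_id R))) => r r0 //=; rewrite add0r mulr1.
Qed.

Lemma rlower_rsol l la (f f1 : R -> C) : is_rsol g l.+1 la f f1 ->
  is_rsol g l la (rlower g l.+1 f f1) (rlower1 l.+1 la f f1).
Proof.
move=> [D1 D2]; split.
- have c1 := cderM (cder_affine 0 l.+1%:R) D2.
  have c2 := cderM (cder_affine (l.+1%:R * (2 * l.+1%:R + 1)) (- g%:C)) D1.
  apply: cder_ext (cderD c1 c2) => r r0 /=; rewrite /rlower /rlower1 /rode.
    by ring.
  by have := realC_neq0 r0 => ?; field.
- have c1 := cderM (cder_affine 0 (- g%:C)) D2.
  have c2 := cderM (cder_affine (- ((2 * l.+1%:R + 1) * g%:C)) (- (l.+1%:R * la))) D1.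
  apply: cder_ext (cderD c1 c2) => r r0 /=; rewrite /rlower /rlower1 /rode.
    by ring.
  by rewrite -!natr1; have := realC_neq0 r0 => ?; field.
Qed.

Lemma rlower_phi l la r : 0 < r ->
  rlower g l.+1 (phi l.+1 la) (phi1 l.+1 la) r = l.+1%:R * (2 * l.+1%:R + 1) * phi l la r.
Proof.
have cb := cent_bcoef l.+1 la; have cb1 := cent_diffs cb.
pose t k := l.+1%:R * cmulX (cdiffs (bcoef l.+1 la)) k + (l.+1%:R * (2 * l.+1%:R + 1) * bcoef l.+1 la k
  + - g%:C * cmulX (bcoef l.+1 la) k).
have c1 := centZ (- g%:C) (cent_mulX cb).
have c2 := cent_lin (l.+1%:R * (2 * l.+1%:R + 1)) cb c1.
have ct : cent t := cent_lin _ (cent_mulX cb1) c2.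
have E s : rlower g l.+1 (phi l.+1 la) (phi1 l.+1 la) s = cpseries t s.
  rewrite (cpseries_lin _ _ (cent_mulX cb1) c2) (cpseries_lin _ _ cb c1).
  rewrite (cpseriesZ _ _ (cent_mulX cb)) !cpseries_mulX // /rlower -/(phi _ _ _) -/(phi1 _ _ _).
  by ring.
have [D1 D2] := rlower_rsol (phi_rsol l.+1 la).
have sol : is_rsol g l la (cpseries t) (rlower1 l.+1 la (phi l.+1 la) (phi1 l.+1 la)).
  split; first by apply: cder_ext D1 => // s _; rewrite E.
  by apply: cder_ext D2 => // s s0; rewrite /rode E.
move=> r0; rewrite E (series_phi r ct (rsol_rec ct sol)); congr (_ * _).
by rewrite /t /= !mulr0 add0r addr0 [bcoef _ _ _]/(1 : C) mulr1.
Qed.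

End RegularSolutions.

Section SingularSolutions.
Variables (R : realType) (g : R).
Local Notation C := R[i].
Implicit Types (l : nat) (la : C).
Local Notation phi := (phi g).
Local Notation phi1 := (phi1 g).
Local Notation is_rsol := (is_rsol g).

Definition wronskian l (f f1 h h1 : R -> C) (r : R) : C :=
  r%:C ^+ (2 * l + 2) * (f r * h1 r - f1 r * h r).

Lemma wronskian_cst l la f f1 h h1 : is_rsol l la f f1 -> is_rsol l la h h1 ->
  forall r s, 0 < r -> 0 < s -> wronskian l f f1 h h1 r = wronskian l f f1 h h1 s.
Proof.
move=> [F1 F2] [H1 H2]; apply: cder_0_cst.
have D := cderM (@cder_exp R (2 * l + 2)) (cderD (cderM F1 H2) (cderZ (-1) (cderM F2 H1))).
apply: cder_ext D => r r0 /=; first by rewrite /wronskian; ring.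
by rewrite /rode natrD natrM; have := realC_neq0 r0 => ?; field.
Qed.

(* Plucker's relation: a solution is a combination of two independent ones, with constant coefficients. *)
Lemma wronskian_plucker l la f f1 h h1 d d1 w : w != 0 -> is_rsol l la f f1 -> is_rsol l la h h1 ->
  is_rsol l la d d1 -> (forall r, 0 < r -> wronskian l f f1 h h1 r = w) ->
  forall r, 0 < r -> d r = wronskian l d d1 h h1 1 / w * f r + wronskian l f f1 d d1 1 / w * h r.
Proof.
move=> w0 sf sh sd W r r0.
rewrite (wronskian_cst sd sh ltr01 r0) (wronskian_cst sf sd ltr01 r0).
apply: (mulfI w0); rewrite -{1}(W r r0) mulrDr.
have -> x y : w * (x / w * y) = x * y by field.
have -> x y : w * (x / w * y) = x * y by field.
by rewrite /wronskian; ring.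
Qed.

Lemma wronskian_rtheta l la f f1 h h1 r : 0 < r -> is_rsol l.+1 la f f1 -> is_rsol l la h h1 ->
  wronskian l.+1 f f1 (rtheta g l h h1) (rtheta1 g l la h h1) r =
  - wronskian l (rlower g l.+1 f f1) (rlower1 g l.+1 la f f1) h h1 r.
Proof.
move=> r0 sf sh; rewrite /wronskian /rtheta /rtheta1 /rlower /rlower1.
have -> : (2 * l.+1 + 2 = (2 * l + 2) + 2)%N by rewrite mulnS addnAC addnC addnA.
by rewrite exprD -!natr1; have := realC_neq0 r0 => ?; field.
Qed.

Lemma singular_radialP l la G : singular_radial g l la G ->
  exists h c, [/\ cent h, h 0%N = 1 & forall r, 0 < r ->
    G r = r%:C ^+ l * (cpseries h r / r%:C ^+ (2 * l + 1) + c * (ln r)%:C * phi l la r)].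
Proof.
move=> [_ [h [c [F [/entireP ch h0 /regular_radialP -> GE]]]]].
exists h, c; split=> // r r0; rewrite GE //.
have -> : (2 * l + 1 = l + l.+1)%N by rewrite mul2n -addnn addnS addn0 addnS.
rewrite exprD.
have := realC_neq0 r0; have : r%:C ^+ l != 0 by rewrite expf_neq0 // realC_neq0.
have : r%:C ^+ l.+1 != 0 by rewrite expf_neq0 // realC_neq0.
move=> ? ? ?; field; do ?[apply/andP; split=> //].
Qed.

Section Frobenius.
Variables (l : nat) (la : C) (h : nat -> C) (c : C).
Hypotheses (ch : cent h) (h0 : h 0%N = 1).

Definition frob (r : R) : C := cpseries h r / r%:C ^+ (2 * l + 1) + c * (ln r)%:C * phi l la r.
Definition frob1 (r : R) : C :=
  (r%:C * cpseries (cdiffs h) r - (2 * l%:R + 1) * cpseries h r + c * (r%:C ^+ (2 * l + 1) * phi l la r))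
    / r%:C ^+ (2 * l + 2) + c * (ln r)%:C * phi1 l la r.

Lemma cder_expV n : cder (fun r : R => r%:C ^- n) (fun r => - n%:R / r%:C ^+ n.+1).
Proof.
elim: n => [|n IHn].
  apply: cder_ext (cder_cst 1) => r r0; first by rewrite expr0 invr1.
  by rewrite oppr0 mul0r.
apply: cder_ext (cderM (@cder_inv R) IHn) => r r0 /=; first by rewrite exprS invfM.
have rn := realC_neq0 r0; rewrite !exprS -natr1.
by have := expf_neq0 n rn => ?; field; apply/andP.
Qed.

Lemma cder_frob : cder frob frob1.
Proof.
have Dh : cder (cpseries h) (cpseries (cdiffs h)) by move=> s _; exact: cpseries_derive.
have [Dp _] := phi_rsol g l la.
have D := cderD (cderM Dh (cder_expV (2 * l + 1))) (cderM (cderZ c (@cder_ln R)) Dp).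
apply: cder_ext D => r r0 //=.
rewrite /frob1 natrD natrM.
have rn := realC_neq0 r0; have := expf_neq0 (2 * l + 1) rn.
have -> : (2 * l + 2 = (2 * l + 1).+1)%N by rewrite addnS.
by rewrite exprS => ?; field; apply/andP.
Qed.

Lemma cder_frob1 : exists frob2, cder frob1 frob2.
Proof.
have Dh : cder (cpseries h) (cpseries (cdiffs h)) by move=> s _; exact: cpseries_derive.
have Dh1 : cder (cpseries (cdiffs h)) (cpseries (cdiffs (cdiffs h))).
  by move=> s _; exact: (cpseries_derive s (cent_diffs ch)).
have [Dp Dp1] := phi_rsol g l la.
have D1 := cderD (cderD (cderM (@cder_id R) Dh1) (cderZ (- (2 * l%:R + 1)) Dh))
  (cderZ c (cderM (@cder_exp R (2 * l + 1)) Dp)).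
have D := cderD (cderM D1 (cder_expV (2 * l + 2))) (cderM (cderZ c (@cder_ln R)) Dp1).
eexists; apply: cder_ext D => r r0 //=.
by rewrite /frob1; congr (_ / _ + _); ring.
Qed.

Lemma frob_rsol G : radial_eq g l la G -> (forall r, 0 < r -> G r = r%:C ^+ l * frob r) ->
  is_rsol l la frob frob1.
Proof.
move=> Geq GE; have [frob2 D2] := cder_frob1.
split; first exact: cder_frob.
apply: cder_ext (D2) => // r r0.
exact: (@radial_eqP _ _ l la _ _ _ _ cder_frob D2 GE).1.
Qed.

(* The logarithms cancel in the Wronskian, which extends continuously to 0. *)
Lemma wronskian_frob : is_rsol l la frob frob1 -> forall r, 0 < r ->
  wronskian l (phi l la) (phi1 l la) frob frob1 r = - (2 * l%:R + 1).
Proof.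
move=> sfrob; set f := fun r => r%:C * cpseries (cdiffs h) r - (2 * l%:R + 1) * cpseries h r + c * (r%:C ^+ (2 * l + 1) * phi l la r).
pose k r := phi l la r * f r - r%:C * (phi1 l la r * cpseries h r).
have wk r : 0 < r -> wronskian l (phi l la) (phi1 l la) frob frob1 r = k r.
  move=> r0; rewrite /wronskian /frob /frob1 -/(f r) /k.
  have rn := realC_neq0 r0; have := expf_neq0 (2 * l + 1) rn.
  have -> : (2 * l + 2 = (2 * l + 1).+1)%N by rewrite addnS.
  by rewrite exprS => ?; field; apply/andP.
have k0 : k 0 = - (2 * l%:R + 1).
  rewrite /k /f !mul0r exprD mulr0 mul0r mulr0 add0r addr0 phi0 cpseries_at0 // h0; ring.
have ck x : exists d, has_cD (1 : R) k x d.
  have Dph : has_cD (1 : R) (phi l la) x _ := cpseries_derive x (cent_bcoef g l la).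
  have Dph1 : has_cD (1 : R) (phi1 l la) x _ := cpseries_derive x (cent_diffs (cent_bcoef g l la)).
  have Dh : has_cD (1 : R) (cpseries h) x _ := cpseries_derive x ch.
  have Dh1 : has_cD (1 : R) (cpseries (cdiffs h)) x _ := cpseries_derive x (cent_diffs ch).
  have Did : has_cD (1 : R) (fun r : R => r%:C) x 1.
    by apply: (@has_cD_real _ _ _ id); apply/derivable1_diffP; exact: derivable_id.
  have De n : exists d, has_cD (1 : R) (fun r : R => r%:C ^+ n) x d.
    elim: n => [|n [d IHn]]; first by exists 0; exact: has_cD_cst.
    by eexists; apply: has_cD_ext (has_cDM Did IHn) => r /=; rewrite exprS.
  have [de De'] := De (2 * l + 1)%N.
  have Df := has_cDD (has_cDD (has_cDM Did Dh1) (has_cDZ (- (2 * l%:R + 1)) Dh)) (has_cDZ c (has_cDM De' Dph)).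
  have D := has_cDD (has_cDM Dph Df) (has_cDZ (-1) (has_cDM Did (has_cDM Dph1 Dh))).
  by eexists; apply: has_cD_ext D => r /=; rewrite /k /f; ring.
have [d [[dr di] _]] := ck 0.
have E r : 0 < r -> k r = k 1 by move=> r0; rewrite -!wk // (wronskian_cst (phi_rsol g l la) sfrob r0 ltr01).
have k1 : k 1 = k 0.
  apply/eqP; rewrite eq_complex; apply/andP; split; apply/eqP/esym.
    apply: (cont0_pos (f := (@complex.Re R) \o k)); first exact: differentiable_continuous.
    by move=> r r0; exact: (congr1 (@complex.Re R) (E r r0)).
  apply: (cont0_pos (f := (@complex.Im R) \o k)); first exact: differentiable_continuous.
  by move=> r r0; exact: (congr1 (@complex.Im R) (E r r0)).
by move=> r r0; rewrite wk // E // k1 k0.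
Qed.

End Frobenius.

(* The value of the Wronskian encodes the normalization of the [r^-(l+1)]-coefficient of [r^l psi]. *)
Definition is_sing l la (psi psi' : R -> C) := is_rsol l la psi psi' /\
  forall r, 0 < r -> wronskian l (phi l la) (phi1 l la) psi psi' r = - (2 * l%:R + 1).

Lemma singular_is_sing l la G : singular_radial g l la G ->
  exists psi psi', is_sing l la psi psi' /\ forall r, 0 < r -> G r = r%:C ^+ l * psi r.
Proof.
move=> sG; have [Geq _] := sG; have [h [c [ch h0 GE]]] := singular_radialP sG.
have sfrob := frob_rsol ch Geq GE.
exists (frob l la h c), (frob1 l la h c); split=> //.
by split=> //; exact: wronskian_frob.
Qed.

Lemma singular_raise l la G : singular_radial g l la G -> exists G', singular_radial g l.+1 la G'.
Proof.
move=> sG; have [Geq _] := sG; have [h [c [ch h0 GE]]] := singular_radialP sG.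
have sfrob := frob_rsol ch Geq GE; have [D1 D2] := rtheta_rsol sfrob.
pose w : C := - ((l%:R + 1) * (2 * l%:R + 1)).
have w0 : w != 0 by rewrite oppr_eq0 mulf_neq0 ?neq0_l1 ?neq0_2l1.
pose th r := w^-1 * rtheta g l (frob l la h c) (frob1 l la h c) r.
have cb := cent_bcoef g l la.
pose h' k := w^-1 * ((l%:R + 1) * cmulX (cdiffs h) k + (- ((l%:R + 1) * (2 * l%:R + 1)) * h k
  + (g%:C * cmulX h k + (l%:R + 1) * c * iter (2 * l + 1) (@cmulX R) (bcoef g l la) k))).
have c1 := centZ ((l%:R + 1) * c) (cent_iter_cmulX (2 * l + 1) cb).
have c2 := cent_lin g%:C (cent_mulX ch) c1.
have c3 := cent_lin (- ((l%:R + 1) * (2 * l%:R + 1))) ch c2.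
have c4 := cent_lin (l%:R + 1) (cent_mulX (cent_diffs ch)) c3.
have ch' : cent h' := centZ _ c4.
have h'E r : cpseries h' r = w^-1 * ((l%:R + 1) * (r%:C * cpseries (cdiffs h) r)
   + (- ((l%:R + 1) * (2 * l%:R + 1)) * cpseries h r
   + (g%:C * (r%:C * cpseries h r) + (l%:R + 1) * c * (r%:C ^+ (2 * l + 1) * phi l la r)))).
  rewrite (cpseriesZ _ _ c4) (cpseries_lin _ _ (cent_mulX (cent_diffs ch)) c3).
  rewrite (cpseries_lin _ _ ch c2) (cpseries_lin _ _ (cent_mulX ch) c1).
  rewrite (cpseriesZ _ _ (cent_iter_cmulX _ cb)) cpseries_iter // !cpseries_mulX //.
  exact: cent_diffs.
pose F' r := r%:C ^+ l.+1 * phi l.+1 la r.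
pose c' := w^-1 * c * - Dl g l la.
have thE r : 0 < r -> r%:C ^+ l.+1 * th r = cpseries h' r / r%:C ^+ l.+2 + c' * (ln r)%:C * F' r.
  move=> r0; rewrite h'E /F' /c'; have rn := realC_neq0 r0.
  have e := rtheta_phi g l la r0; rewrite /th /rtheta /frob /frob1.
  transitivity (r%:C ^+ l.+1 * w^-1 * ((((l%:R + 1) * (r%:C * cpseries (cdiffs h) r - (2 * l%:R + 1) * cpseries h r + c * (r%:C ^+ (2 * l + 1) * phi l la r))
    / r%:C ^+ (2 * l + 2) + g%:C * (cpseries h r / r%:C ^+ (2 * l + 1))) / r%:C) + c * (ln r)%:C * rtheta g l (phi l la) (phi1 l la) r)).
    by rewrite /rtheta; field; rewrite rn !expf_neq0.
  rewrite e; have -> : (2 * l + 2 = (l + l.+1).+1)%N by rewrite mul2n -addnn addnS addnS addn0 addnS.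
  have -> : (2 * l + 1 = l + l.+1)%N by rewrite mul2n -addnn addnS addn0 addnS.
  rewrite !(exprS, exprD); have := expf_neq0 l rn => ?.
  by field; do ?[apply/andP; split=> //].
exists (fun r => r%:C ^+ l.+1 * th r); split.
  apply/(@radial_eqP _ _ l.+1 la _ th _ _ (cderZ w^-1 D1) (cderZ w^-1 D2)) => // r r0.
  by rewrite /rode /th; ring.
exists h', c', F'; split=> //.
- exact/entireP.
- rewrite /h' iter_cmulX addn1 /= h0 !mulr0 add0r mulr1 !addr0.
  by rewrite -/w mulVf.
- exact/regular_radialP.
Qed.

Lemma is_sing_rtheta l la psi psi' chi chi' : is_sing l la psi psi' -> is_sing l.+1 la chi chi' ->
  exists a, forall r, 0 < r -> rtheta g l psi psi' r =
    - ((l%:R + 1) * (2 * l%:R + 1)) * chi r + a * phi l.+1 la r.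
Proof.
move=> [sp Wp] [sc Wc]; have st := rtheta_rsol sp; have sphi := phi_rsol g l.+1 la.
have w0 : - (2 * l.+1%:R + 1) != 0 :> C by rewrite oppr_eq0 neq0_2l1.
have Wt : wronskian l.+1 (phi l.+1 la) (phi1 l.+1 la) (rtheta g l psi psi') (rtheta1 g l la psi psi') 1
   = (l%:R + 1) * (2 * l%:R + 3) * (2 * l%:R + 1).
  rewrite (wronskian_rtheta ltr01 sphi sp).
  have [L1 _] := rlower_rsol sphi.
  have e := fun r r0 => @rlower_phi _ g l la r r0.
  have [P1 _] := phi_rsol g l la.
  have e1 := cder_uniq (cder_ext e (fun _ _ => erefl) L1) (cderZ (l.+1%:R * (2 * l.+1%:R + 1)) P1).
  have := Wp 1 ltr01; rewrite /wronskian e1 ?ltr01 // e ?ltr01 // => W.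
  transitivity (- (l.+1%:R * (2 * l.+1%:R + 1)) * - (2 * l%:R + 1) : C); last by rewrite -!natr1; ring.
  by rewrite -W; ring.
exists (wronskian l.+1 (rtheta g l psi psi') (rtheta1 g l la psi psi') chi chi' 1 / - (2 * l.+1%:R + 1)) => r r0.
rewrite (wronskian_plucker w0 sphi sc st Wc r0) Wt addrC; congr (_ * _ + _).
by rewrite -natr1; have := neq0_2l1 R l.+1; rewrite -natr1 => ?; field.
Qed.

Lemma is_sing_rlower l la psi psi' chi chi' : is_sing l.+1 la psi psi' -> is_sing l la chi chi' ->
  exists a, forall r, 0 < r -> rlower g l.+1 psi psi' r =
    Dl g l la * (2 * l%:R + 3) / (2 * l%:R + 1) * chi r + a * phi l la r.
Proof.
move=> [sp Wp] [sc Wc]; have sphi := phi_rsol g l la; have sL := rlower_rsol sp.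
have w0 : - (2 * l%:R + 1) != 0 :> C by rewrite oppr_eq0 neq0_2l1.
have st := rtheta_rsol sphi; have [T1 _] := st.
have e := fun r r0 => @rtheta_phi _ g l la r r0.
have [P1 _] := phi_rsol g l.+1 la.
have e1 := cder_uniq (cder_ext e (fun _ _ => erefl) T1) (cderZ (- Dl g l la) P1).
have W1 : wronskian l (phi l la) (phi1 l la) (rlower g l.+1 psi psi') (rlower1 g l.+1 la psi psi') 1
   = - (Dl g l la * (2 * l%:R + 3)).
  have := wronskian_rtheta ltr01 sp sphi; rewrite {1}/wronskian e1 ?ltr01 // e ?ltr01 // => W.
  have n1 : l.+1%:R = l%:R + 1 :> C by rewrite natr1.
  have := Wp 1 ltr01; rewrite {1}/wronskian n1 => Wp1.
  transitivity (- wronskian l (rlower g l.+1 psi psi') (rlower1 g l.+1 la psi psi') (phi l la) (phi1 l la) 1).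
    by rewrite /wronskian; ring.
  rewrite -W; transitivity (Dl g l la * - (2 * (l%:R + 1) + 1) : C); last by ring.
  by rewrite -Wp1; ring.
exists (wronskian l (rlower g l.+1 psi psi') (rlower1 g l.+1 la psi psi') chi chi' 1 / - (2 * l%:R + 1)) => r r0.
rewrite (wronskian_plucker w0 sphi sc sL Wc r0) W1 addrC; congr (_ * _ + _).
by have := neq0_2l1 R l => ?; field.
Qed.

Lemma is_sing_uniq l la psi psi' chi chi' : is_sing l la psi psi' -> is_sing l la chi chi' ->
  exists a, forall r, 0 < r -> psi r = chi r + a * phi l la r.
Proof.
move=> [sp Wp] [sc Wc]; have sphi := phi_rsol g l la.
have w0 : - (2 * l%:R + 1) != 0 :> C by rewrite oppr_eq0 neq0_2l1.
exists (wronskian l psi psi' chi chi' 1 / - (2 * l%:R + 1)) => r r0.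
by rewrite (wronskian_plucker w0 sphi sc sp Wc r0) Wp ?ltr01 // divff // mul1r addrC.
Qed.

End SingularSolutions.

(** * The module of regular solutions *)

Section SubquotientTheory.
Variables (K : pzRingType) (V : lmodType K) (U W : set V).

Definition rep (c : subquot U W) : V := val (repr c).

Lemma rep_mem c : lspan U (rep c).
Proof. by apply/lspan_predE; exact: (valP (repr c)). Qed.

Lemma sqcls_rep c : sqcls U W (rep c) = c.
Proof.
rewrite /sqcls /rep.
have -> : insubd (0 : submod U) (val (repr c)) = repr c by exact: valKd.
exact: reprK.
Qed.

Lemma sqcls_eq u v : lspan U u -> lspan U v ->
  (sqcls U W u = sqcls U W v) <-> lspan W (u - v).
Proof.
move=> Uu Uv; have uU : u \in lspan_pred U by exact/lspan_predE.
have vU : v \in lspan_pred U by exact/lspan_predE.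
rewrite /sqcls; split.
  move=> /eqP; rewrite -Quotient.idealrBE => /lspan_predE.
  by rewrite /= !val_insubd uU vU.
move=> Wuv; apply/eqP; rewrite -Quotient.idealrBE; apply/lspan_predE.
by rewrite /= !val_insubd uU vU.
Qed.

Lemma rep_sqcls v : lspan U v -> lspan W (rep (sqcls U W v) - v).
Proof. by move=> Uv; apply/sqcls_eq => //; [exact: rep_mem|exact: sqcls_rep]. Qed.

Lemma sqcls_lin a u v : lspan U u -> lspan U v ->
  sqcls U W (a *: u + v) = a *: sqcls U W u + sqcls U W v.
Proof.
move=> Uu Uv; have uU : u \in lspan_pred U by exact/lspan_predE.
have vU : v \in lspan_pred U by exact/lspan_predE.
rewrite -[a *: sqcls U W u]/(subquot_scale a (sqcls U W u)) /sqcls (subquot_scale_cls W a).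
have -> : insubd (0 : submod U) (a *: u + v) = a *: insubd 0 u + insubd 0 v.
  apply: val_inj; rewrite /= !val_insubd uU vU.
  by rewrite (_ : _ \in _ = true) //; apply/lspan_predE; exact: lspan_linear.
by rewrite (@Quotient.pi_add _ (sub_pred (U:=U) W)).
Qed.

Lemma sqcls0 : sqcls U W 0 = 0.
Proof.
have := sqcls_lin 0 (lspan0 U) (lspan0 U); rewrite scale0r addr0 => {1}->.
by rewrite scale0r add0r; have := sqcls_lin (-1) (lspan0 U) (lspan0 U);
  rewrite scaler0 addr0 scaleN1r addNr.
Qed.

Lemma sqclsZ a u : lspan U u -> sqcls U W (a *: u) = a *: sqcls U W u.
Proof. by move=> Uu; have := sqcls_lin a Uu (lspan0 U); rewrite sqcls0 !addr0. Qed.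

Lemma sqclsD u v : lspan U u -> lspan U v -> sqcls U W (u + v) = sqcls U W u + sqcls U W v.
Proof. by move=> Uu Uv; have := sqcls_lin 1 Uu Uv; rewrite !scale1r. Qed.

Lemma sqcls_eq0 u : lspan U u -> (sqcls U W u = 0) <-> lspan W u.
Proof. by move=> Uu; rewrite -sqcls0 sqcls_eq ?subr0 //; exact: lspan0. Qed.

Lemma rep_lin a c d : lspan W (rep (a *: c + d) - (a *: rep c + rep d)).
Proof.
apply/sqcls_eq; first exact: rep_mem.
  by apply: lspan_linear; exact: rep_mem.
by rewrite sqcls_rep sqcls_lin ?sqcls_rep //; exact: rep_mem.
Qed.

Lemma sqmap_sqcls (X : V -> V) v :
  (forall u, lspan W u -> lspan U u) ->
  (forall u v, lspan U u -> lspan U v -> X (u - v) = X u - X v) ->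
  (forall u, lspan W u -> lspan W (X u)) ->
  lspan U v -> lspan U (X v) ->
  sqmap (U:=U) (W:=W) X (sqcls U W v) = sqcls U W (X v).
Proof.
move=> WU Xlin XW Uv UXv; rewrite /sqmap -/(rep _).
have Ur := rep_mem (sqcls U W v); have Wr := rep_sqcls Uv.
have E : X (rep (sqcls U W v)) - X v = X (rep (sqcls U W v) - v) by rewrite Xlin.
apply/sqcls_eq => //; last by rewrite E; exact: XW.
rewrite -[X (rep _)](subrK (X v)) E; apply: lspanD => //.
by apply: WU; exact: XW.
Qed.

End SubquotientTheory.

Section RegularModule.
Variables (R : realType) (g : R).
Local Notation C := R[i].
Local Notation fn := (fn R).
Local Notation space0 := (space0 R).
Local Notation rad := (@Defs.rad R).
Implicit Types (f P Q : fn) (x : space0) (i : 'I_3) (l : nat) (la : C).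

Definition reg l la P : fn := rp (phi g l la) P.

Lemma reg_lin l la a P Q : reg l la (a *: P + Q) = a *: reg l la P + reg l la Q.
Proof. by rewrite /reg rpD rpZ. Qed.
Lemma regZ l la a P : reg l la (a *: P) = a *: reg l la P.
Proof. exact: rpZ. Qed.
Lemma regD l la P Q : reg l la (P + Q) = reg l la P + reg l la Q.
Proof. exact: rpD. Qed.
Lemma reg0 l la : reg l la 0 = 0.
Proof. exact: rp0. Qed.
Lemma reg_sum l la (I : Type) (r : seq I) (F : I -> fn) :
  reg l la (\sum_(a <- r) F a) = \sum_(a <- r) reg l la (F a).
Proof.
elim: r => [|a r IHr]; first by rewrite !big_nil reg0.
by rewrite !big_cons regD IHr.
Qed.

Definition reg_gen la : set fn := [set f | exists l P, harm l P /\ f = reg l la P].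

Lemma sphericalP l (Y : fn) : spherical l Y <-> exists2 P, harm l P & Y = rp (fun r => r%:C ^- l) P.
Proof.
split=> [[P [hP lP ->]]|[P [hP lP] ->]]; exists P => //.
- by split=> //; rewrite -laplacianE.
- by apply: fnP => x; rewrite rpE mulrC.
- by split=> //; [rewrite laplacianE|apply: fnP => x; rewrite rpE mulrC].
Qed.

Lemma radial_spherical (G psi : R -> C) l P : (forall r, 0 < r -> G r = r%:C ^+ l * psi r) ->
  (fun x => G (rad x) * rp (fun r => r%:C ^- l) P x) = rp psi P.
Proof.
move=> GE; apply: fnP => x; rewrite !rpE GE ?rad_gt0 //.
by have := expf_neq0 l (radC_neq0 x) => ?; field.
Qed.

Lemma RegSolE la : RegSol g la = lspan (reg_gen la).
Proof.
congr lspan; apply/seteqP; split=> f.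
  move=> [l [F [Y [/regular_radialP -> /sphericalP[P hP ->] ->]]]].
  exists l, P; split=> //.
  exact: (@radial_spherical (fun r => r%:C ^+ l * phi g l la r) (phi g l la) l P (fun r _ => erefl)).
move=> [l [P [hP ->]]]; exists l, (fun r => r%:C ^+ l * phi g l la r), (rp (fun r => r%:C ^- l) P).
split; first exact/regular_radialP.
- by apply/sphericalP; exists P.
- exact/esym/(@radial_spherical (fun r => r%:C ^+ l * phi g l la r) (phi g l la) l P (fun r _ => erefl)).
Qed.

Lemma reg_mem l la P : harm l P -> RegSol g la (reg l la P).
Proof. by move=> hP; rewrite RegSolE; apply: lspan_gen; exists l, P. Qed.

Lemma reg_Sol l la P : harm l P -> Sol g la (reg l la P).
Proof. by move=> hP; exact: Sol_rp (phi_rsol g l la) hP. Qed.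

Lemma RegSol_span la : lspan (RegSol g la) `<=` RegSol g la.
Proof. by rewrite RegSolE; apply: lspan_sub. Qed.

Lemma RegSol_lin la a f h : RegSol g la f -> RegSol g la h -> RegSol g la (a *: f + h).
Proof. exact: lspan_linear. Qed.

Lemma RegSol_Sol la : RegSol g la `<=` lspan (Sol g la).
Proof.
rewrite RegSolE; apply: lspan_sub => _ [l [P [hP ->]]].
by apply: lspan_gen; exact: reg_Sol.
Qed.

Lemma lspan_Sol_smooth la f : lspan (Sol g la) f -> smooth f.
Proof.
move: f; apply: lspan_ind; first exact: smooth0.
  by move=> a f h; exact: smooth_lin.
by move=> f [].
Qed.

Lemma RegSol_smooth la f : RegSol g la f -> smooth f.
Proof. by move=> /RegSol_Sol /lspan_Sol_smooth. Qed.

Definition casimir f : fn := \sum_i ang i (ang i f).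

Lemma casimir_rp l psi P : rsmooth psi -> harm l P ->
  casimir (rp psi P) = (- (l%:R * (l%:R + 1))) *: rp psi P.
Proof.
move=> sp hP; have [psi' D _] := rsmooth_ex sp; rewrite /casimir -rpZ -(angmom_casimir hP).
transitivity (\sum_i rp psi (ang i (ang i P))).
  apply: eq_bigr => i _; have dP : fdiff P by case: hP => /hom_diff.
  by rewrite (ang_rp i D dP) (ang_rp i D) //; have [/hom_diff] := harm_angmom i hP.
by apply: fnP => x; rewrite !fnE mulr_sumr; apply: eq_bigr => i _; rewrite fnE.
Qed.

Local Notation rprods := (lspan (@radial_products R)).

Lemma rprods_xm i f : rprods f -> rprods (xm i f).
Proof.
move: f; apply: lspan_ind; first by rewrite xm0; exact: lspan0.
  by move=> a f h Sf Sh; rewrite xm_lin; exact: lspan_linear.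
move=> _ [psi [P [l [sp hP ->]]]]; apply: lspan_gen; exists psi, (xm i P), l.+1.
split=> //; first exact: homogeneous_xm.
by apply: fnP => x; rewrite !fnE; ring.
Qed.

Lemma rprods_ang i f : rprods f -> rprods (ang i f).
Proof.
by move=> /radial_products_pd[_ Sf]; apply: lspanB; exact: rprods_xm.
Qed.

Lemma casimirD f h : rprods f -> rprods h -> casimir (f + h) = casimir f + casimir h.
Proof.
move=> sf sh; rewrite /casimir -big_split; apply: eq_bigr => i _ /=.
have lin (a b : fn) : rprods a -> rprods b -> ang i (a + b) = ang i a + ang i b.
  move=> /smooth_radial_products sa /smooth_radial_products sb.
  by have := ang_lin2 i 1 sa sb; rewrite !scale1r.
by rewrite lin // lin //; exact: rprods_ang.
Qed.

Lemma casimir0 : casimir 0 = 0.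
Proof.
have ang0 i : ang i (0 : fn) = 0 by rewrite /ang !partial0 !xm0 subrr.
by rewrite /casimir big1 // => i _; rewrite !ang0.
Qed.

Lemma rprods_rp l psi P : rsmooth psi -> harm l P -> rprods (rp psi P).
Proof. by move=> sp [hP _]; apply: lspan_gen; exists psi, P, l. Qed.

Lemma smooth_rp_harm l psi P : rsmooth psi -> harm l P -> smooth (rp psi P).
Proof. by move=> sp [hP _]; exact: smooth_rp hP. Qed.

Lemma smooth_sum (I : Type) (r : seq I) (F : I -> fn) :
  (forall a, smooth (F a)) -> smooth (\sum_(a <- r) F a).
Proof.
move=> sF; elim/big_rec: _ => [|a f _ sf]; first exact: smooth0.
by rewrite -[F a]scale1r; exact: smooth_lin.
Qed.

Lemma casimir_sum (I : Type) (r : seq I) (F : I -> fn) :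
  (forall a, rprods (F a)) -> casimir (\sum_(a <- r) F a) = \sum_(a <- r) casimir (F a).
Proof.
move=> sF; elim: r => [|a r IHr]; first by rewrite !big_nil casimir0.
by rewrite !big_cons casimirD ?IHr //; apply: lspan_sum => b _; exact: sF.
Qed.

Lemma casimir_eigen_inj l N : (l < N)%N -> (N%:R * (N%:R + 1) - l%:R * (l%:R + 1) : C) != 0.
Proof.
move=> lN; rewrite subr_eq0 !natr1 -!natrM eqr_nat neq_ltn; apply/orP; right.
by apply: ltn_mul.
Qed.

(* The spherical components are eigenvectors of the Casimir operator for distinct eigenvalues. *)
Lemma casimir_indep N (psi : nat -> R -> C) (P : nat -> fn) :
  (forall l, rsmooth (psi l)) -> (forall l, harm l (P l)) ->
  \sum_(l < N) rp (psi l) (P l) = 0 -> forall l, (l < N)%N -> rp (psi l) (P l) = 0.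
Proof.
move=> sp; elim: N P => [|N IHN] P hP //; rewrite big_ord_recr /= => S0.
have sm l : rprods (rp (psi l) (P l)) by exact: rprods_rp (sp l) (hP l).
pose c l : C := N%:R * (N%:R + 1) - l%:R * (l%:R + 1).
have lN l : (l < N)%N -> rp (psi l) (P l) = 0.
  move=> ltN; have := IHN (fun l => c l *: P l) (fun l => harmZ (c l) (hP l)) _ l ltN.
  rewrite rpZ => H; apply/eqP; have /eqP : c l *: rp (psi l) (P l) = 0.
    apply: H; have := congr1 casimir S0; rewrite casimir0 casimirD // ?casimir_sum //; last first.
      by apply: lspan_sum => k _; exact: sm.
    rewrite (casimir_rp (sp N) (hP N)) => e.
    transitivity ((N%:R * (N%:R + 1)) *: (\sum_(k < N) rp (psi k) (P k) + rp (psi N) (P N)) +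
      (\sum_(k < N) casimir (rp (psi k) (P k)) + (- (N%:R * (N%:R + 1))) *: rp (psi N) (P N))).
      rewrite scalerDr addrACA scaleNr subrr addr0 scaler_sumr -big_split.
      by apply: eq_bigr => k _ /=; rewrite rpZ (casimir_rp (sp k) (hP k)) -scalerDl.
    by rewrite S0 e scaler0 addr0.
  by rewrite scaler_eq0 (negbTE (casimir_eigen_inj ltN)).
move=> l; rewrite ltnS leq_eqVlt => /orP[/eqP ->|]; last exact: lN.
by move: S0; rewrite big1 ?add0r // => k _; exact: lN.
Qed.

Lemma scale_neq0 x (r : R) : 0 < r -> (r / rad x) *: val x != 0.
Proof.
move=> r0; rewrite scaler_eq0 negb_or (valP x) andbT.
by rewrite mulf_neq0 ?invr_neq0 // gt_eqF // rad_gt0.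
Qed.

Definition ray x (r : R) (r0 : 0 < r) : space0 :=
  exist (fun x : 'cV[R]_3 => is_true (x != 0)) _ (scale_neq0 x r0).

Lemma rad_ray x r (r0 : 0 < r) : rad (ray x r0) = r.
Proof.
rewrite {1}/rad /=; under eq_bigr => i _ do rewrite mxE exprMn.
rewrite -mulr_sumr -rad_sqr -exprMn divfK ?gt_eqF ?rad_gt0 //.
by rewrite sqrtr_sqr gtr0_norm.
Qed.

Lemma hom_ray l P x r (r0 : 0 < r) : homogeneous l P ->
  P (ray x r0) = (r / rad x)%:C ^+ l * P x.
Proof.
move: l P; apply: (@homogeneous_ind R (fun l P => P (ray x r0) = (r / rad x)%:C ^+ l * P x)).
- by move=> c; rewrite mul1r.
- by move=> l a P Q _ _ EP EQ; rewrite !fnE EP EQ; ring.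
- by move=> l i P _ EP; rewrite !xmE EP /= mxE rmorphM exprS; ring.
Qed.

Lemma reg_eq0 l la P : homogeneous l P -> reg l la P = 0 -> P = 0.
Proof.
move=> hP e; apply: fnP => x; rewrite fnE; apply/eqP; apply: contraT => Px.
have ph0 r : 0 < r -> phi g l la r = 0.
  move=> r0; have := congr1 (fun f => f (ray x r0)) e.
  rewrite /reg rpE rad_ray fnE (hom_ray x r0 hP) => /eqP.
  rewrite mulf_eq0 mulf_eq0 expf_eq0 (negbTE Px) orbF fmorph_eq0.
  by rewrite [r / _ == 0]gt_eqF ?divr_gt0 ?rad_gt0 // andbF orbF => /eqP.
have := cpseries_pos_at0 (cent_bcoef g l la) ph0; rewrite [bcoef _ _ _ _]/(1 : C) => /eqP.
by rewrite oner_eq0.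
Qed.

Lemma phi_smooth l la : rsmooth (phi g l la).
Proof. by have [] := is_rsol_smooth (phi_rsol g l la). Qed.

Definition hfam (N : nat) (P : nat -> fn) := (forall l, harm l (P l)) /\ forall l, (N <= l)%N -> P l = 0.

Definition regsum la N (P : nat -> fn) : fn := \sum_(l < N) reg l la (P l).

Lemma regsum_widen la N M (P : nat -> fn) : hfam N P -> (N <= M)%N -> regsum la M P = regsum la N P.
Proof.
move=> [_ P0] NM; rewrite /regsum (big_ord_widen M (fun l => reg l la (P l)) NM) [RHS]big_mkcond /=.
by apply: eq_bigr => l _; case: ltnP => // /P0 ->; rewrite reg0.
Qed.

Lemma hfam_le N M (P : nat -> fn) : hfam N P -> (N <= M)%N -> hfam M P.
Proof. by move=> [hP P0] NM; split=> // l Ml; apply: P0; exact: leq_trans Ml. Qed.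

Lemma hfam_lin N a (P Q : nat -> fn) : hfam N P -> hfam N Q -> hfam N (fun l => a *: P l + Q l).
Proof.
move=> [hP P0] [hQ Q0]; split=> [l|l Nl]; first exact: harm_lin.
by rewrite P0 // Q0 // scaler0 addr0.
Qed.

Lemma regsum_lin la N a (P Q : nat -> fn) : regsum la N (fun l => a *: P l + Q l) = a *: regsum la N P + regsum la N Q.
Proof. by rewrite /regsum scaler_sumr -big_split; apply: eq_bigr => l _; rewrite reg_lin. Qed.

Lemma RegSolP la f : RegSol g la f <-> exists N (P : nat -> fn), hfam N P /\ f = regsum la N P.
Proof.
rewrite RegSolE; split=> [|[N [P [[hP _] ->]]]]; last first.
  by apply: lspan_sum => l _; apply: lspan_gen; exists l, (P l).
move: f; apply: lspan_ind.
- exists 0%N, (fun=> 0); split; last by rewrite /regsum big_ord0.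
  by split=> // l; exact: harm0.
- move=> a _ _ [N [P [hP ->]]] [M [Q [hQ ->]]].
  have [NK MK] := (leq_maxl N M, leq_maxr N M).
  have := hfam_lin a (hfam_le hP NK) (hfam_le hQ MK).
  exists (maxn N M), (fun l => a *: P l + Q l); split=> //.
  by rewrite regsum_lin (regsum_widen la hP NK) (regsum_widen la hQ MK).
- move=> _ [l [P [hP ->]]]; exists l.+1, (fun k => if k == l then P else 0); split.
    split=> [k|k lk]; first by case: eqP => [->|_] //; exact: harm0.
    by rewrite gtn_eqF.
  rewrite /regsum big_ord_recr /= eqxx big1 ?add0r // => k _.
  by rewrite ltn_eqF // reg0.
Qed.

Lemma regsum_eq0 la N (P : nat -> fn) : hfam N P -> regsum la N P = 0 -> forall l, P l = 0.
Proof.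
move=> [hP P0] e l; have [Nl|lN] := leqP N l; first exact: P0.
have := casimir_indep (fun l => phi_smooth l la) hP e lN.
by apply: reg_eq0; case: (hP l).
Qed.

Lemma regsum_inj la N M (P Q : nat -> fn) : hfam N P -> hfam M Q -> regsum la N P = regsum la M Q ->
  forall l, P l = Q l.
Proof.
move=> hP hQ e l; have [NK MK] := (leq_maxl N M, leq_maxr N M).
have hPQ := hfam_lin (-1) (hfam_le hQ MK) (hfam_le hP NK).
have e0 : regsum la (maxn N M) (fun l => -1 *: Q l + P l) = 0.
  rewrite regsum_lin (regsum_widen la hP NK) (regsum_widen la hQ MK) e.
  by rewrite scaleN1r addNr.
by have /eqP := regsum_eq0 hPQ e0 l; rewrite scaleN1r addrC subr_eq0 => /eqP.
Qed.

Lemma rungelenz_reg l la i P : harm l P -> rungelenz g i (reg l la P) =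
  (- 'i) *: (Dl g l la *: reg l.+1 la (Zproj l i P) + l%:R *: reg l.-1 la (pd i P)).
Proof.
move=> hP; have sp := phi_rsol g l la.
rewrite rungelenzE; last exact: smooth_rp_harm (phi_smooth l la) hP.
rewrite (rlz_rp i sp hP) (rp_ext _ (fun r r0 => rtheta_phi g l la r0)).
rewrite scaleNr -scalerN; congr (_ *: _).
case: l hP sp => [|l] hP sp.
  have -> : pd i P = 0 by apply: hom0_partial; case: hP.
  rewrite !reg0 rp0 !scaler0 subr0 addr0.
  by apply: fnP => x; rewrite /reg !fnE; ring.
rewrite (rp_ext _ (fun r r0 => rlower_phi g l la r0)).
apply: fnP => x; rewrite /reg !fnE; have := neq0_2l1 R l.+1 => ?.
by field.
Qed.

Lemma angmom_reg l la i P : harm l P -> angmom i (reg l la P) = reg l la (ang i P).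
Proof.
move=> [hP _]; have [D _] := phi_rsol g l la.
by rewrite angmomE (ang_rp i D (hom_diff hP)).
Qed.

Lemma RegSol_rungelenz la i f : RegSol g la f -> RegSol g la (rungelenz g i f).
Proof.
move=> /RegSolP[N [P [[hP _] ->]]].
have sm l : smooth (reg l la (P l)) by exact: smooth_rp_harm (phi_smooth l la) (hP l).
rewrite /regsum; elim: N => [|N IHN].
  by rewrite big_ord0 rungelenz0; exact: lspan0.
rewrite big_ord_recr /= -[X in X + _]scale1r rungelenz_lin //; last exact: smooth_sum.
rewrite scale1r; apply: lspanD => //; rewrite rungelenz_reg //; apply: lspanZ.
by apply: lspanD; apply: lspanZ; apply: reg_mem; [exact: harm_Zproj|exact: harm_partial_pred].
Qed.

Lemma RegSol_angmom la i f : RegSol g la f -> RegSol g la (angmom i f).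
Proof.
move=> /RegSolP[N [P [[hP _] ->]]].
have sm l : smooth (reg l la (P l)) by exact: smooth_rp_harm (phi_smooth l la) (hP l).
rewrite /regsum; elim: N => [|N IHN].
  by rewrite big_ord0 angmomE /ang !partial0 !xm0 subrr; exact: lspan0.
rewrite big_ord_recr /= -[X in X + _]scale1r angmomE ang_lin2 //; last exact: smooth_sum.
rewrite scale1r -!angmomE; apply: lspanD => //; rewrite angmom_reg //; apply: reg_mem.
exact: harm_angmom.
Qed.

End RegularModule.

(** * Singular sections and the Jantzen filtration *)

Section SingularModule.
Variables (R : realType) (g : R).
Local Notation C := R[i].
Local Notation fn := (fn R).
Local Notation space0 := (space0 R).
Implicit Types (f P Q : fn) (x : space0) (i : 'I_3) (l : nat) (la : C).

Definition cls la f : SingSol g la := sqcls (Sol g la) (RegSol g la) f.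

Lemma lspan_RegSol_Sol la f : lspan (RegSol g la) f -> lspan (Sol g la) f.
Proof. by move=> /RegSol_span; exact: RegSol_Sol. Qed.

Lemma sqmap_rungelenz la i f : lspan (Sol g la) f -> lspan (Sol g la) (rungelenz g i f) ->
  sqmap (rungelenz g i) (cls la f) = cls la (rungelenz g i f).
Proof.
move=> Sf SRf; apply: sqmap_sqcls => //; first exact: lspan_RegSol_Sol.
  move=> u v /lspan_Sol_smooth su /lspan_Sol_smooth sv.
  by rewrite addrC -scaleN1r rungelenz_lin // scaleN1r addrC.
by move=> u /RegSol_span Ru; apply: lspan_gen; exact: RegSol_rungelenz.
Qed.

Lemma sqmap_angmom la i f : lspan (Sol g la) f -> lspan (Sol g la) (angmom i f) ->
  sqmap (angmom i) (cls la f) = cls la (angmom i f).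
Proof.
move=> Sf SRf; apply: sqmap_sqcls => //; first exact: lspan_RegSol_Sol.
  move=> u v /lspan_Sol_smooth su /lspan_Sol_smooth sv.
  by rewrite addrC -scaleN1r !angmomE ang_lin2 // scaleN1r addrC.
by move=> u /RegSol_span Ru; apply: lspan_gen; exact: RegSol_angmom.
Qed.

Definition solfam l (ps : C -> R -> C) := forall la, exists ps', is_sing g l la (ps la) ps'.

Lemma solfam_Sol l ps la P : solfam l ps -> harm l P -> lspan (Sol g la) (rp (ps la) P).
Proof. by move=> /(_ la)[ps' [sp _]] hP; apply: lspan_gen; exact: Sol_rp sp hP. Qed.

Definition sg (ps : C -> R -> C) P : sections (SingSol g) := fun la => cls la (rp (ps la) P).

Lemma sg_lin l ps a P Q : solfam l ps -> harm l P -> harm l Q ->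
  sg ps (a *: P + Q) = a *: sg ps P + sg ps Q.
Proof.
move=> sps hP hQ; apply: functional_extensionality_dep => la.
by rewrite /sg rpD rpZ /cls sqcls_lin //; exact: solfam_Sol.
Qed.

Lemma sg0 ps : sg ps 0 = 0.
Proof. by apply: functional_extensionality_dep => la; rewrite /sg rp0 /cls sqcls0. Qed.

Lemma sgD l ps P Q : solfam l ps -> harm l P -> harm l Q -> sg ps (P + Q) = sg ps P + sg ps Q.
Proof. by move=> sps hP hQ; have := sg_lin 1 sps hP hQ; rewrite !scale1r. Qed.

Lemma sgZ l ps a P : solfam l ps -> harm l P -> sg ps (a *: P) = a *: sg ps P.
Proof. by move=> sps hP; have := sg_lin a sps hP (harm0 R l); rewrite sg0 !addr0. Qed.

Lemma sg_sum l ps n (F : 'I_n -> fn) : solfam l ps -> (forall a, harm l (F a)) ->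
  sg ps (\sum_a F a) = \sum_a sg ps (F a).
Proof.
move=> sps hF; elim: n F hF => [|n IHn] F hF; first by rewrite !big_ord0 sg0.
rewrite !big_ord_recl (sgD sps) //; last exact: harm_sum.
by rewrite IHn.
Qed.

Definition psec (p : {poly C}) (s : sections (SingSol g)) : sections (SingSol g) :=
  fun la => p.[la] *: s la.

Lemma psecC c s : psec c%:P s = c *: s.
Proof. by apply: functional_extensionality_dep => la; rewrite /psec hornerC. Qed.

Lemma SingSections_sg l ps (G : C -> R -> C) p P : harm l P ->
  (forall la, singular_radial g l la (G la)) ->
  (forall la r, 0 < r -> G la r = r%:C ^+ l * ps la r) -> SingSections (psec p (sg ps P)).
Proof.
move=> hP sG GE; apply: lspan_gen.
exists l, p, G, (rp (fun r => r%:C ^- l) P); split=> //.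
  by apply/sphericalP; exists P.
apply: functional_extensionality_dep => la; rewrite /psec /sg /cls.
by rewrite (radial_spherical P (GE la)).
Qed.

Record sdata := SData {
  sd_l : nat; sd_p : {poly C}; sd_G : C -> R -> C; sd_ps : C -> R -> C; sd_P : fn;
  sd_sing : forall la, singular_radial g sd_l la (sd_G la);
  sd_fam : solfam sd_l sd_ps;
  sd_eq : forall la r, 0 < r -> sd_G la r = r%:C ^+ sd_l * sd_ps la r;
  sd_harm : harm sd_l sd_P }.

Definition sdsec (d : sdata) := psec (sd_p d) (sg (sd_ps d) (sd_P d)).

Lemma singular_fam l (G : C -> R -> C) : (forall la, singular_radial g l la (G la)) ->
  exists ps, solfam l ps /\ forall la r, 0 < r -> G la r = r%:C ^+ l * ps la r.
Proof.
move=> sG; have H la : exists ps : R -> C, (exists ps', is_sing g l la ps ps') /\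
    forall r, 0 < r -> G la r = r%:C ^+ l * ps r.
  by have [ps [ps' [h1 h2]]] := singular_is_sing (sG la); exists ps; split=> //; exists ps'.
have [ps hps] := choice H.
by exists ps; split=> la; have [] := hps la.
Qed.

Lemma SingSections_gen s : SingSections s -> exists n (c : 'I_n -> C) (d : 'I_n -> sdata),
  s = \sum_j c j *: sdsec (d j).
Proof.
move=> [n [c [w [Sw ->]]]]; exists n, c.
have H j : exists d : sdata, w j = sdsec d.
  have [l [p [G [Y [sG /sphericalP[P hP ->] wE]]]]] := Sw j.
  have [ps [sps GE]] := singular_fam sG.
  exists (SData p sG sps GE hP); rewrite wE /sdsec /=.
  apply: functional_extensionality_dep => la; rewrite /psec /sg /cls.
  by rewrite (radial_spherical P (GE la)).
have [d hd] := choice H.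
by exists d; apply: eq_bigr => j _; rewrite hd.
Qed.

Lemma sdsec_mem d : SingSections (sdsec d).
Proof. by apply: SingSections_sg (sd_harm d) (@sd_sing d) _; exact: sd_eq. Qed.

Lemma secmap_angmom l ps p P i : solfam l ps -> harm l P ->
  secmap (angmom i) (psec p (sg ps P)) = psec p (sg ps (ang i P)).
Proof.
move=> sps hP; apply: functional_extensionality_dep => la; rewrite /secmap /psec /sg.
have SP := solfam_Sol la sps hP; have [ps' [[D _] _]] := sps la.
have sm := lspan_Sol_smooth SP; have dP : fdiff P by case: hP => /hom_diff.
have E : angmom i (p.[la] *: rp (ps la) P) = p.[la] *: rp (ps la) (ang i P).
  rewrite -[_ *: _ in LHS]addr0 angmomE ang_lin2 //; last exact: smooth0.
  by rewrite (ang_rp i D dP) /ang !partial0 !xm0 subrr addr0.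
have hA := solfam_Sol la sps (harm_angmom i hP).
rewrite /cls -!sqclsZ // -/(cls _ _) sqmap_angmom ?E //; exact: lspanZ.
Qed.

Definition singpol l : {poly C} :=
  ((2 * l%:R + 3) / (2 * l%:R + 1) / ((2 * l%:R + 3) * (l%:R + 1))) *: ((l%:R + 1) ^+ 2 *: 'X + (g%:C ^+ 2)%:P).

Lemma singpolE l la : (singpol l).[la] = Dl g l la * (2 * l%:R + 3) / (2 * l%:R + 1).
Proof.
rewrite /singpol !(hornerZ, hornerD, hornerC, hornerX) /Dl.
by have := neq0_l1 R l; have := neq0_2l3 R l; have := neq0_2l1 R l => ? ? ?; field; apply/and3P.
Qed.

Lemma RegSol_reg_class la f h : lspan (Sol g la) f -> lspan (Sol g la) h ->
  RegSol g la (f - h) -> cls la f = cls la h.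
Proof. by move=> Sf Sh Rfh; apply/sqcls_eq => //; exact: lspan_gen. Qed.

Section Family.
Variable ps : nat -> C -> R -> C.
Hypothesis sps : forall l, solfam l (ps l).
Local Notation sing l P := (sg (ps l) P).

Lemma cls_rtheta l la P ps' : harm l.+1 P -> is_sing g l la (ps l la) ps' ->
  cls la (rp (rtheta g l (ps l la) ps') P) =
  - ((l%:R + 1) * (2 * l%:R + 1)) *: cls la (rp (ps l.+1 la) P).
Proof.
move=> hP sp; have [qs sq] := @sps l.+1 la; have [a E] := is_sing_rtheta sp sq.
have Sq := solfam_Sol la (@sps l.+1) hP.
rewrite -sqclsZ //; apply: RegSol_reg_class.
- by apply: lspan_gen; apply: Sol_rp hP; apply: rtheta_rsol; case: sp.
- exact: lspanZ.
rewrite (rp_ext _ E) (_ : _ - _ = reg g l.+1 la (a *: P)); first exact/reg_mem/harmZ.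
by apply: fnP => x; rewrite /reg !fnE; ring.
Qed.

Lemma cls_rlower l la P ps' : harm l P -> is_sing g l.+1 la (ps l.+1 la) ps' ->
  cls la (rp (rlower g l.+1 (ps l.+1 la) ps') P) = (singpol l).[la] *: cls la (rp (ps l la) P).
Proof.
move=> hP sp; have [qs sq] := @sps l la; have [a E] := is_sing_rlower sp sq.
have Sq := solfam_Sol la (@sps l) hP.
rewrite -sqclsZ // singpolE; apply: RegSol_reg_class.
- by apply: lspan_gen; apply: Sol_rp hP; apply: rlower_rsol; case: sp.
- exact: lspanZ.
rewrite (rp_ext _ E) (_ : _ - _ = reg g l la (a *: P)); first exact/reg_mem/harmZ.
by apply: fnP => x; rewrite /reg !fnE; ring.
Qed.

Definition lowpol l : {poly C} := if l is l'.+1 then (- 'i / (2 * l%:R + 1)) *: singpol l' else 0.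
Definition upcst l : C := - 'i * ((l%:R + 1) * (2 * l%:R + 1)).

Lemma secmap_rungelenz l P i : harm l P ->
  secmap (rungelenz g i) (sing l P) =
  upcst l *: sing l.+1 (Zproj l i P) + psec (lowpol l) (sing l.-1 (pd i P)).
Proof.
move=> hP; apply: functional_extensionality_dep => la; rewrite /secmap /sg.
have [ps' sp] := @sps l la; have [sr _] := sp.
have SP := solfam_Sol la (@sps l) hP; have hZ := harm_Zproj i hP.
have st := rtheta_rsol sr.
have Slow : lspan (Sol g la) (rp (rlower g l (ps l la) ps') (pd i P)).
  case: l hP sp sr SP hZ st => [|l] hP sp sr SP hZ st.
    rewrite (_ : pd i P = 0) ?rp0; first exact: lspan0.
    by apply: hom0_partial; case: hP.
  by apply: lspan_gen; apply: Sol_rp (rlower_rsol sr) _; exact: harm_partial.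
have Sth : lspan (Sol g la) (rp (rtheta g l (ps l la) ps') (Zproj l i P)).
  by apply: lspan_gen; exact: Sol_rp st hZ.
have E : rungelenz g i (rp (ps l la) P) = 'i *: (- (2 * l%:R + 1)^-1 *: rp (rlower g l (ps l la) ps') (pd i P)
    + rp (rtheta g l (ps l la) ps') (Zproj l i P)).
  rewrite rungelenzE; last exact: lspan_Sol_smooth SP.
  by rewrite (rlz_rp i sr hP) addrC scaleNr.
rewrite sqmap_rungelenz ?E //; last by apply: lspanZ; exact: lspan_linear.
rewrite /cls sqclsZ; last exact: lspan_linear.
rewrite sqcls_lin // -!/(cls _ _) (cls_rtheta hZ sp) scalerDr addrC !scalerA /psec /upcst.
congr (_ + _); first by rewrite mulrN mulNr.
case: l hP sp sr SP hZ st Slow {Sth E} => [|l] hP sp sr SP hZ st Slow.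
  by rewrite (_ : pd i P = 0) ?rp0 /cls ?sqcls0 ?scaler0 //; apply: hom0_partial; case: hP.
rewrite (cls_rlower (harm_partial i hP) sp) scalerA.
by congr (_ *: _); rewrite [RHS]hornerZ; ring.
Qed.

End Family.

End SingularModule.

Section Intertwiner.
Variables (R : realType) (g : R).
Local Notation C := R[i].
Local Notation fn := (fn R).
Local Notation space0 := (space0 R).
Implicit Types (f P Q : fn) (x : space0) (i : 'I_3) (l : nat) (la : C).

Definition cst1 : fn := fun=> 1.

Lemma harm_cst1 : harm 0 cst1. Proof. exact: harm_cst. Qed.

Lemma group_regs n (l : 'I_n -> nat) (Q : 'I_n -> C -> fn) : (forall j la, harm (l j) (Q j la)) ->
  exists N, forall la, hfam N (fun k => \sum_(j | l j == k) Q j la) /\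
    \sum_j reg g (l j) la (Q j la) = regsum g la N (fun k => \sum_(j | l j == k) Q j la).
Proof.
move=> hQ; exists (\max_j l j).+1 => la; split.
  split=> [k|k Nk]; first by apply: harm_sum => j /eqP <-.
  by rewrite big1 // => j /eqP lj; move: Nk; rewrite -lj ltnNge leq_bigmax.
rewrite /regsum; transitivity (\sum_(k < (\max_j l j).+1) \sum_(j | l j == k) reg g (l j) la (Q j la)).
  rewrite (exchange_big_dep xpredT) //=; apply: eq_bigr => j _.
  have ljN : (l j < (\max_j l j).+1)%N by rewrite ltnS leq_bigmax.
  rewrite (bigD1 (Ordinal ljN)) ?eqxx //= big1 ?addr0 // => k /andP[/eqP lk].
  by rewrite -val_eqE /= -lk eqxx.
apply: eq_bigr => k _; rewrite [RHS]/reg.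
have rps (I : Type) (r : seq I) (p : pred I) psi (F : I -> fn) :
    rp psi (\sum_(a <- r | p a) F a) = \sum_(a <- r | p a) rp psi (F a).
  by apply: fnP => x; rewrite !fnE mulr_sumr; apply: eq_bigr => a _; rewrite fnE.
by rewrite rps; apply: eq_bigr => j /eqP ->.
Qed.

Lemma RegSections_mem l p P : harm l P -> RegSections g (fun la => p.[la] *: reg g l la P).
Proof.
move=> hP; apply: lspan_gen.
exists l, p, (fun la r => r%:C ^+ l * phi g l la r), (rp (fun r => r%:C ^- l) P); split.
- by move=> la; exact/regular_radialP.
- by apply/sphericalP; exists P.
- apply: funext => la; apply: fnP => x; rewrite fnZ; congr (_ * _).
  have := @radial_spherical R (fun r => r%:C ^+ l * phi g l la r) (phi g l la) l P (fun r _ => erefl).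
  by move=> /(congr1 (fun f => f x)) /= ->.
Qed.

Lemma RegSections_gen h : RegSections g h -> exists n (l : 'I_n -> nat) (p : 'I_n -> {poly C}) (P : 'I_n -> fn),
  (forall j, harm (l j) (P j)) /\ h = fun la => \sum_j reg g (l j) la ((p j).[la] *: P j).
Proof.
move=> [n [c [w [Sw ->]]]].
have H j : exists d : nat * {poly C} * fn, harm d.1.1 d.2 /\
    w j = fun la => d.1.2.[la] *: reg g d.1.1 la d.2.
  have [l [p [F [Y [sF /sphericalP[P hP ->] wE]]]]] := Sw j.
  exists (l, p, P); split=> //; rewrite wE; apply: funext => la; apply: fnP => x /=.
  rewrite fnZ; congr (_ * _); have /regular_radialP -> := sF la.
  have := @radial_spherical R (fun r => r%:C ^+ l * phi g l la r) (phi g l la) l P (fun r _ => erefl).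
  by move=> /(congr1 (fun f => f x)) /= ->.
have [d hd] := choice H.
exists n, (fun j => (d j).1.1), (fun j => c j *: (d j).1.2), (fun j => (d j).2).
split=> [j|]; first by have [] := hd j.
apply: funext => la.
have ev (I : Type) (r : seq I) (F : I -> C -> fn) : (\sum_(a <- r) F a) la = \sum_(a <- r) F a la.
  by elim/big_rec2: _ => // a u v _ <-.
rewrite ev; apply: eq_bigr => j _; have [_ ->] := hd j.
by rewrite hornerZ regZ -scalerA.
Qed.

Lemma RegSections_at h la : RegSections g h -> RegSol g la (h la).
Proof.
move=> /RegSections_gen[n [l [p [P [hP ->]]]]].
rewrite RegSolE; apply: lspan_sum => j _; apply: lspan_gen.
by exists (l j), ((p j).[la] *: P j); split=> //; exact: harmZ.
Qed.

Variables (A : sections (SingSol g) -> C -> fn) (A_intw : intertwiner A).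

Lemma SingSections0 : SingSections (0 : sections (SingSol g)). Proof. exact: lspan0. Qed.

Lemma intw0 la : A 0 la = 0.
Proof.
have := intw_add A_intw SingSections0 SingSections0; rewrite addr0 => /(congr1 (fun h => h la)) /eqP.
by rewrite -[X in X == _]addr0 (inj_eq (addrI _)) eq_sym => /eqP.
Qed.

Lemma intwZ c s la : SingSections s -> A (c *: s) la = c *: A s la.
Proof.
move=> Ss; rewrite -psecC; have := intw_scale A_intw c%:P Ss.
by move=> /(congr1 (fun h => h la)) ->; rewrite hornerC.
Qed.

Lemma intw_psec p s la : SingSections s -> A (psec p s) la = p.[la] *: A s la.
Proof. by move=> Ss; have := intw_scale A_intw p Ss => /(congr1 (fun h => h la)). Qed.

Lemma intw_sum n (F : 'I_n -> sections (SingSol g)) la : (forall j, SingSections (F j)) ->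
  A (\sum_j F j) la = \sum_j A (F j) la.
Proof.
elim: n F => [|n IHn] F SF; first by rewrite !big_ord0 intw0.
rewrite !big_ord_recl; have := intw_add A_intw (SF ord0) _.
move=> /(_ _ _)/(congr1 (fun h => h la)) ->; last by apply: lspan_sum => j _; exact: SF.
by rewrite -[LHS]/(A (F ord0) la + A (\sum_i F (lift ord0 i)) la) IHn.
Qed.

(* [A] commutes with the Casimir operator of the rotations. *)
Lemma intw_isotypic d la : exists2 P, harm (sd_l d) P & A (sdsec d) la = reg g (sd_l d) la P.
Proof.
set l := sd_l d; have fam := @sd_fam _ _ d; have hP := sd_harm d.
have Ssec Q : harm l Q -> SingSections (psec (sd_p d) (sg g (sd_ps d) Q)).
  by move=> hQ; apply: SingSections_sg hQ (@sd_sing _ _ d) _; exact: sd_eq.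
pose t i := secmap (angmom i) (secmap (angmom i) (sdsec d)).
have tE i : t i = psec (sd_p d) (sg g (sd_ps d) (ang i (ang i (sd_P d)))).
  rewrite /t /sdsec (secmap_angmom _ _ fam) // (secmap_angmom _ _ fam) //.
  exact: harm_angmom.
have St i : SingSections (t i) by rewrite tE; apply: Ssec; do 2!apply: harm_angmom.
have At i : A (t i) la = ang i (ang i (A (sdsec d) la)).
  rewrite /t (intw_angmom A_intw) -?angmomE; last first.
    by rewrite /sdsec (secmap_angmom _ _ fam) //; apply: Ssec; exact: harm_angmom.
  rewrite (intw_angmom A_intw) ?angmomE //; exact: sdsec_mem.
have sumt : \sum_i t i = (- (l%:R * (l%:R + 1))) *: sdsec d.
  apply: functional_extensionality_dep => mu.
  have ev (F : 'I_3 -> sections (SingSol g)) : (\sum_i F i) mu = \sum_i F i mu.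
    by elim/big_rec2: _ => // a u v _ <-.
  rewrite ev; under eq_bigr => i _ do rewrite tE.
  rewrite /psec -scaler_sumr.
  have -> : \sum_i sg g (sd_ps d) (ang i (ang i (sd_P d))) mu =
      (sg g (sd_ps d) (\sum_i ang i (ang i (sd_P d)))) mu.
    rewrite (sg_sum fam) ?ev // => i; do 2!apply: harm_angmom; exact: hP.
  rewrite (angmom_casimir hP) (sgZ _ fam hP).
  by rewrite -[RHS]/(_ *: ((sd_p d).[mu] *: sg g (sd_ps d) (sd_P d) mu)) !scalerA mulrC.
have E : casimir (A (sdsec d) la) = (- (l%:R * (l%:R + 1))) *: A (sdsec d) la.
  rewrite -(intwZ _ _ (sdsec_mem d)) -sumt intw_sum //; apply: eq_bigr => i _.
  by rewrite At.
have /RegSolP[N [Q [hQ AE]]] := RegSections_at la (intw_map A_intw (sdsec_mem d)).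
have [hQh Q0] := hQ.
pose c k : C := l%:R * (l%:R + 1) - k%:R * (k%:R + 1).
have hc : hfam N (fun k => c k *: Q k).
  by split=> [k|k Nk]; [exact: harmZ|rewrite Q0 // scaler0].
have c0 : regsum g la N (fun k => c k *: Q k) = 0.
  have : casimir (A (sdsec d) la) + (l%:R * (l%:R + 1)) *: A (sdsec d) la = 0.
    by rewrite E scaleNr addNr.
  rewrite AE /regsum casimir_sum => [e|k]; last exact: rprods_rp (phi_smooth g _ la) (hQh k).
  apply: (etrans _ e); rewrite scaler_sumr -big_split; apply: eq_bigr => k _ /=.
  by rewrite (casimir_rp (phi_smooth g _ la) (hQh k)) regZ /c -scalerDl addrC.
have Qk k : k != l -> Q k = 0.
  move=> kl; have /eqP := regsum_eq0 hc c0 k; rewrite scaler_eq0 => /orP[/eqP ck|/eqP //].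
  exfalso; move: kl; rewrite neq_ltn => /orP[kl|lk].
    by have /eqP := @casimir_eigen_inj R k l kl; apply.
  have /eqP := @casimir_eigen_inj R l k lk; apply.
  by apply/eqP; rewrite -oppr_eq0 opprB; apply/eqP.
exists (Q l) => //; rewrite AE.
have hl : hfam N (fun k => if k == l then Q l else 0).
  split=> [k|k Nk]; first by case: eqP => [->|_] //; exact: harm0.
  by case: eqP => // kl; rewrite -kl Q0.
have -> : Q = fun k => if k == l then Q l else 0.
  by apply: funext => k; case: eqP => [->|/eqP/Qk].
rewrite eqxx -(regsum_widen g la hl (leq_maxl N l.+1)) /regsum.
have lM : (l < maxn N l.+1)%N by rewrite leq_max ltnSn orbT.
rewrite (bigD1 (Ordinal lM)) //= eqxx big1 ?addr0 // => k kl.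
by rewrite -[k == l :> nat]/(k == Ordinal lM) (negbTE kl) reg0.
Qed.

Lemma cst1_neq0 : cst1 != 0.
Proof. by apply/eqP => /(congr1 (fun f => f (pt0 R)))/eqP; rewrite fnE oner_eq0. Qed.

Lemma fixed_section : exists2 s, SingSections s & forall la, A s la = reg g 0 la cst1.
Proof.
have [_ _ surj] := intw_fixed A_intw.
have [|s [Ss _] As] := surj (fun la => reg g 0 la cst1); last first.
  by exists s => // la; rewrite As.
split=> [|k kO].
  have := RegSections_mem 1 harm_cst1; congr RegSections; apply: funext => la.
  by rewrite hornerC scale1r.
apply: funext => la; have [m mm ->] := fn_act_rot kO.
by rewrite /reg (rot_rp mm).
Qed.

Lemma exists_singular0 : exists G : C -> R -> C, forall la, singular_radial g 0 la (G la).
Proof.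
have [s /SingSections_gen[n [c [d ->]]] As] := fixed_section.
apply: contrapT => noG.
have dl j : sd_l (d j) != 0%N.
  apply/eqP => l0; apply: noG; exists (sd_G (d j)) => la.
  by rewrite -l0; exact: (sd_sing (d j)).
have H j : exists P, harm (sd_l (d j)) P /\ A (sdsec (d j)) 0 = reg g (sd_l (d j)) 0 P.
  by have [P hP e] := intw_isotypic (d j) 0; exists P.
have [P hP] := choice H.
have hcP j (la : C) : harm (sd_l (d j)) (c j *: P j) by apply: harmZ; have [] := hP j.
have [N /(_ 0)[hN e]] := group_regs hcP.
have := As 0; rewrite intw_sum => [|j]; last exact/lspanZ/sdsec_mem.
under eq_bigr => j _ do rewrite (intwZ _ _ (sdsec_mem _)).
under eq_bigr => j _ do rewrite (hP j).2 -regZ.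
rewrite e => e2.
have h1 : hfam 1 (fun k => if k == 0%N then cst1 else 0).
  split=> [[|k]|[]] //; first exact: harm_cst1.
  exact: harm0.
have e3 : regsum g 0 1 (fun k => if k == 0%N then cst1 else 0) = reg g 0 0 cst1.
  by rewrite /regsum big_ord1.
have := regsum_inj hN h1 (etrans e2 (esym e3)) 0%N; rewrite /=.
rewrite big1 => [|j /eqP]; last by move/eqP; rewrite (negbTE (dl j)).
by move=> /esym/eqP; rewrite (negbTE cst1_neq0).
Qed.

Lemma exists_singular l : exists G : C -> R -> C, forall la, singular_radial g l la (G la).
Proof.
elim: l => [|l [G sG]]; first exact: exists_singular0.
have H la := singular_raise (sG la).
by have [G' hG'] := choice H; exists G'.
Qed.

Lemma exists_family : exists (G ps : nat -> C -> R -> C), forall l,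
  [/\ forall la, singular_radial g l la (G l la), solfam g l (ps l) &
      forall la r, 0 < r -> G l la r = r%:C ^+ l * ps l la r].
Proof.
have H l : exists d : (C -> R -> C) * (C -> R -> C),
    [/\ forall la, singular_radial g l la (d.1 la), solfam g l d.2 &
      forall la r, 0 < r -> d.1 la r = r%:C ^+ l * d.2 la r].
  have [G sG] := exists_singular l; have [ps [sps GE]] := singular_fam sG.
  by exists (G, ps).
have [d hd] := choice H.
by exists (fun l => (d l).1), (fun l => (d l).2).
Qed.

End Intertwiner.

Section JantzenFiltration.
Variables (R : realType) (g : R).
Local Notation C := R[i].
Local Notation fn := (fn R).
Local Notation space0 := (space0 R).
Implicit Types (f P Q : fn) (x : space0) (i : 'I_3) (l : nat) (la : C).

Lemma sg_uniq l ps ps' P : solfam g l ps -> solfam g l ps' -> harm l P -> sg g ps P = sg g ps' P.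
Proof.
move=> sps sps' hP; apply: functional_extensionality_dep => la; rewrite /sg.
have [q sq] := sps la; have [q' sq'] := sps' la.
have [a E] := is_sing_uniq sq sq'.
apply: RegSol_reg_class; [exact: solfam_Sol sps hP|exact: solfam_Sol sps' hP|].
rewrite (rp_ext _ E) (_ : _ - _ = reg g l la (a *: P)); first exact/reg_mem/harmZ.
by apply: fnP => x; rewrite /reg !fnE; ring.
Qed.

Lemma harm0_cst P : harm 0 P -> P = P (pt0 R) *: @cst1 R.
Proof. by move=> [hP _]; apply: fnP => x; rewrite fnZ mulr1; exact: hom0_const. Qed.

Definition dpol l : {poly C} :=
  ((2 * l%:R + 3) * (l%:R + 1) * ((l%:R + 1) * (2 * l%:R + 1)))^-1 *: ((l%:R + 1) ^+ 2 *: 'X + (g%:C ^+ 2)%:P).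

Lemma dpolE l la : (dpol l).[la] = Dl g l la / ((l%:R + 1) * (2 * l%:R + 1)).
Proof.
rewrite /dpol !(hornerZ, hornerD, hornerC, hornerX) /Dl.
by have := neq0_l1 R l; have := neq0_2l3 R l; have := neq0_2l1 R l => ? ? ?; field; apply/and3P.
Qed.

Lemma dpol_neq0 l la : ((dpol l).[la] != 0) = (Dl g l la != 0).
Proof.
have h : (l%:R + 1) * (2 * l%:R + 1) != 0 :> C by rewrite mulf_neq0 ?neq0_l1 ?neq0_2l1.
by rewrite dpolE mulf_eq0 invr_eq0 (negbTE h) orbF.
Qed.

Variables (A : sections (SingSol g) -> C -> fn) (A_intw : intertwiner A).
Variables (G ps : nat -> C -> R -> C).
Hypothesis Gps : forall l, [/\ forall la, singular_radial g l la (G l la), solfam g l (ps l) &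
  forall la r, 0 < r -> G l la r = r%:C ^+ l * ps l la r].

Let sps l : solfam g l (ps l). Proof. by have [] := Gps l. Qed.

Lemma sing_mem l p P : harm l P -> SingSections (psec p (sg g (ps l) P)).
Proof. by have [sG _ GE] := Gps l; move=> hP; exact: SingSections_sg hP sG GE. Qed.

Lemma psec1 s : psec 1 s = s :> sections (SingSol g).
Proof. by apply: functional_extensionality_dep => la; rewrite /psec hornerC scale1r. Qed.

Lemma sing_mem1 l P : harm l P -> SingSections (sg g (ps l) P).
Proof. by move=> hP; have := sing_mem 1 hP; rewrite psec1. Qed.

Lemma intw_ground : exists q : {poly C}, forall la, A (sg g (ps 0%N) (@cst1 R)) la = q.[la] *: reg g 0 la (@cst1 R).
Proof.
have [sG _ GE] := Gps 0.
have Am := intw_map A_intw (sing_mem1 (harm_cst1 R)).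
have [n [l [p [P [hP AE]]]]] := RegSections_gen Am.
exists (\sum_(j | l j == 0%N) P j (pt0 R) *: p j) => la.
pose d := SData 1 sG (@sps 0) GE (harm_cst1 R).
have [Q hQ] := intw_isotypic A_intw d la; rewrite /sdsec /= psec1 => AQ.
have hcP j (mu : C) : harm (l j) ((p j).[mu] *: P j) by exact: harmZ.
have [N /(_ la)[hN e]] := group_regs g hcP.
have h1 : hfam 1 (fun k => if k == 0%N then Q else 0).
  split=> [[|k]|[]] //; exact: harm0.
have e1 : regsum g la 1 (fun k => if k == 0%N then Q else 0) = A (sg g (ps 0%N) (@cst1 R)) la.
  by rewrite /regsum big_ord1 AQ.
rewrite AE e in e1; have := regsum_inj h1 hN e1 0%N; rewrite /= => QE.
rewrite AQ /= QE -regZ horner_sum scaler_suml; congr (reg _ _ _ _).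
apply: eq_bigr => j /eqP lj; rewrite hornerZ.
have hPj : harm 0 (P j) by rewrite -lj.
by rewrite {1}(harm0_cst hPj) scalerA mulrC.
Qed.

Variable q : {poly C}.
Hypothesis qE : forall la, A (sg g (ps 0%N) (@cst1 R)) la = q.[la] *: reg g 0 la (@cst1 R).

Fixpoint intw_coef l : {poly C} := if l is l'.+1 then intw_coef l' * dpol l' else q.

Lemma intw_sing l P la : harm l P -> A (sg g (ps l) P) la = (intw_coef l).[la] *: reg g l la P.
Proof.
elim: l P => [|l IHl] P hP.
  rewrite (harm0_cst hP) (sgZ _ (@sps 0) (harm_cst1 R)) regZ.
  by rewrite (intwZ A_intw) ?qE ?scalerA 1?mulrC //; apply: sing_mem1; exact: harm_cst1.
pose t i := secmap (rungelenz g i) (sg g (ps l) (pd i P)).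
have hp i := harm_partial i hP.
have tE i : t i = upcst R l *: sg g (ps l.+1) (Zproj l i (pd i P))
    + psec (lowpol g l) (sg g (ps l.-1) (pd i (pd i P))).
  exact: secmap_rungelenz.
have St i : SingSections (t i).
  rewrite tE; apply: lspanD; first exact/lspanZ/sing_mem1/harm_Zproj.
  by apply: sing_mem; exact: harm_partial_pred.
have At i : A (t i) la = rungelenz g i (A (sg g (ps l) (pd i P)) la).
  by rewrite (intw_rungelenz A_intw) //; exact: sing_mem1.
have sumt : \sum_i t i = (upcst R l * l.+1%:R) *: sg g (ps l.+1) P.
  rewrite (eq_bigr _ (fun i _ => tE i)) big_split /= -scaler_sumr.
  rewrite -(sg_sum (@sps l.+1)) => [|i]; last exact: harm_Zproj.
  rewrite (sum_Zproj_partial _ hP) (sgZ _ (@sps l.+1) hP) scalerA.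
  rewrite [X in _ + X](_ : _ = 0) ?addr0 //.
  transitivity (psec (lowpol g l) (sg g (ps l.-1) (\sum_i pd i (pd i P)))).
    rewrite (sg_sum (@sps l.-1)) => [|i]; last exact: harm_partial_pred.
    apply: functional_extensionality_dep => mu; rewrite /psec.
    have ev (F : 'I_3 -> sections (SingSol g)) : (\sum_i F i) mu = \sum_i F i mu.
      by elim/big_rec2: _ => // a u v _ <-.
    by rewrite !ev scaler_sumr.
  have [_] := hP; rewrite /lap => ->; rewrite sg0.
  by apply: functional_extensionality_dep => mu; rewrite /psec scaler0.
have u0 : upcst R l * l.+1%:R != 0.
  by rewrite /upcst !mulf_neq0 ?oppr_eq0 ?pnatr_eq0 ?neq0_l1 ?neq0_2l1 ?neq0Ci.
have E : (upcst R l * l.+1%:R) *: A (sg g (ps l.+1) P) la =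
    ((intw_coef l).[la] * (- 'i * (Dl g l la * l.+1%:R))) *: reg g l.+1 la P.
  rewrite -(intwZ A_intw) -?sumt ?(intw_sum A_intw) //; last exact: sing_mem1.
  transitivity (\sum_i (intw_coef l).[la] *: ((- 'i) *: (Dl g l la *: reg g l.+1 la (Zproj l i (pd i P))
      + l%:R *: reg g l.-1 la (pd i (pd i P))))).
    apply: eq_bigr => i _; rewrite At IHl // -(rungelenz_reg g la i (hp i)).
    have sm : smooth (reg g l la (pd i P)) by exact: smooth_rp_harm (phi_smooth g _ la) (hp i).
    exact: rungelenzZ.
  rewrite -!scaler_sumr big_split /= -!scaler_sumr -!reg_sum (sum_Zproj_partial _ hP).
  by have [_] := hP; rewrite /lap => ->; rewrite reg0 scaler0 addr0 regZ !scalerA !mulrA.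
apply: (scalerI u0); rewrite E scalerA; congr (_ *: _).
rewrite /= hornerM dpolE /upcst -natr1.
by have := neq0_l1 R l; have := neq0_2l1 R l => ? ?; field; apply/andP.
Qed.

Lemma intw_gen s : SingSections s -> exists n (l : 'I_n -> nat) (p : 'I_n -> {poly C}) (P : 'I_n -> fn),
  (forall j, harm (l j) (P j)) /\ forall la, A s la = \sum_j reg g (l j) la ((p j * intw_coef (l j)).[la] *: P j).
Proof.
move=> /SingSections_gen[n [c [d ->]]].
exists n, (fun j => sd_l (d j)), (fun j => c j *: sd_p (d j)), (fun j => sd_P (d j)).
split=> [j|la]; first exact: sd_harm.
rewrite (intw_sum A_intw) => [|j]; last exact/lspanZ/sdsec_mem.
apply: eq_bigr => j _; rewrite (intwZ A_intw); last exact: sdsec_mem.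
rewrite /sdsec (sg_uniq (@sd_fam _ _ (d j)) (@sps _) (sd_harm (d j))).
rewrite (intw_psec A_intw); last exact/sing_mem1/sd_harm.
by rewrite (intw_sing la (sd_harm (d j))) regZ !scalerA hornerM hornerZ.
Qed.

Lemma q_neq0 la : q.[la] != 0.
Proof.
have [s Ss As] := fixed_section A_intw; have [n [l [p [P [hP AE]]]]] := intw_gen Ss.
have hcP j (mu : C) : harm (l j) ((p j * intw_coef (l j)).[mu] *: P j) by exact: harmZ.
have [N /(_ la)[hN e]] := group_regs g hcP.
have h1 : hfam 1 (fun k => if k == 0%N then @cst1 R else 0).
  split=> [[|k]|[]] //; first exact: harm_cst1.
  exact: harm0.
have e1 : regsum g la 1 (fun k => if k == 0%N then @cst1 R else 0) = A s la.
  by rewrite /regsum big_ord1 As.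
rewrite AE e in e1; have := regsum_inj h1 hN e1 0%N; rewrite /= => c1E.
apply/eqP => q0; have := cst1_neq0 R; rewrite c1E big1 ?eqxx // => j /eqP lj.
by rewrite lj hornerM /= q0 mulr0 scale0r.
Qed.

Lemma intw_coef_neq0 l la : ((intw_coef l).[la] != 0) <-> forall j, (j < l)%N -> Dl g j la != 0.
Proof.
elim: l => [|l IHl]; first by split=> // _; exact: q_neq0.
rewrite /= hornerM mulf_eq0 negb_or dpol_neq0; split.
  by move=> /andP[/IHl H Dn] j; rewrite ltnS leq_eqVlt => /orP[/eqP ->|/H].
move=> H; apply/andP; split; last exact: H.
by apply/IHl => j jl; apply: H; exact: ltnW.
Qed.

Hypothesis g_neq0 : g != 0.

Lemma Dl_eq0 l la : (Dl g l la == 0) = (la * (l%:R + 1) ^+ 2 + g%:C ^+ 2 == 0).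
Proof.
by rewrite /Dl mulf_eq0 invr_eq0 mulf_eq0 (negbTE (neq0_2l3 R l)) (negbTE (neq0_l1 R l)) !orbF.
Qed.

Lemma Dl_eq0_inj j l la : Dl g j la = 0 -> Dl g l la = 0 -> j = l.
Proof.
move=> /eqP; rewrite Dl_eq0 addr_eq0 => /eqP ej /eqP; rewrite Dl_eq0 addr_eq0 => /eqP el.
have la0 : la != 0.
  apply/eqP => la0; move: ej; rewrite la0 mul0r => /esym/eqP.
  by rewrite oppr_eq0 expf_eq0 fmorph_eq0 (negbTE g_neq0) andbF.
have /(mulfI la0) e : la * (j%:R + 1) ^+ 2 = la * (l%:R + 1) ^+ 2 by rewrite ej el.
move: e; rewrite !natr1 -!natrX => /eqP; rewrite eqr_nat eqn_sqr => /eqP[].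
by [].
Qed.

Lemma intw_coef_simple_root l la : (intw_coef l).[la] = 0 ->
  exists b, intw_coef l = b * ('X - la%:P) /\ b.[la] != 0.
Proof.
elim: l => [|l IHl]; first by move/eqP; rewrite (negbTE (q_neq0 la)).
rewrite /= hornerM => /eqP; rewrite mulf_eq0.
have [/eqP d0|dn0] := boolP ((dpol l).[la] == 0); last first.
  rewrite orbF => /eqP /IHl[b [aE bn0]].
  by exists (b * dpol l); rewrite aE mulrAC hornerM mulf_neq0.
move=> _; have D0 : Dl g l la = 0 by apply/eqP; have := dpol_neq0 l la; rewrite d0 eqxx => /esym/negbFE.
pose k : C := ((2 * l%:R + 3) * (l%:R + 1) * ((l%:R + 1) * (2 * l%:R + 1)))^-1 * (l%:R + 1) ^+ 2.
have k0 : k != 0 by rewrite mulf_neq0 ?invr_neq0 ?expf_neq0 ?mulf_neq0 ?neq0_l1 ?neq0_2l1 ?neq0_2l3.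
exists (k *: intw_coef l); split; last first.
  rewrite hornerZ mulf_neq0 //; apply/intw_coef_neq0 => j jl; apply/eqP => Dj.
  by move: jl; rewrite (Dl_eq0_inj Dj D0) ltnn.
have gE : g%:C ^+ 2 = - (la * (l%:R + 1) ^+ 2).
  by move/eqP: D0; rewrite Dl_eq0 addrC addr_eq0 => /eqP.
rewrite -scalerAl scalerAr; congr (_ * _); rewrite /dpol gE /k -[in RHS]scalerA; congr (_ *: _).
by rewrite scalerBr polyCN -mul_polyC -[_ *: _%:P]mul_polyC -polyCM [_ * la]mulrC.
Qed.

(* The solutions obtained from those of degree 0 by raising. *)
Definition J0 la : set fn := lspan [set f | exists l P,
  [/\ harm l P, forall j, (j < l)%N -> Dl g j la != 0 & f = reg g l la P]].

Lemma jantzen_lin la p a u v : jantzen A la p u -> jantzen A la p v -> jantzen A la p (a *: u + v).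
Proof.
move=> [h [Rh [s Ss e]] <-] [k [Rk [t St e']] <-].
exists (fun mu => a *: h mu + k mu) => //; split; first exact: (lspan_linear a Rh Rk).
exists (a *: s + t); first exact: lspan_linear.
have Ae mu : A (a *: s + t) mu = a *: A s mu + A t mu.
  rewrite (congr1 (fun h => h mu) (intw_add A_intw (lspanZ a Ss) St)).
  by rewrite -[LHS]/(A (a *: s) mu + A t mu) (intwZ A_intw).
case: p e e' => n e e'; apply: funext => mu; rewrite Ae.
  by rewrite -e -e' scalerDr !scalerA mulrC.
by rewrite e e' scalerDr !scalerA mulrC.
Qed.

Lemma jantzen_0 la p : jantzen A la p 0.
Proof.
exists (fun=> 0) => //; split; first exact: lspan0.
exists 0; first exact: SingSections0.
by case: p => n; apply: funext => mu; rewrite (intw0 A_intw) scaler0.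
Qed.

Lemma jantzen_neg la n : jantzen A la (Negz n) = [set 0].
Proof.
apply/seteqP; split=> f; last by move=> ->; exact: jantzen_0.
by move=> [h [_ [s _ ->]] <-]; rewrite subrr expr0n scale0r.
Qed.

Lemma jantzen_zero la : jantzen A la 0 = J0 la.
Proof.
apply/seteqP; split=> f.
  move=> [h [_ [s Ss e]] <-]; have := congr1 (fun h => h la) e; rewrite expr0 scale1r => ->.
  have [n [l [p [P [hP ->]]]]] := intw_gen Ss; apply: lspan_sum => j _.
  rewrite regZ hornerM; have [->|an0] := eqVneq (intw_coef (l j)).[la] 0.
    by rewrite mulr0 scale0r; exact: lspan0.
  by apply: lspanZ; apply: lspan_gen; exists (l j), (P j); split=> //; exact/intw_coef_neq0.
move: f; apply: lspan_ind; first exact: jantzen_0.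
  by move=> a u v; exact: jantzen_lin.
move=> _ [l [P [hP /intw_coef_neq0 an0 ->]]].
have Ss := sing_mem1 hP.
exists (A ((intw_coef l).[la]^-1 *: sg g (ps l) P)).
  split; first by apply: (intw_map A_intw); exact: lspanZ.
  by exists ((intw_coef l).[la]^-1 *: sg g (ps l) P); [exact: lspanZ|apply: funext => mu; rewrite expr0 scale1r].
by rewrite (intwZ A_intw) // intw_sing // scalerA mulVf // scale1r.
Qed.

Lemma jantzen_pos la n : jantzen A la n.+1 = RegSol g la.
Proof.
apply/seteqP; split=> f.
  by move=> [h [Rh _] <-]; exact: RegSections_at.
rewrite RegSolE; move: f; apply: lspan_ind; first exact: jantzen_0.
  by move=> a u v; exact: jantzen_lin.
move=> _ [l [P [hP ->]]].
have [a0|an0] := eqVneq (intw_coef l).[la] 0.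
  have [b [aE bn0]] := intw_coef_simple_root a0.
  exists (fun mu => (b.[la]^-1 *: b).[mu] *: reg g l mu P).
    split; first exact: RegSections_mem.
    exists (psec (b.[la]^-1 *: ('X - la%:P) ^+ n) (sg g (ps l) P)); first exact: sing_mem.
    apply: funext => mu; rewrite (intw_psec A_intw); last exact: sing_mem1.
    rewrite intw_sing // aE !scalerA hornerM !hornerZ horner_exp !hornerXsubC exprS.
    by congr (_ *: _); ring.
  by rewrite hornerZ mulVf // scale1r.
exists (A ((intw_coef l).[la]^-1 *: sg g (ps l) P)).
  split; first by apply: (intw_map A_intw); apply: lspanZ; exact: sing_mem1.
  exists (psec ((intw_coef l).[la]^-1 *: ('X - la%:P) ^+ n.+1) (sg g (ps l) P)); first exact: sing_mem.
  apply: funext => mu; rewrite (intw_psec A_intw) ?(intwZ A_intw); do ?[exact: sing_mem1].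
  by rewrite hornerZ horner_exp hornerXsubC scalerA mulrC.
rewrite (intwZ A_intw) ?intw_sing // ?scalerA ?mulVf ?scale1r //; exact: sing_mem1.
Qed.

End JantzenFiltration.

(** * Unitarity of the Jantzen quotients *)

Section UnitaryForm.
Variables (R : realType) (g la : R).
Local Notation C := R[i].
Local Notation fn := (fn R).
Local Notation regl := (fun l P => reg g l la%:C P).
Implicit Types (f h P Q : fn) (i : 'I_3) (l : nat).

Definition comps f : nat -> fn :=
  xget (fun=> 0) [set P | exists N, hfam N P /\ f = regsum g la%:C N P].

Lemma comps_regsum N (P : nat -> fn) : hfam N P -> comps (regsum g la%:C N P) = P.
Proof.
move=> hP; rewrite /comps; case: xgetP => [Q _ [M [hQ e]]|]; last first.
  by move=> /(_ P); case; exists N.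
by apply: funext => l; exact/esym/(regsum_inj hP hQ e).
Qed.

Lemma compsP f : RegSol g la%:C f ->
  exists N, hfam N (comps f) /\ f = regsum g la%:C N (comps f).
Proof. by move=> /RegSolP[N [P [hP ->]]]; exists N; rewrite comps_regsum. Qed.

Lemma comps_lin a f h : RegSol g la%:C f -> RegSol g la%:C h ->
  comps (a *: f + h) = fun l => a *: comps f l + comps h l.
Proof.
move=> /compsP[N [hf fE]] /compsP[M [hh hE]].
have [NK MK] := (leq_maxl N M, leq_maxr N M).
have H := hfam_lin a (hfam_le hf NK) (hfam_le hh MK).
rewrite -(comps_regsum H) regsum_lin (regsum_widen _ _ hf NK) (regsum_widen _ _ hh MK).
by rewrite -fE -hE.
Qed.

Lemma hfam_reg l P : harm l P -> hfam l.+1 (fun k => if k == l then P else 0).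
Proof.
move=> hP; split=> [k|k lk]; first by case: eqP => [->|_] //; exact: harm0.
by rewrite gtn_eqF.
Qed.

Lemma comps_reg l P : harm l P -> comps (regl l P) = fun k => if k == l then P else 0.
Proof.
move=> hP; rewrite -(comps_regsum (hfam_reg hP)); congr comps.
rewrite /regsum big_ord_recr /= eqxx big1 ?add0r // => k _.
by rewrite ltn_eqF // reg0.
Qed.

(* The weights make the raising and lowering parts of the Runge-Lenz operators mutually adjoint. *)
Definition weight l : C := \prod_(j < l) (Dl g j la%:C)^-1.

Lemma Dl_real l : Dl g l la%:C = ((la * (l%:R + 1) ^+ 2 + g ^+ 2) / ((2 * l%:R + 3) * (l%:R + 1)))%:C.
Proof.
rewrite /Dl rmorphM fmorphV !(rmorphD, rmorphM, rmorphXn) /=.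
by rewrite !rmorph_nat ?rmorph1.
Qed.

Lemma weight_real l : Num.conj (weight l) = weight l.
Proof.
by rewrite /weight rmorph_prod; apply: eq_bigr => j _; rewrite fmorphV /= Dl_real conj_real.
Qed.

Definition sformn N f h : C := \sum_(l < N) weight l * fis l (comps f l) (comps h l).
Definition sform f h : C := sformn (xget 0%N [set N | hfam N (comps f)]) f h.

Lemma sformn_widen N M f h : hfam N (comps f) -> (N <= M)%N -> sformn M f h = sformn N f h.
Proof.
move=> [_ f0] NM.
rewrite /sformn (big_ord_widen M (fun l => weight l * fis l (comps f l) (comps h l)) NM) [RHS]big_mkcond /=.
by apply: eq_bigr => l _; case: ltnP => // /f0 ->; rewrite fis0l mulr0.
Qed.

Lemma sformE N f h : hfam N (comps f) -> sform f h = sformn N f h.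
Proof.
move=> hN; rewrite /sform; case: xgetP => [M _ hM|]; last by move=> /(_ N); case.
rewrite -(sformn_widen h hN (leq_maxl N M)).
by rewrite -(sformn_widen h hM (leq_maxr N M)).
Qed.

Lemma hcomps f l : RegSol g la%:C f -> homogeneous l (comps f l).
Proof. by move=> /compsP[N [[/(_ l)[]]]]. Qed.

Lemma sform_herm f h : RegSol g la%:C f -> RegSol g la%:C h -> Num.conj (sform f h) = sform h f.
Proof.
move=> /compsP[N [hf _]] /compsP[M [hh _]].
rewrite (sformE h (hfam_le hf (leq_maxl N M))) (sformE f (hfam_le hh (leq_maxr N M))).
by rewrite /sformn rmorph_sum; apply: eq_bigr => l _; rewrite rmorphM /= weight_real fis_conj.
Qed.

Lemma sform_linl a f f' h : RegSol g la%:C f -> RegSol g la%:C f' ->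
  sform (a *: f + f') h = a * sform f h + sform f' h.
Proof.
move=> Rf Rf'; have [N [hf _]] := compsP Rf; have [M [hf' _]] := compsP Rf'.
have [NK MK] := (leq_maxl N M, leq_maxr N M).
have H := hfam_lin a (hfam_le hf NK) (hfam_le hf' MK); rewrite -comps_lin // in H.
rewrite (sformE h H) (sformE h (hfam_le hf NK)) (sformE h (hfam_le hf' MK)) /sformn.
rewrite mulr_sumr -big_split; apply: eq_bigr => l _ /=; rewrite comps_lin //.
by rewrite fis_linl; [ring|exact: hcomps..].
Qed.

Lemma sform_linr a f h h' : RegSol g la%:C f -> RegSol g la%:C h -> RegSol g la%:C h' ->
  sform f (a *: h + h') = Num.conj a * sform f h + sform f h'.
Proof.
move=> Rf Rh Rh'; rewrite -sform_herm //; last exact: RegSol_lin.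
by rewrite sform_linl // rmorphD rmorphM /= !sform_herm.
Qed.

Lemma sform_reg l m P Q : harm l P -> harm m Q ->
  sform (regl l P) (regl m Q) = if l == m then weight l * fis l P Q else 0.
Proof.
move=> hP hQ; have H := hfam_reg hP; rewrite -comps_reg // in H.
rewrite (sformE _ H) /sformn big_ord_recr big1 ?add0r /= => [|k _]; last first.
  by rewrite comps_reg // ltn_eqF // fis0l mulr0.
rewrite !comps_reg // eqxx; by case: eqP => _; rewrite add0r ?fis0r ?mulr0.
Qed.

Local Notation J := (J0 g la%:C).

Definition alive l := forall j, (j < l)%N -> Dl g j la%:C != 0.

Lemma J0_reg l P : harm l P -> alive l -> J (regl l P).
Proof. by move=> hP al; apply: lspan_gen; exists l, P. Qed.

Lemma J0_lin a f h : J f -> J h -> J (a *: f + h).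
Proof. exact: lspan_linear. Qed.

Lemma J0_RegSol f : J f -> RegSol g la%:C f.
Proof.
move: f; apply: lspan_sub => _ [l [P [hP _ ->]]]; exact: reg_mem.
Qed.

Lemma J0_ind (S : fn -> Prop) : S 0 -> (forall a f h, S f -> S h -> S (a *: f + h)) ->
  (forall l P, harm l P -> alive l -> S (regl l P)) -> forall f, J f -> S f.
Proof.
move=> S0 SD Sg; apply: lspan_ind => // _ [l [P [hP al ->]]]; exact: Sg.
Qed.

Lemma J0_comps f l : J f -> comps f l != 0 -> alive l.
Proof.
move=> Jf; suff: RegSol g la%:C f /\ (comps f l != 0 -> alive l) by case.
move: f Jf; apply: J0_ind.
- split; first exact: lspan0.
  have /comps_regsum : hfam 0 (fun=> 0 : fn) by split=> // k; exact: harm0.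
  by rewrite /regsum big_ord0 => ->; rewrite eqxx.
- move=> a f h [Rf Hf] [Rh Hh]; split; first exact: RegSol_lin.
  rewrite comps_lin //.
  have [f0|/Hf//] := eqVneq (comps f l) 0; have [h0|/Hh//] := eqVneq (comps h l) 0.
  by rewrite f0 h0 scaler0 addr0 eqxx.
- move=> k P hP al; split; first exact: reg_mem.
  by rewrite comps_reg //; have [->|_] := eqVneq l k; rewrite ?eqxx.
Qed.

Lemma J0_rungelenz i f : J f -> J (rungelenz g i f).
Proof.
move=> Jf; suff: smooth f /\ J (rungelenz g i f) by case.
move: f Jf; apply: J0_ind.
- by split; [exact: smooth0|rewrite rungelenz0; exact: lspan0].
- move=> a f h [sf Jf] [sh Jh]; split; first exact: smooth_lin.
  by rewrite rungelenz_lin //; exact: J0_lin.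
- move=> l P hP al; split; first exact: smooth_rp_harm (phi_smooth g l _) hP.
  rewrite rungelenz_reg //; apply: lspanZ; apply: lspanD.
    have [->|Dn0] := eqVneq (Dl g l la%:C) 0; first by rewrite scale0r; exact: lspan0.
    apply: lspanZ; apply: J0_reg; first exact: harm_Zproj.
    by move=> j; rewrite ltnS leq_eqVlt => /orP[/eqP ->|/al].
  apply: lspanZ; apply: J0_reg; first exact: harm_partial_pred.
  by move=> j jl; apply: al; apply: leq_trans jl (leq_pred l).
Qed.

Lemma J0_angmom i f : J f -> J (angmom i f).
Proof.
move=> Jf; suff: smooth f /\ J (angmom i f) by case.
move: f Jf; apply: J0_ind.
- by split; [exact: smooth0|rewrite angmomE /ang !partial0 !xm0 subrr; exact: lspan0].
- move=> a f h [sf]; rewrite !angmomE => Jf [sh Jh]; split; first exact: smooth_lin.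
  by rewrite ang_lin2 //; exact: J0_lin.
- move=> l P hP al; split; first exact: smooth_rp_harm (phi_smooth g l _) hP.
  by rewrite angmom_reg //; apply: J0_reg => //; exact: harm_angmom.
Qed.

Lemma J0_act k f : O3 k -> J f -> J (fn_act k f).
Proof.
move=> /fn_act_rot[m mm E]; rewrite (E mm); move: f; apply: J0_ind.
- by rewrite rot0; exact: lspan0.
- by move=> a f h Jf Jh; rewrite rot_lin; exact: J0_lin.
- by move=> l P hP al; rewrite /reg rot_rp; apply: J0_reg => //; exact: harm_rot.
Qed.

Definition sesquilinear_on_J0 (b : fn -> fn -> C) :=
  (forall a f f' h, J f -> J f' -> J h -> b (a *: f + f') h = a * b f h + b f' h) /\
  (forall a f h h', J f -> J h -> J h' -> b f (a *: h + h') = Num.conj a * b f h + b f h').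

Lemma sesquilinear_ext b b' : sesquilinear_on_J0 b -> sesquilinear_on_J0 b' ->
  (forall l m P Q, harm l P -> harm m Q -> alive l -> alive m ->
     b (regl l P) (regl m Q) = b' (regl l P) (regl m Q)) ->
  forall f h, J f -> J h -> b f h = b' f h.
Proof.
move=> [bl br] [bl' br'] E f h Jf Jh; have J0' : J 0 by exact: lspan0.
suff: J f /\ b f h = b' f h by case.
move: f Jf; apply: J0_ind.
- split=> //; have := bl (-1) 0 0 h J0' J0' Jh; have := bl' (-1) 0 0 h J0' J0' Jh.
  by rewrite scaler0 addr0 !mulN1r !addNr => -> ->.
- by move=> a u v [Ju Eu] [Jv Ev]; split; [exact: J0_lin|rewrite bl // bl' // Eu Ev].
- move=> l P hP al; have JP := J0_reg hP al; split=> //.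
  suff: J h /\ b (regl l P) h = b' (regl l P) h by case.
  move: h Jh; apply: J0_ind.
  + split=> //; have := br (-1) _ 0 0 JP J0' J0'; have := br' (-1) _ 0 0 JP J0' J0'.
    by rewrite scaler0 addr0 rmorphN1 !mulN1r !addNr => -> ->.
  + by move=> a u v [Ju Eu] [Jv Ev]; split; [exact: J0_lin|rewrite br // br' // Eu Ev].
  + by move=> m Q hQ am; split; [exact: J0_reg|exact: E].
Qed.

Definition linear_on_J0 (X : fn -> fn) :=
  (forall f, J f -> J (X f)) /\
  (forall a f h, J f -> J h -> X (a *: f + h) = a *: X f + X h).

Lemma sesquilinear_sform (X Y : fn -> fn) : linear_on_J0 X -> linear_on_J0 Y ->
  sesquilinear_on_J0 (fun f h => sform (X f) (Y h)).
Proof.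
move=> [JX Xl] [JY Yl]; split=> [a f f' h Jf Jf' Jh|a f h h' Jf Jh Jh'].
  by rewrite Xl // sform_linl //; apply: J0_RegSol; exact: JX.
by rewrite Yl // sform_linr //; apply: J0_RegSol; [exact: JX|exact: JY..].
Qed.

Lemma sesquilinear_opp b : sesquilinear_on_J0 b -> sesquilinear_on_J0 (fun f h => - b f h).
Proof.
move=> [bl br]; split=> [a f f' h Jf Jf' Jh|a f h h' Jf Jh Jh'].
  by rewrite bl // opprD mulrN.
by rewrite br // opprD mulrN.
Qed.

Lemma linear_id : linear_on_J0 id. Proof. by []. Qed.

Lemma J0_smooth f : J f -> smooth f.
Proof. by move=> /J0_RegSol; exact: RegSol_smooth. Qed.

Lemma linear_act k : O3 k -> linear_on_J0 (fn_act k).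
Proof. by move=> Ok; split=> [f|//]; exact: J0_act. Qed.

Lemma linear_angmom i : linear_on_J0 (angmom i).
Proof.
split=> [f|a f h Jf Jh]; first exact: J0_angmom.
by rewrite !angmomE ang_lin2 //; exact: J0_smooth.
Qed.

Lemma linear_rungelenz i : linear_on_J0 (rungelenz g i).
Proof.
split=> [f|a f h Jf Jh]; first exact: J0_rungelenz.
by rewrite rungelenz_lin //; exact: J0_smooth.
Qed.

Lemma sform_act k f h : O3 k -> J f -> J h -> sform (fn_act k f) (fn_act k h) = sform f h.
Proof.
move=> Ok; apply: (sesquilinear_ext (sesquilinear_sform (linear_act Ok) (linear_act Ok))
  (sesquilinear_sform linear_id linear_id)) => l m P Q hP hQ _ _.
have [mx mm E] := fn_act_rot Ok; rewrite !(E mm) /reg !rot_rp -!/(reg g _ la%:C _).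
rewrite !sform_reg //; do ?[exact: harm_rot].
by case: eqP => // e; subst m; rewrite fis_rot //; [case: hP|case: hQ].
Qed.

Lemma sform_angmom i f h : J f -> J h -> sform (angmom i f) h = - sform f (angmom i h).
Proof.
apply: (sesquilinear_ext (sesquilinear_sform (linear_angmom i) linear_id)
  (sesquilinear_opp (sesquilinear_sform linear_id (linear_angmom i)))) => l m P Q hP hQ _ _ /=.
rewrite !angmom_reg // !sform_reg //; do ?[exact: harm_angmom].
case: eqP => [e|_]; last by rewrite oppr0.
by subst m; rewrite fis_ang ?mulrN //; [case: hP|case: hQ].
Qed.

Lemma weightS l : alive l.+1 -> Dl g l la%:C * weight l.+1 = weight l.
Proof.
move=> al; rewrite /weight big_ord_recr /= mulrCA mulfV ?mulr1 //; exact: al.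
Qed.

Lemma sformDl f f' h : RegSol g la%:C f -> RegSol g la%:C f' -> sform (f + f') h = sform f h + sform f' h.
Proof. by move=> Rf Rf'; rewrite -[f]scale1r sform_linl // scale1r mul1r. Qed.

Lemma sformZl a f h : RegSol g la%:C f -> sform (a *: f) h = a * sform f h.
Proof.
move=> Rf; have R0 : RegSol g la%:C 0 by exact: lspan0.
have e0 : sform 0 h = 0 by have := sform_linl (-1) h R0 R0; rewrite scaler0 addr0 mulN1r addNr.
by rewrite -[a *: f]addr0 sform_linl // e0 addr0.
Qed.

(* The lowering part of one factor pairs with the raising part of the other. *)
Lemma sform_rungelenz_reg i l m P Q : harm l P -> harm m Q -> alive l -> alive m ->
  sform (rungelenz g i (regl l P)) (regl m Q) =
  - 'i * (if m == l.+1 then weight l * (l.+1%:R * fis l P (pd i Q))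
          else if l == m.+1 then weight m * (m.+1%:R * fis m (pd i P) Q) else 0).
Proof.
move=> hP hQ al am; rewrite rungelenz_reg //.
have rZ := reg_mem g la%:C (harm_Zproj i hP); have rp := reg_mem g la%:C (harm_partial_pred i hP).
rewrite sformZl; last by apply: lspanD; exact: lspanZ.
rewrite sformDl; [|exact: lspanZ..]; rewrite !sformZl //.
rewrite !sform_reg //; [|exact: harm_partial_pred|exact: harm_Zproj]; congr (_ * _).
rewrite [l.+1 == m]eq_sym; case: eqP => [e|_].
  subst m; rewrite (_ : (l.-1 == l.+1) = false) ?mulr0 ?addr0; last by case: (l) => [|k] //=; rewrite ltn_eqF.
  by rewrite (fis_Zproj _ hP hQ) -(weightS am); ring.
rewrite mulr0 add0r; case: l hP al rZ rp => [|l] hP al rZ rp /=; first by rewrite mul0r.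
by rewrite eqSS; case: eqP => [->|_]; rewrite ?mulr0 // mulrCA.
Qed.

Lemma sform_rungelenz i f h : J f -> J h -> sform (rungelenz g i f) h = - sform f (rungelenz g i h).
Proof.
apply: (sesquilinear_ext (sesquilinear_sform (linear_rungelenz i) linear_id)
  (sesquilinear_opp (sesquilinear_sform linear_id (linear_rungelenz i)))) => l m P Q hP hQ al am /=.
have RQ : RegSol g la%:C (rungelenz g i (regl m Q)) by apply/RegSol_rungelenz/reg_mem.
rewrite -[sform _ (rungelenz g i _)]sform_herm //; last exact: reg_mem.
rewrite !sform_rungelenz_reg // rmorphM rmorphN /= conjCi opprK.
rewrite mulNr; congr (- (_ * _)).
have cj k A B : Num.conj (weight k * (k.+1%:R * fis k A B)) = weight k * (k.+1%:R * fis k B A).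
  by rewrite !rmorphM /= weight_real rmorph_nat fis_conj.
have [->|ne] := eqVneq m l.+1; first by rewrite ltn_eqF ?cj // ltnW.
by case: eqP => _; rewrite ?cj ?rmorph0.
Qed.

Hypothesis Dl_gt0 : forall l, alive l -> forall j, (j < l)%N -> 0 < Dl g j la%:C.

Lemma weight_gt0 l : alive l -> 0 < weight l.
Proof. by move=> al; apply: prodr_gt0 => j _; rewrite invr_gt0; exact: Dl_gt0 al _ _. Qed.

Lemma sform_gt0 f : J f -> f != 0 -> 0 < sform f f.
Proof.
move=> Jf f0; have [N [hf fE]] := compsP (J0_RegSol Jf).
have t0 l : 0 <= weight l * fis l (comps f l) (comps f l).
  have [->|/(J0_comps Jf)/weight_gt0/ltW w0] := eqVneq (comps f l) 0; first by rewrite fis0l mulr0.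
  by rewrite mulr_ge0 // fis_ge0.
rewrite (sformE _ hf) lt_neqAle sumr_ge0 // andbT eq_sym; apply: contra f0 => /eqP.
move=> /psumr_eq0P H; rewrite fE /regsum big1 // => l _.
have /eqP := H (fun k _ => t0 (k : 'I_N)) l isT; rewrite mulf_eq0.
have [->|c0] := eqVneq (comps f l) 0; first by rewrite reg0.
rewrite (gt_eqF (weight_gt0 (J0_comps Jf c0))) /= => /eqP /(fis_eq0 (hcomps l (J0_RegSol Jf))) e.
by rewrite e eqxx in c0.
Qed.

Local Notation Q0 := (subquot J [set 0]).

Lemma lspan_set0 f : lspan [set 0] f -> f = 0.
Proof. by move: f; apply: lspan_ind => // a f h -> ->; rewrite scaler0 addr0. Qed.

Lemma J0_rep (c : Q0) : J (rep c).
Proof. by have := rep_mem c; move: (rep c); apply: lspan_sub. Qed.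

Lemma rep_lin_J0 a (c d : Q0) : rep (a *: c + d) = a *: rep c + rep d.
Proof. by apply/eqP; rewrite -subr_eq0; apply/eqP/lspan_set0/rep_lin. Qed.

Lemma rep_sqmap X (c : Q0) : linear_on_J0 X -> rep (sqmap X c) = X (rep c).
Proof.
move=> [JX _]; apply/eqP; rewrite -subr_eq0; apply/eqP/lspan_set0/rep_sqcls.
by apply: lspan_gen; exact/JX/J0_rep.
Qed.

Definition qform (c d : Q0) : C := sform (rep c) (rep d).

Lemma qform_bilinear : sesquilinear.bilinear_for *%R (Num.conj \; *%R) qform.
Proof.
split=> [d a c c'|c a d d'] /=; rewrite /qform rep_lin_J0.
  by rewrite sform_linl //; exact/J0_RegSol/J0_rep.
by rewrite sform_linr //; exact/J0_RegSol/J0_rep.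
Qed.

Lemma qform_herm c d : qform c d = (-1) ^+ false * Num.conj (qform d c).
Proof. by rewrite expr0 mul1r sform_herm //; exact/J0_RegSol/J0_rep. Qed.

Lemma qform_gt0 c : c != 0 -> 0 < qform c c.
Proof.
move=> c0; apply: sform_gt0; first exact: J0_rep.
by apply: contra c0 => /eqP r0; rewrite -(sqcls_rep c) r0 sqcls0.
Qed.

HB.instance Definition _ := sesquilinear.bilinear_isBilinear.Build C Q0 Q0 C
  *%R (Num.conj \; *%R) qform qform_bilinear.
HB.instance Definition _ := sesquilinear.isHermitianSesquilinear.Build C Q0 false Num.conj qform qform_herm.
HB.instance Definition _ := sesquilinear.isDotProduct.Build C Q0 qform qform_gt0.

Lemma unitary_J0 : @inf_unitary R Q0 (fun k => sqmap (fn_act k)) (fun i => sqmap (@angmom R i))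
  (fun i => sqmap (rungelenz g i)).
Proof.
exists (qform : sesquilinear.Dot.type Q0 Num.conj); split.
- move=> k c d Ok; rewrite /= /qform !(rep_sqmap _ (linear_act Ok)).
  by apply: sform_act => //; exact: J0_rep.
- move=> i c d; rewrite /= /qform !(rep_sqmap _ (linear_angmom i)).
  by apply: sform_angmom; exact: J0_rep.
- move=> i c d; rewrite /= /qform !(rep_sqmap _ (linear_rungelenz i)).
  by apply: sform_rungelenz; exact: J0_rep.
Qed.

End UnitaryForm.

Section NonUnitary.
Variables (R : realType) (g la : R).
Local Notation C := R[i].
Local Notation fn := (fn R).
Local Notation regl := (fun l P => reg g l la%:C P).
Implicit Types (f h P Q : fn) (i : 'I_3) (l : nat).

Lemma exists_harm l : exists2 P : fn, harm l P & P != 0.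
Proof.
elim: l => [|l [P hP P0]]; first by exists (@cst1 R); [exact: harm_cst1|exact: cst1_neq0].
have [/existsP[i Zi]|/existsPn Z0] := boolP [exists i, Zproj l i P != 0].
  by exists (Zproj l i P) => //; exact: harm_Zproj.
have /esym/eqP := sum_partial_Zproj hP; rewrite big1 => [|i _]; last first.
  by move: (Z0 i); rewrite negbK => /eqP ->; exact: partial0.
rewrite scaler_eq0 (negbTE P0) orbF mulf_eq0 invr_eq0 mulf_eq0.
by rewrite (negbTE (neq0_2l3 R l)) (negbTE (neq0_l1 R l)) (negbTE (neq0_2l1 R l)).
Qed.

(* For [la < 0] the coefficient is positive in high degrees, which is impossible for skew-symmetric operators. *)
Lemma sum_rungelenz_sq l P : harm l.+1 P ->
  \sum_i rungelenz g i (rungelenz g i (regl l.+1 P)) =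
  (- (la * (l.+1%:R ^+ 2 + l.+1%:R + 1) + g ^+ 2)%:C) *: regl l.+1 P.
Proof.
move=> hP.
have E i : rungelenz g i (rungelenz g i (regl l.+1 P)) =
    - (Dl g l.+1 la%:C *: (Dl g l.+2 la%:C *: regl l.+3 (Zproj l.+2 i (Zproj l.+1 i P))
         + l.+2%:R *: regl l.+1 (pd i (Zproj l.+1 i P)))
      + l.+1%:R *: (Dl g l la%:C *: regl l.+1 (Zproj l i (pd i P))
         + l%:R *: regl l.-1 (pd i (pd i P)))).
  have hZ := harm_Zproj i hP; have hp := harm_partial i hP.
  have sZ : smooth (regl l.+2 (Zproj l.+1 i P)) by exact: smooth_rp_harm (phi_smooth g _ _) hZ.
  have sp : smooth (regl l (pd i P)) by exact: smooth_rp_harm (phi_smooth g _ _) hp.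
  have slin a f : smooth f -> smooth (a *: f).
    by move=> sf; rewrite -[a *: f]addr0; apply: smooth_lin => //; exact: smooth0.
  rewrite (rungelenz_reg g la%:C i hP) -[l.+1.-1]/l rungelenzZ; last first.
    by apply: smooth_lin => //; exact: slin.
  rewrite rungelenz_lin ?rungelenzZ //; last exact: slin.
  rewrite !rungelenz_reg // !(scalerA _ (- 'i)) !(mulrC _ (- 'i)) -!scalerA -scalerDr scalerA.
  by rewrite mulrNN -expr2 sqrCi scaleN1r.
rewrite (eq_bigr _ (fun i _ => E i)) sumrN big_split /= -!scaler_sumr !big_split /= -!scaler_sumr.
rewrite -!reg_sum (sum_Zproj_Zproj hP) (sum_partial_Zproj hP) (sum_Zproj_partial _ hP).
have [_] := hP; rewrite /lap => ->; rewrite !reg0 !scaler0 !regZ add0r addr0 !scalerA -scalerDl -scaleNr.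
congr (_ *: _); congr (- _); rewrite /Dl.
rewrite !(rmorphM, rmorphD, rmorphXn) /= !rmorph_nat ?rmorph1 -[l.+2%:R]natr1 -![l.+1%:R]natr1.
have h1 := neq0_l1 R l; have h2 : l%:R + 1 + 1 != 0 :> C by rewrite natr1 neq0_l1.
have h3 : 2 * (l%:R + 1) + 1 != 0 :> C by rewrite natr1 neq0_2l1.
have h4 := neq0_2l3 R l; have h5 : 2 * (l%:R + 1) + 3 != 0 :> C by rewrite natr1 neq0_2l3.
by field; rewrite ?h1 ?h2 ?h3 ?h4 ?h5.
Qed.

Hypothesis la_lt0 : la < 0.

Lemma not_unitary (U W : set fn) N : lspan U = RegSol g la%:C ->
  (forall f, lspan W f -> lspan U f) ->
  (forall i f, lspan W f -> lspan W (rungelenz g i f)) ->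
  (forall l P, (N <= l)%N -> harm l P -> lspan W (regl l P) -> P = 0) ->
  ~ @inf_unitary R (subquot U W) (fun k => sqmap (fn_act k)) (fun i => sqmap (@angmom R i))
      (fun i => sqmap (rungelenz g i)).
Proof.
move=> UE WU RW WN [B [_ _ BR]].
pose l := maxn N (Num.bound (g ^+ 2 / - la)).
have [P hP P0] := exists_harm l.+1.
have Ru i f : lspan U f -> lspan U (rungelenz g i f) by rewrite UE; exact: RegSol_rungelenz.
have sR i f : lspan U f -> sqmap (rungelenz g i) (sqcls U W f) = sqcls U W (rungelenz g i f).
  move=> Uf; apply: sqmap_sqcls => //; [|exact: RW|exact: Ru].
  rewrite UE => u v Ru' Rv'; rewrite addrC -scaleN1r rungelenz_lin; [|exact: RegSol_smooth Rv'|exact: RegSol_smooth Ru'].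
  by rewrite scaleN1r addrC.
have Uf : lspan U (regl l.+1 P) by rewrite UE; exact: reg_mem.
pose c : subquot U W := sqcls U W (regl l.+1 P).
have c0 : c != 0.
  apply/eqP => /sqcls_eq0 c0; move: P0; rewrite (WN l.+1 P (leqW (leq_maxl _ _)) hP (c0 Uf)).
  by rewrite eqxx.
have Bc : 0 < B c c by exact: sesquilinear.neq0_dnorm_gt0.
pose k : R := la * (l.+1%:R ^+ 2 + l.+1%:R + 1) + g ^+ 2.
have k0 : k < 0.
  have la0 : 0 < - la by rewrite oppr_gt0.
  have /archi_boundP : 0 <= g ^+ 2 / - la by rewrite divr_ge0 ?sqr_ge0 // ltW.
  rewrite ltr_pdivrMr // => Hb.
  have bl : (Num.bound (g ^+ 2 / - la))%:R <= l.+1%:R :> R.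
    by rewrite ler_nat; apply: leqW; exact: leq_maxr.
  have l0 : 0 <= l.+1%:R ^+ 2 :> R by rewrite sqr_ge0.
  have := ler_wpM2r (ltW la0) bl; rewrite /k.
  set b := (Num.bound _)%:R in Hb *; set L := l.+1%:R in l0 *; nra.
have S : \sum_i B (sqmap (rungelenz g i) c) (sqmap (rungelenz g i) c) = k%:C * B c c.
  transitivity (- B (\sum_i sqmap (rungelenz g i) (sqmap (rungelenz g i) c)) c).
    rewrite sesquilinear.linear_sumlz -sumrN; apply: eq_bigr => i _.
    by apply/esym; rewrite -[RHS]opprK; congr (- _); exact: BR.
  rewrite (_ : \sum_i _ = (- k%:C) *: c); first by rewrite sesquilinear.linearZl_LR /= mulNr opprK.
  rewrite -sqclsZ // -sum_rungelenz_sq //.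
  have sum_cls (F : 'I_3 -> fn) : (forall i, lspan U (F i)) -> sqcls U W (\sum_i F i) = \sum_i sqcls U W (F i).
    move=> UF; suff: lspan U (\sum_i F i) /\ sqcls U W (\sum_i F i) = \sum_i sqcls U W (F i) by case.
    elim/big_rec2: _ => [|i a f _ [Uf' E]]; first by split; [exact: lspan0|exact: sqcls0].
    by split; [exact: lspanD|rewrite sqclsD // E].
  rewrite (sum_cls _ (fun i => Ru i _ (Ru i _ Uf))).
  by apply: eq_bigr => i _; rewrite /c (sR i _ Uf) (sR i _ (Ru i _ Uf)).
have : 0 <= k%:C * B c c.
  rewrite -S; apply: sumr_ge0 => i _.
  have [->|n0] := eqVneq (sqmap (rungelenz g i) c) 0; first by rewrite sesquilinear.linear0r.
  exact/ltW/sesquilinear.neq0_dnorm_gt0.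
by rewrite pmulr_lge0 // ler0c leNgt k0.
Qed.

End NonUnitary.

(** * Decay at infinity *)

Section RadialAsymptotics.
Variables (R : realType) (g la : R).
Local Notation C := R[i].
Implicit Types (l : nat) (r a b : R).

Lemma bpair_real l k : exists x y : R, bpair g l la%:C k = (x%:C, y%:C).
Proof.
elim: k => [|k [x [y E]]]; first by exists 1, 0.
exists (- (2 * g * x + la * y) / (k.+1%:R * (k%:R + 2 * l%:R + 2))), x.
rewrite /= E /=; congr (_, _); rewrite rmorphM fmorphV rmorphN !(rmorphD, rmorphM) /=.
by rewrite !rmorph_nat.
Qed.

Lemma cpseries_real (c : nat -> R) r : cpseries (fun k => (c k)%:C) r = (rps c r)%:C.
Proof.
have e : complex.Im (cpseries (fun=> 0 : C) r) = 0 by rewrite cpseries0.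
by rewrite cpseriesE; congr (_ +i* _); rewrite cpseriesE in e.
Qed.

Lemma phi_real l r : phi g l la%:C r = (complex.Re (phi g l la%:C r))%:C /\
  phi1 g l la%:C r = (complex.Re (phi1 g l la%:C r))%:C.
Proof.
pose c k := complex.Re (bcoef g l la%:C k).
have cE : bcoef g l la%:C = fun k => (c k)%:C.
  by apply: funext => k; rewrite /c /bcoef; have [x [y ->]] := bpair_real l k.
rewrite /phi /phi1 cE.
have -> : cdiffs (fun k => (c k)%:C) = fun k => (k.+1%:R * c k.+1)%:C.
  by apply: funext => k; rewrite /cdiffs rmorphM rmorph_nat.
by rewrite !cpseries_real.
Qed.

Definition rphi l r : R := complex.Re (phi g l la%:C r).
Definition rphi1 l r : R := complex.Re (phi1 g l la%:C r).
Definition dcoef l : R := (la * (l%:R + 1) ^+ 2 + g ^+ 2) / ((2 * l%:R + 3) * (l%:R + 1)).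

Lemma phiE l r : phi g l la%:C r = (rphi l r)%:C. Proof. by have [] := phi_real l r. Qed.
Lemma phi1E l r : phi1 g l la%:C r = (rphi1 l r)%:C. Proof. by have [] := phi_real l r. Qed.

Lemma rphi_derive l r : 0 < r -> is_derive r 1 (rphi l) (rphi1 l r).
Proof. by move=> r0; have [/(_ r r0)/has_cDP[]] := phi_rsol g l la%:C. Qed.

Lemma rphi1_derive l r : 0 < r ->
  is_derive r 1 (rphi1 l) (- ((2 * l%:R + 2) / r * rphi1 l r + (2 * g / r + la) * rphi l r)).
Proof.
move=> r0; have [_ /(_ r r0)/has_cDP[_ D _]] := phi_rsol g l la%:C.
apply: is_derive_eq; rewrite /rode phiE phi1E.
rewrite (_ : - _ = (- ((2 * l%:R + 2) / r * rphi1 l r + (2 * g / r + la) * rphi l r))%:C) //.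
by rewrite !(rmorphN, rmorphD, rmorphM, fmorphV, rmorph_nat).
Qed.

(* [ured] is [r F] for the regular solution [F], [ured1] is its derivative, and [ured1' = upot * ured]. *)
Definition ured l r : R := r ^+ l.+1 * rphi l r.
Definition ured1 l r : R := l.+1%:R * r ^+ l * rphi l r + r ^+ l.+1 * rphi1 l r.
Definition upot l r : R := l%:R * (l%:R + 1) / r ^+ 2 - 2 * g / r - la.

Lemma is_derive_M (f h : R -> R) r f' h' : is_derive r 1 f f' -> is_derive r 1 h h' ->
  is_derive r 1 (fun x => f x * h x) (f' * h r + f r * h').
Proof. by move=> Df Dh; apply: is_derive_eq; rewrite /= addrC mulrC. Qed.

Lemma is_derive_powr n r : is_derive r 1 (fun x : R => x ^+ n) (n%:R * r ^+ n.-1).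
Proof.
have -> : (fun x : R => x ^+ n) = id ^+ n by rewrite fctE.
by apply: is_derive_eq; rewrite [LHS]mulr1.
Qed.

Lemma is_derive_Z a (f : R -> R) r f' : is_derive r 1 f f' -> is_derive r 1 (fun x => a * f x) (a * f').
Proof.
move=> Df; have := is_derive_M (is_derive_cst (a : R^o) (r : R^o) 1) Df.
by move=> D; apply: (is_derive_eq D); rewrite mul0r add0r.
Qed.

Lemma is_derive_D (f h : R -> R) r f' h' : is_derive r 1 f f' -> is_derive r 1 h h' ->
  is_derive r 1 (fun x => f x + h x) (f' + h').
Proof. by move=> Df Dh; exact: is_deriveD. Qed.

Lemma ured_derive l r : 0 < r -> is_derive r 1 (ured l) (ured1 l r).
Proof. by move=> r0; exact: is_derive_M (is_derive_powr l.+1 r) (rphi_derive l r0). Qed.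

Lemma ured1_derive l r : 0 < r -> is_derive r 1 (ured1 l) (upot l r * ured l r).
Proof.
move=> r0; have D := is_derive_M (is_derive_Z l.+1%:R (is_derive_powr l r)) (rphi_derive l r0).
have D1 := is_derive_M (is_derive_powr l.+1 r) (rphi1_derive l r0).
apply: (is_derive_eq (is_derive_D D D1)); rewrite /upot /ured -natr1 exprS.
case: l {D D1} => [|l] /=; first by field; rewrite gt_eqF.
by rewrite exprS -natr1; field; rewrite gt_eqF.
Qed.

Lemma ured_raise l r : 0 < r ->
  (l%:R + 1) * ured1 l r - ((l%:R + 1) ^+ 2 / r - g) * ured l r = - dcoef l * ured l.+1 r.
Proof.
move=> r0; have := rtheta_phi g l la%:C r0; rewrite Dl_real /rtheta !phiE phi1E => E.
have {E} : ((l%:R + 1) * rphi1 l r + g * rphi l r) / r = - dcoef l * rphi l.+1 r.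
  apply: (@complexI R); rewrite /dcoef [RHS]rmorphM rmorphN /= -E.
  by rewrite rmorphM fmorphV !(rmorphD, rmorphM) !rmorph_nat ?rmorph1.
move=> E; transitivity (r ^+ l.+2 * (- dcoef l * rphi l.+1 r)); last by rewrite /ured; ring.
by rewrite -E /ured1 /ured -natr1 !exprS; field; rewrite gt_eqF.
Qed.

Lemma ured_lower l r : 0 < r ->
  (l%:R + 1) * ured1 l.+1 r + ((l%:R + 1) ^+ 2 / r - g) * ured l.+1 r =
  (l%:R + 1) * (2 * l%:R + 3) * ured l r.
Proof.
move=> r0; have := rlower_phi g l la%:C r0; rewrite /rlower !phiE phi1E => E.
have {E} : (l%:R + 1) * r * rphi1 l.+1 r + ((l%:R + 1) * (2 * l%:R + 3) - g * r) * rphi l.+1 r =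
    (l%:R + 1) * (2 * l%:R + 3) * rphi l r.
  apply: (@complexI R); move: E; rewrite -[l.+1%:R]natr1 (_ : 2 * (l%:R + 1) + 1 = 2 * l%:R + 3 :> C); last by ring.
  by move=> E; rewrite !(rmorphM, rmorphD, rmorphN) !rmorph_nat ?rmorph1.
move=> E; transitivity (r ^+ l.+1 * ((l%:R + 1) * (2 * l%:R + 3) * rphi l r)); last by rewrite /ured; ring.
by rewrite -E /ured1 /ured -[l.+2%:R]natr1 -natr1 !exprS; field; rewrite gt_eqF.
Qed.

End RadialAsymptotics.

Section RadialDecay.
Variables (R : realType) (g la : R).
Hypothesis g_gt0 : 0 < g.
Local Notation C := R[i].
Local Notation u := (ured g la).
Local Notation v := (ured1 g la).
Local Notation P := (upot g la).
Implicit Types (l : nat) (r a b e : R) (f : R -> R).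

Lemma pos_MVT f f' a b : (forall r, 0 < r -> is_derive r 1 f (f' r)) -> 0 < a -> a <= b ->
  exists c, [/\ a <= c, c <= b & f b - f a = f' c * (b - a)].
Proof.
move=> D a0 ab; have dr r : a <= r -> is_derive r 1 f (f' r) by move=> ar; apply: D; exact: lt_le_trans ar.
have [||c] := @MVT_segment R f f' a b ab.
- by move=> r /itvP rab; apply: dr; rewrite rab.
- apply: derivable_within_continuous => r /itvP rab.
  by have [] := dr r _; rewrite ?rab.
- by move=> /itvP cab E; exists c; rewrite !cab.
Qed.

Lemma pos_nondecr f f' a b : (forall r, 0 < r -> is_derive r 1 f (f' r)) -> 0 < a -> a <= b ->
  (forall r, a <= r -> 0 <= f' r) -> f a <= f b.
Proof.
move=> D a0 ab f0; have [c [ac _ E]] := pos_MVT D a0 ab.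
by rewrite -subr_ge0 E mulr_ge0 ?f0 // subr_ge0.
Qed.

Lemma pos_nonincr f f' a b : (forall r, 0 < r -> is_derive r 1 f (f' r)) -> 0 < a -> a <= b ->
  (forall r, a <= r -> f' r <= 0) -> f b <= f a.
Proof.
move=> D a0 ab f0; have [c [ac _ E]] := pos_MVT D a0 ab.
by rewrite -subr_le0 E mulr_le0_ge0 ?f0 // subr_ge0.
Qed.

Lemma normr_le_sqr a b : a ^+ 2 <= b ^+ 2 -> `|a| <= `|b|.
Proof. by move=> ab; rewrite -(@ler_pXn2r _ 2) ?nnegrE // !real_normK ?num_real. Qed.

Definition decays l := forall e, 0 < e -> exists2 M, 0 < M & forall r, M < r -> `|u l r| < e * r.
Definition bdd l := exists B M, 0 < M /\ forall r, M <= r -> `|u l r| <= B /\ `|v l r| <= B.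

Lemma bounded_decays l B M : 0 < M -> (forall r, M <= r -> `|u l r| <= B) -> decays l.
Proof.
move=> M0 uB e e0; have B0 : 0 <= B by apply: le_trans (uB M (lexx M)).
exists (M + B / e); first by rewrite ltr_pwDl // divr_ge0 // ltW.
move=> r Mr; have Be : 0 <= B / e by rewrite divr_ge0 // ltW.
apply: le_lt_trans (uB r _) _; first by apply: ltW; apply: le_lt_trans Mr; rewrite lerDl.
by rewrite -ltr_pdivrMl // mulrC; apply: lt_trans Mr; rewrite ltrDr.
Qed.

Lemma usq_derive l r : 0 < r -> is_derive r 1 (fun x => u l x ^+ 2) (2 * (u l r * v l r)).
Proof.
move=> r0; have D := ured_derive g la l r0.
by apply: (is_derive_eq (is_derive_M D D)); ring.
Qed.

Lemma vsq_derive l r : 0 < r -> is_derive r 1 (fun x => v l x ^+ 2) (2 * P l r * (u l r * v l r)).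
Proof.
move=> r0; have D := ured1_derive g la l r0.
by apply: (is_derive_eq (is_derive_M D D)); ring.
Qed.

Lemma uv_derive l r : 0 < r -> is_derive r 1 (fun x => u l x * v l x) (v l r ^+ 2 + P l r * u l r ^+ 2).
Proof.
move=> r0; apply: (is_derive_eq (is_derive_M (ured_derive g la l r0) (ured1_derive g la l r0))).
by ring.
Qed.

Lemma upot_derive l r : 0 < r -> is_derive r 1 (P l) (2 * g / r ^+ 2 - 2 * (l%:R * (l%:R + 1)) / r ^+ 3).
Proof.
move=> r0; have rn0 : r != 0 by rewrite gt_eqF.
have D1 := is_deriveV rn0 (is_derive_id (r : R^o) 1).
have D2 := is_derive_M D1 D1.
have D := is_derive_D (is_derive_D (is_derive_Z (l%:R * (l%:R + 1)) D2) (is_derive_Z (- (2 * g)) D1))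
  (is_derive_cst (- la : R^o) (r : R^o) 1).
have -> : P l = fun x => l%:R * (l%:R + 1) * (x^-1 * x^-1) + - (2 * g) * x^-1 + - la.
  by apply: funext => x; rewrite /upot expr2 invfM; ring.
apply: (is_derive_eq D); rewrite /=.
by rewrite -![_ *: _]/(_ * _); field.
Qed.

Section NegativeEnergy.
Hypothesis la_lt0 : la < 0.
Let r1 := 2 * g / - la.
Let r1_gt0 : 0 < r1. Proof. by rewrite divr_gt0 ?oppr_gt0 // mulr_gt0. Qed.

Lemma upot_ge0 l r : r1 <= r -> 0 <= P l r.
Proof.
move=> rr; have r0 : 0 < r by exact: lt_le_trans rr.
have h : 0 <= l%:R * (l%:R + 1) / r ^+ 2 by apply: divr_ge0; [rewrite mulr_ge0 ?addr_ge0 ?ler0n|exact: sqr_ge0].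
have : 2 * g / r <= - la by rewrite ler_pdivrMr // [leRHS]mulrC -ler_pdivrMr ?oppr_gt0.
by rewrite /upot => h'; lra.
Qed.

Lemma uv_nondecr l r0 r : r1 <= r0 -> r0 <= r -> u l r0 * v l r0 <= u l r * v l r.
Proof.
move=> rr0 r0r; apply: (pos_nondecr (@uv_derive l) (lt_le_trans r1_gt0 rr0) r0r) => x xr.
by rewrite addr_ge0 ?sqr_ge0 // mulr_ge0 ?sqr_ge0 // upot_ge0 // (le_trans rr0).
Qed.

(* Once [u u' > 0], [u'] is bounded away from 0 and [u] grows at least linearly. *)
Lemma decays_uv l r0 : decays l -> r1 <= r0 -> u l r0 * v l r0 <= 0.
Proof.
move=> dl rr0; rewrite leNgt; apply/negP => uv0.
have r0_gt0 : 0 < r0 by exact: lt_le_trans rr0.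
pose m := `|v l r0|; have m0 : 0 < m.
  by rewrite normr_gt0; apply/eqP => v0; rewrite v0 mulr0 ltxx in uv0.
have vm r : r0 <= r -> m <= `|v l r|.
  move=> rr; apply: normr_le_sqr.
  apply: (pos_nondecr (@vsq_derive l) r0_gt0 rr) => x xr.
  apply: mulr_ge0; first by rewrite mulr_ge0 ?upot_ge0 // (le_trans rr0).
  by apply: le_trans (uv_nondecr l rr0 xr); exact: ltW.
have [M M0 uM] := dl (m / 2) (divr_gt0 m0 (ltr0n _ 2)).
pose r := M + 2 * r0 + 2 * (`|u l r0| / m).
have c0 : 0 <= `|u l r0| / m by rewrite divr_ge0 // ltW.
have rr : r0 <= r by rewrite /r; lra.
have [c [rc _ E]] := pos_MVT (@ured_derive _ g la l) r0_gt0 rr.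
have : `|u l r - u l r0| = `|v l c| * (r - r0).
  by rewrite E normrM [`|r - r0|]ger0_norm // subr_ge0.
have rM : M < r by rewrite /r; lra.
have := uM r rM; have := vm c rc; have := ler_normB (u l r) (u l r0).
have cE : `|u l r0| = m * (`|u l r0| / m) by rewrite mulrC divfK // gt_eqF.
move: rr rM; rewrite {}cE; move: (`|u l r0| / m) c0 @r E => k k0 r E rr rM h1 h2 h3 h4.
have : m * (r - r0) <= `|v l c| * (r - r0) by rewrite ler_wpM2r // subr_ge0.
by rewrite -h4 /r in h1 h3 *; nra.
Qed.

Lemma decays_bdd l : decays l -> bdd l.
Proof.
move=> dl; exists (Num.max `|u l r1| `|v l r1|), r1; split=> // r rr.
rewrite !le_max; split; apply/orP; [left|right]; apply: normr_le_sqr.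
  apply: (pos_nonincr (@usq_derive l) r1_gt0 rr) => x xr.
  by rewrite mulr_ge0_le0 // decays_uv.
apply: (pos_nonincr (@vsq_derive l) r1_gt0 rr) => x xr.
by rewrite mulr_ge0_le0 ?decays_uv // mulr_ge0 ?upot_ge0.
Qed.

Lemma decays_raise l : dcoef g la l != 0 -> decays l -> decays l.+1.
Proof.
move=> d0 /decays_bdd[B [M [M0 uvB]]].
pose k := (l%:R + 1) ^+ 2 / M + g.
have l0 : 0 <= l%:R + 1 :> R by rewrite addr_ge0 ?ler0n.
apply: (@bounded_decays _ (((l%:R + 1) * B + k * B) / `|dcoef g la l|) M) => // r Mr.
have r0 : 0 < r by exact: lt_le_trans Mr.
have [uB vB] := uvB r Mr.
rewrite ler_pdivlMr ?normr_gt0 // -normrM mulrC -normrN -mulNr -ured_raise //.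
apply: le_trans (ler_normB _ _) _; rewrite [X in X + _]normrM [X in _ + X]normrM (ger0_norm l0); apply: lerD.
  exact: ler_wpM2l.
apply: ler_pM => //; apply: le_trans (ler_normB _ _) _; rewrite /k (gtr0_norm g_gt0).
rewrite lerD2r ger0_norm ?divr_ge0 ?sqr_ge0 ?(ltW r0) //.
by rewrite ler_wpM2l ?sqr_ge0 // lef_pV2.
Qed.

Lemma decays_lower l : decays l.+1 -> decays l.
Proof.
move=> /decays_bdd[B [M [M0 uvB]]].
pose k := (l%:R + 1) ^+ 2 / M + g.
have l0 : 0 < l%:R + 1 :> R by rewrite ltr_wpDl ?ler0n.
have l3 : 0 < (l%:R + 1) * (2 * l%:R + 3) :> R.
  by rewrite mulr_gt0 // ltr_wpDl ?mulr_ge0 ?ler0n.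
apply: (@bounded_decays _ (((l%:R + 1) * B + k * B) / ((l%:R + 1) * (2 * l%:R + 3))) M) => // r Mr.
have r0 : 0 < r by exact: lt_le_trans Mr.
have [uB vB] := uvB r Mr.
rewrite ler_pdivlMr // mulrC -[X in X * _](gtr0_norm l3) -normrM -ured_lower //.
apply: le_trans (ler_normD _ _) _; rewrite [X in X + _]normrM [X in _ + X]normrM (gtr0_norm l0); apply: lerD.
  by rewrite ler_wpM2l // ltW.
apply: ler_pM => //; apply: le_trans (ler_normB _ _) _; rewrite /k (gtr0_norm g_gt0).
rewrite lerD2r ger0_norm ?divr_ge0 ?sqr_ge0 ?(ltW r0) //.
by rewrite ler_wpM2l ?sqr_ge0 // lef_pV2.
Qed.

Lemma uv_gt0 l : exists2 s, 0 < s & 0 < u l s * v l s.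
Proof.
pose h r := rphi g la l r * ((l%:R + 1) * rphi g la l r + r * rphi1 g la l r).
have [cp _] := cpseries_cont (cent_bcoef g l la%:C).
have [cp1 _] := cpseries_cont (cent_diffs (cent_bcoef g l la%:C)).
have ch : {for 0, continuous h}.
  apply: cvgM => //; apply: cvgD; first by apply: cvgM => //; exact: cvg_cst.
  by apply: cvgM => //; exact: cvg_id.
have h0 : h 0 = l%:R + 1 by rewrite /h /rphi phi0 /= mul0r addr0 mulr1 mul1r.
have h0_gt0 : 0 < h 0 by rewrite h0 ltr_wpDl ?ler0n.
have : \forall r \near (0 : R), 0 < h r by exact: cvgr_gt (h 0) ch 0 h0_gt0.
move=> /nbhs_ballP[e /= e0 He].
have e2 : 0 < e / 2 by rewrite divr_gt0.
exists (e / 2) => //; have hs : 0 < h (e / 2).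
  by apply: He; rewrite /ball /= sub0r normrN gtr0_norm // ltr_pdivrMr // mulr_natr mulr2n ltrDr.
have -> : u l (e / 2) * v l (e / 2) = (e / 2) ^+ l * (e / 2) ^+ l.+1 * h (e / 2).
  by rewrite /ured /ured1 /h -natr1 !exprS; ring.
by apply: mulr_gt0 => //; rewrite mulr_gt0 ?exprn_gt0.
Qed.

Lemma eventually_not_decays : exists J, forall j, (J <= j)%N -> ~ decays j.
Proof.
have la0 : 0 < - la by rewrite oppr_gt0.
(* In high degrees the potential is nonnegative everywhere and [u u' > 0] near 0. *)
exists (Num.bound (g ^+ 2 / - la)) => j Jj dj.
have [s s0 uvs] := uv_gt0 j; pose r := Num.max s r1.
have /archi_boundP : 0 <= g ^+ 2 / - la by rewrite divr_ge0 ?sqr_ge0 // ltW.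
rewrite ltr_pdivrMr // => Hb.
have bj : (Num.bound (g ^+ 2 / - la))%:R <= j%:R :> R by rewrite ler_nat.
have P0 x : 0 < x -> 0 <= P j x.
  move=> x0; have -> : P j x = (j%:R * (j%:R + 1) - 2 * g * x - la * x ^+ 2) / x ^+ 2.
    by rewrite /upot; field; rewrite gt_eqF.
  rewrite divr_ge0 ?sqr_ge0 // -(@pmulr_rge0 _ (- la)) //.
  have := ler_wpM2r (ltW la0) bj; have : 0 <= (g + la * x) ^+ 2 by exact: sqr_ge0.
  have : 0 <= j%:R * j%:R * - la by rewrite mulr_ge0 ?mulr_ge0 ?ler0n // ltW.
  set n := j%:R in bj *; set b := (Num.bound _)%:R in bj Hb *; nra.
have : u j s * v j s <= u j r * v j r.
  apply: (pos_nondecr (@uv_derive j) s0) => [|x sx]; first by rewrite le_max lexx.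
  by rewrite addr_ge0 ?sqr_ge0 // mulr_ge0 ?sqr_ge0 // P0 // (lt_le_trans s0).
move=> /(lt_le_trans uvs); rewrite ltNge decays_uv //.
by rewrite le_max lexx orbT.
Qed.

Lemma decays_neg l : decays l <-> exists2 j, (l <= j)%N & dcoef g la j = 0.
Proof.
split.
  move=> dl; apply: contrapT => ne; have [J nJ] := eventually_not_decays.
  have dj k : decays (l + k).
    elim: k => [|k IHk]; first by rewrite addn0.
    rewrite addnS; apply: decays_raise IHk; apply/eqP => d0; apply: ne.
    by exists (l + k)%N => //; exact: leq_addr.
  by apply: nJ (dj J); exact: leq_addl.
move=> [j lj d0]; suff dj : decays j.
  rewrite -(subKn lj); elim: (j - l)%N => [|k IHk]; first by rewrite subn0.
  have [kj|jk] := ltnP k j; last by rewrite (eqP (_ : j - k.+1 == 0)%N) ?subn_eq0 ?leqW //; rewrite (eqP (_ : j - k == 0)%N) ?subn_eq0 // in IHk.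
  by apply: decays_lower; rewrite subnSK.
(* If the raising coefficient vanishes, then raising gives a first order equation for [u]. *)
pose r2 := (j%:R + 1) ^+ 2 / g.
have j0 : 0 < j%:R + 1 :> R by rewrite ltr_wpDl ?ler0n.
have r2_gt0 : 0 < r2 by rewrite divr_gt0 ?exprn_gt0.
apply: (@bounded_decays _ `|u j r2| r2) => // r rr.
apply: normr_le_sqr.
apply: (pos_nonincr (@usq_derive j) r2_gt0 rr) => x xr.
have x0 : 0 < x by exact: lt_le_trans xr.
have := ured_raise g la j x0; rewrite d0 oppr0 mul0r => /eqP; rewrite subr_eq0 => /eqP E.
rewrite mulr_ge0_le0 // -(@pmulr_rle0 _ (j%:R + 1)) // mulrCA E mulrCA mulr_le0_ge0 //; last first.
  by rewrite -expr2 sqr_ge0.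
by rewrite subr_le0 ler_pdivrMr // mulrC -ler_pdivrMr.
Qed.

End NegativeEnergy.

Lemma decays_ge0 l : 0 <= la -> decays l.
Proof.
move=> la0; pose r0 := (l%:R * (l%:R + 1) + 1) / g.
have L0 : 0 <= l%:R * (l%:R + 1) :> R by rewrite mulr_ge0 ?addr_ge0 ?ler0n.
have r0_gt0 : 0 < r0 by rewrite divr_gt0 // ltr_wpDl.
(* The energy is eventually nonincreasing and bounds [g u^2 / r]. *)
pose E r := v l r ^+ 2 + - (P l r * u l r ^+ 2).
have DE r : 0 < r -> is_derive r 1 E (- ((2 * g / r ^+ 2 - 2 * (l%:R * (l%:R + 1)) / r ^+ 3) * u l r ^+ 2)).
  move=> r0'; have D := is_derive_D (vsq_derive l r0') (is_derive_Z (-1) (is_derive_M (upot_derive l r0') (usq_derive l r0'))).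
  have -> : E = fun x => v l x ^+ 2 + -1 * (P l x * u l x ^+ 2) by apply: funext => x; rewrite mulN1r.
  by apply: (is_derive_eq D); ring.
have gr r : r0 <= r -> l%:R * (l%:R + 1) <= g * r.
  rewrite ler_pdivrMr // mulrC => h; lra.
have Er r : r0 <= r -> E r <= E r0.
  move=> rr; apply: (pos_nonincr DE r0_gt0 rr) => x xr; have x0 : 0 < x by exact: lt_le_trans xr.
  rewrite oppr_le0 mulr_ge0 ?sqr_ge0 //.
  have -> : 2 * g / x ^+ 2 - 2 * (l%:R * (l%:R + 1)) / x ^+ 3 = 2 * (g * x - l%:R * (l%:R + 1)) / x ^+ 3.
    by field; rewrite gt_eqF.
  by rewrite divr_ge0 ?exprn_ge0 ?(ltW x0) // mulr_ge0 // subr_ge0 gr.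
have ub r : r0 <= r -> u l r ^+ 2 * g <= E r0 * r.
  move=> rr; have x0 : 0 < r by exact: lt_le_trans rr.
  rewrite -ler_pdivrMr //; apply: le_trans (Er r rr).
  rewrite /E ler_wpDl ?sqr_ge0 // -mulNr [X in _ <= X]mulrC -mulrA ler_wpM2l ?sqr_ge0 //.
  have -> : - P l r = g / r + la + (g * r - l%:R * (l%:R + 1)) / r ^+ 2.
    by rewrite /upot; field; rewrite gt_eqF.
  by rewrite -addrA lerDl addr_ge0 // divr_ge0 ?sqr_ge0 // subr_ge0 gr.
have E0 : 0 <= E r0.
  have := ub r0 (lexx _); have : 0 <= u l r0 ^+ 2 * g by rewrite mulr_ge0 ?sqr_ge0 // ltW.
  by move=> /le_trans h /h; rewrite pmulr_lge0.
move=> e e0; exists (r0 + E r0 / (g * e ^+ 2)).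
  by rewrite ltr_pwDl // divr_ge0 // mulr_ge0 ?sqr_ge0 // ltW.
move=> r rr; have q0 : 0 <= E r0 / (g * e ^+ 2) by rewrite divr_ge0 // mulr_ge0 ?sqr_ge0 // ltW.
have rr0 : r0 < r by apply: le_lt_trans rr; rewrite lerDl.
have x0 : 0 < r by exact: lt_trans rr0.
have er : E r0 / (g * e ^+ 2) < r by apply: lt_trans rr; rewrite ltrDr.
rewrite ltr_pdivrMr ?mulr_gt0 ?exprn_gt0 // in er.
rewrite -(@ltr_pXn2r _ 2) ?nnegrE ?mulr_ge0 ?(ltW e0) ?(ltW x0) // real_normK ?num_real //.
rewrite -(ltr_pM2r g_gt0); apply: le_lt_trans (ub r (ltW rr0)) _.
by rewrite exprMn expr2 mulrA -mulrA -(ltr_pM2r x0) in er *; nra.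
Qed.

End RadialDecay.

Section PhysicalSolutions.
Variables (R : realType) (g la : R).
Hypothesis g_gt0 : 0 < g.
Local Notation C := R[i].
Local Notation fn := (fn R).
Local Notation space0 := (space0 R).
Local Notation rad := (@Defs.rad R).
Implicit Types (P Q : fn) (i : 'I_3) (l : nat).

Definition vanishes (T : Type) (m : T -> R) (f : T -> C) :=
  forall e : R, 0 < e -> exists M : R, forall y : T, M < m y -> `|f y| < e%:C.

Lemma vanishes_lin (T : Type) (m : T -> R) a f h : vanishes m f -> vanishes m h ->
  vanishes m (fun x => a * f x + h x).
Proof.
move=> vf vh e e0; pose k := complex.Re `|a|.
have k0 : 0 <= k by exact: Re_norm_ge0.
have e1 : 0 < e / 2 / (k + 1) by rewrite !divr_gt0 // ltr_wpDl.
have [M fM] := vf _ e1; have [N hN] := vh _ (divr_gt0 e0 (ltr0n _ 2)).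
exists (Num.max M N) => x; rewrite gt_max => /andP[/fM fx /hN hx].
apply: le_lt_trans (ler_normD _ _) _; rewrite normrM.
rewrite (normC_Re a) (normC_Re (f x)) (normC_Re (h x)) in fx hx *.
rewrite -rmorphM -rmorphD !ltcR in fx hx *; rewrite -/k.
have f0 : 0 <= complex.Re `|f x| by exact: Re_norm_ge0.
have : complex.Re `|f x| * (k + 1) < e / 2 by rewrite -ltr_pdivlMr // ltr_wpDl.
by nra.
Qed.

Lemma vanishes0 (T : Type) (m : T -> R) : vanishes m (fun=> 0).
Proof. by move=> e e0; exists 0 => x _; rewrite normr0 ltcR. Qed.

Lemma vanishesZ (T : Type) (m : T -> R) a f : vanishes m f -> vanishes m (fun x => a * f x).
Proof.
move=> vf; have := vanishes_lin a vf (vanishes0 m); congr vanishes; apply: funext => x.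
by rewrite addr0.
Qed.

Lemma vanishes_sum (T : Type) (m : T -> R) n (F : 'I_n -> T -> C) :
  (forall j, vanishes m (F j)) -> vanishes m (fun x => \sum_j F j x).
Proof.
elim: n F => [|n IHn] F vF.
  by have := vanishes0 m; congr vanishes; apply: funext => x; rewrite big_ord0.
have := vanishes_lin 1 (IHn _ (fun j => vF (widen_ord (leqnSn n) j))) (vF ord_max).
by congr vanishes; apply: funext => x; rewrite big_ord_recr /= mul1r.
Qed.

(* Gaussian elimination: evaluating at suitable points separates the coefficients of independent functions. *)
Lemma vanishes_coef N (F : nat -> R -> C) (Y : nat -> fn) :
  (forall x, vanishes id (fun r => \sum_(l < N) F l r * Y l x)) ->
  (forall c : nat -> C, \sum_(l < N) c l *: Y l = 0 -> forall l, (l < N)%N -> c l *: Y l = 0) ->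
  forall l, (l < N)%N -> Y l != 0 -> vanishes id (F l).
Proof.
elim: N Y => [|N IHN] Y vS ind l //.
have [YN0|YN0] := eqVneq (Y N) 0.
  rewrite ltnS leq_eqVlt => /orP[/eqP ->|lN]; first by rewrite YN0 eqxx.
  apply: (IHN Y _ _ l lN) => [x|c S0 k kN].
    have := vS x; congr vanishes; apply: funext => r.
    by rewrite big_ord_recr /= YN0 fnE mulr0 addr0.
  by apply: ind (leqW kN); rewrite big_ord_recr /= YN0 scaler0 addr0.
have [x0 Yx0] : exists x0, Y N x0 != 0.
  by apply: contrapT => H; case/eqP: YN0; apply: fnP => x; rewrite fnE; apply/eqP/negPn/negP => h; apply: H; exists x.
pose k l : C := Y l x0 / Y N x0; pose Z l : fn := Y l - k l *: Y N.
have Zind (c : nat -> C) : \sum_(l < N) c l *: Z l = 0 -> forall j, (j < N)%N -> c j *: Y j = 0 /\ c j * k j = 0.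
  move=> S0; pose d l := if l == N then - \sum_(j < N) c j * k j else c l.
  have dl j : (j < N)%N -> d j = c j by move=> jN; rewrite /d ltn_eqF.
  have Sd : \sum_(j < N.+1) d j *: Y j = 0.
    rewrite big_ord_recr /= [d N]/d eqxx -[RHS]S0 scaleNr scaler_suml -sumrB.
    by apply: eq_bigr => j _; rewrite dl // /Z scalerBr scalerA.
  move=> j jN; have := ind d Sd j (leqW jN); rewrite dl // => E; split=> //.
  have := congr1 (fun f : fn => f x0) E; rewrite !fnE => /= e.
  by rewrite /k mulrA e mul0r.
have vZ j : (j < N)%N -> Y j != 0 -> vanishes id (F j).
  move=> jN Yj; apply: (IHN Z _ _ j jN) => [x|c S0 m mN|].
  - have := vanishes_lin (- (Y N x / Y N x0)) (vS x0) (vS x); congr vanishes; apply: funext => r.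
    rewrite !big_ord_recr /= mulrDr addrACA -[RHS]addr0; congr (_ + _); last by field.
    rewrite mulr_sumr -big_split; apply: eq_bigr => m _ /=; rewrite /Z /k !fnE.
    by field.
  - by have [cY ck] := Zind c S0 m mN; rewrite /Z scalerBr cY scalerA ck scale0r subrr.
  - apply/eqP => Zj; have /(Zind (fun m => (m == j)%:R)) /(_ j jN) : \sum_(m < N) (m == j :> nat)%:R *: Z m = 0.
      by rewrite big1 // => m _; case: eqP => [->|_]; rewrite ?Zj ?scaler0 // scale0r.
    by rewrite eqxx scale1r => -[Y0]; rewrite Y0 eqxx in Yj.
rewrite ltnS leq_eqVlt => /orP[/eqP -> _|]; last exact: vZ.
have vT : vanishes id (fun r => \sum_(j < N) F j r * Y j x0).
  apply: vanishes_sum => j; have [Y0|Yj] := eqVneq (Y j) 0.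
    by have := @vanishes0 R id; congr vanishes; apply: funext => r; rewrite Y0 fnE mulr0.
  by have := vanishesZ (Y j x0) (vZ j (ltn_ord j) Yj); congr vanishes; apply: funext => r; rewrite mulrC.
have := vanishes_lin (Y N x0)^-1 (vS x0) (vanishesZ (- (Y N x0)^-1) vT); congr vanishes; apply: funext => r.
by rewrite big_ord_recr /=; field.
Qed.

Implicit Types x : space0.

Lemma coord_le_rad x i : `|val x i 0| <= rad x.
Proof.
rewrite -[rad x]gtr0_norm ?rad_gt0 //; apply: normr_le_sqr; rewrite rad_sqr (bigD1 i) //=.
by rewrite lerDl sumr_ge0 // => j _; exact: sqr_ge0.
Qed.

Lemma hom_bound l P : homogeneous l P -> exists2 K : R, 0 <= K & forall x, `|P x| <= (K * rad x ^+ l)%:C.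
Proof.
move: l P; apply: (@homogeneous_ind R (fun l P => exists2 K : R, 0 <= K & forall x, `|P x| <= (K * rad x ^+ l)%:C)).
- by move=> c; exists (complex.Re `|c|) => [|x]; [exact: Re_norm_ge0|rewrite mulr1 -normC_Re].
- move=> l a P Q _ _ [K K0 PK] [L L0 QL]; exists (complex.Re `|a| * K + L).
    by rewrite addr_ge0 // mulr_ge0 // Re_norm_ge0.
  move=> x; rewrite !fnE; apply: le_trans (ler_normD _ _) _; rewrite normrM mulrDl rmorphD.
  by rewrite lerD // -mulrA rmorphM (normC_Re a) ler_wpM2l // lecR Re_norm_ge0.
- move=> l i P _ [K K0 PK]; exists K => // x; rewrite xmE normrM.
  rewrite exprS mulrCA rmorphM; apply: ler_pM => //.
  by rewrite normc_def /= expr0n addr0 sqrtr_sqr lecR coord_le_rad.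
Qed.

Lemma regE l P x : reg g l la%:C P x = (rphi g la l (rad x))%:C * P x.
Proof. by rewrite /reg rpE phiE. Qed.

Lemma reg_vanishes l P : harm l P -> decays g la l -> vanishes rad (reg g l la%:C P).
Proof.
move=> [hP _] dl e e0; have [K K0 PK] := hom_bound hP.
have e1 : 0 < e / (K + 1) by rewrite divr_gt0 // ltr_wpDl.
have [M M0 uM] := dl _ e1; exists M => x Mx; have x0 := rad_gt0 x.
rewrite regE normrM; have := uM _ Mx; rewrite /ured exprS -mulrA normrM (gtr0_norm x0) mulrC ltr_pM2r //.
rewrite normrM (ger0_norm (exprn_ge0 _ (ltW x0))) ltr_pdivlMr ?ltr_wpDl // => H.
apply: le_lt_trans (ler_wpM2l (normr_ge0 _) (PK x)) _.
rewrite [X in X * _]normc_def /= expr0n addr0 sqrtr_sqr -rmorphM ltcR.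
apply: le_lt_trans H; rewrite mulrDr mulr1 mulrCA mulrC -mulrA.
have z0 : 0 <= rad x ^+ l * `|rphi g la l (rad x)| by rewrite mulr_ge0 // exprn_ge0 // ltW.
by rewrite [X in X <= _](_ : _ = rad x ^+ l * `|rphi g la l (rad x)| * K) ?lerDl //; ring.
Qed.

Lemma rsmooth_invX l : rsmooth (fun r : R => r%:C ^- l).
Proof.
elim: l => [|l IHl]; first by apply: rsmooth_ext (rsmooth_cst 1) => r _; rewrite expr0 invr1.
apply: rsmooth_ext (rsmoothM (@rsmooth_inv R) IHl) => r _ /=.
by rewrite exprS invfM.
Qed.

Lemma regsum_vanishes N (P : nat -> fn) : hfam N P -> vanishes rad (regsum g la%:C N P) ->
  forall l, P l != 0 -> decays g la l.
Proof.
move=> [hP P0] vf l Pl.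
pose F k (r : R) : C := (r ^+ k * rphi g la k r)%:C.
pose Y k : fn := rp (fun r => r%:C ^- k) (P k).
have lN : (l < N)%N by rewrite ltnNge; apply: contra Pl => /P0 ->.
have Fl : vanishes id (F l).
  apply: (@vanishes_coef N F Y _ _ l lN) => [x e e0|c S0 k kN|].
  - have [M fM] := vf e e0; exists (Num.max M 0) => r; rewrite gt_max => /andP[Mr r0].
    rewrite /= in Mr r0; have := fM (ray x r0); rewrite rad_ray => /(_ Mr).
    congr (`|_| < _); rewrite /regsum fn_sum; apply: eq_bigr => k _.
    have [hk _] := hP k; rewrite regE rad_ray (hom_ray x r0 hk) /F /Y rpE.
    rewrite !rmorphM fmorphV rmorphXn exprMn exprVn /=; ring.
  - rewrite /Y -rpZ; apply: (casimir_indep (psi := fun k r => r%:C ^- k) (P := fun k => c k *: P k) rsmooth_invX _ _ kN).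
      by move=> m; exact: harmZ.
    by rewrite -[RHS]S0; apply: eq_bigr => m _; rewrite -rpZ.
  - apply: contra Pl => /eqP Y0; apply/eqP/fnP => x; have := congr1 (fun f : fn => f x) Y0.
    rewrite /Y rpE !fnE => /eqP; rewrite mulf_eq0 invr_eq0 expf_eq0 (negbTE (radC_neq0 x)) andbF /=.
    by move/eqP.
move=> e e0; have [M FM] := Fl e e0; exists (Num.max M 1); first by rewrite lt_max ltr01 orbT.
move=> r; rewrite gt_max => /andP[Mr r1]; have r0 : 0 < r by exact: lt_trans r1.
have := FM r Mr; rewrite /F normc_def /= expr0n addr0 sqrtr_sqr ltcR => H.
by rewrite /ured exprS -mulrA normrM (gtr0_norm r0) mulrC ltr_pM2r.
Qed.

Lemma Dl_dcoef l : Dl g l la%:C = (dcoef g la l)%:C.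
Proof. exact: Dl_real. Qed.

Lemma Dl_eq0_dcoef l : (Dl g l la%:C == 0) = (dcoef g la l == 0).
Proof. by rewrite Dl_dcoef fmorph_eq0. Qed.

Lemma decaysP l : decays g la l <-> 0 <= la \/ exists2 j, (l <= j)%N & Dl g j la%:C = 0.
Proof.
have E : (exists2 j, (l <= j)%N & dcoef g la j = 0) <-> exists2 j, (l <= j)%N & Dl g j la%:C = 0.
  by split=> -[j lj /eqP d0]; exists j => //; apply/eqP; rewrite ?Dl_eq0_dcoef // -Dl_eq0_dcoef.
have [la0|la0] := ltP la 0; last by split=> [_|_]; [left|exact: decays_ge0].
rewrite -E; split=> [/(decays_neg g_gt0 la0)|[|/(decays_neg g_gt0 la0)]//]; first by right.
Qed.

Lemma dcoef_gt0 l : 0 <= la -> 0 < dcoef g la l.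
Proof.
move=> la0; have l1 : 0 < l%:R + 1 :> R by rewrite ltr_wpDl ?ler0n.
rewrite divr_gt0 ?mulr_gt0 // ?ltr_wpDl ?mulr_ge0 ?ler0n ?exprn_gt0 //.
Qed.

Definition bound_state := 0 <= la \/ exists j, Dl g j la%:C = 0.

Lemma decays_alive l : bound_state -> (decays g la l <-> alive g la l).
Proof.
have gn0 : g != 0 by rewrite gt_eqF.
move=> [la0|[n Dn]]; rewrite decaysP; split.
- by move=> _ j _; rewrite Dl_eq0_dcoef gt_eqF // dcoef_gt0.
- by left.
- move=> [la0|[m lm Dm]] j jl; apply/eqP => Dj.
    by move/eqP: Dn; rewrite Dl_eq0_dcoef gt_eqF // dcoef_gt0.
  by move: jl; rewrite (Dl_eq0_inj gn0 Dj Dm) ltnNge lm.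
- by move=> al; right; exists n => //; rewrite leqNgt; apply/negP => /al; rewrite Dn eqxx.
Qed.

Lemma PhysSolP f : PhysSol g la f <-> exists N (P : nat -> fn),
  [/\ hfam N P, f = regsum g la%:C N P & forall l, P l != 0 -> decays g la l].
Proof.
split=> [[/RegSolP[N [P [hP ->]]] vf]|[N [P [hP -> dP]]]].
  by exists N, P; split=> //; exact: regsum_vanishes vf.
split; first by apply/RegSolP; exists N, P.
have [hP' _] := hP; rewrite /regsum.
have : vanishes rad (fun x => \sum_(l < N) reg g l la%:C (P l) x).
  apply: vanishes_sum => l; have [->|Pl] := eqVneq (P l) 0; last exact: reg_vanishes (dP l Pl).
  by have := vanishes0 rad; congr vanishes; apply: funext => x; rewrite reg0 fnE.
by congr vanishes; apply: funext => x; rewrite fn_sum.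
Qed.

Lemma PhysSol_J0 : bound_state -> PhysSol g la = J0 g la%:C.
Proof.
move=> bs; apply/seteqP; split=> f.
  move=> /PhysSolP[N [P [[hP _] -> dP]]]; apply: lspan_sum => l _.
  have [->|Pl] := eqVneq (P l) 0; first by rewrite reg0; exact: lspan0.
  by apply: J0_reg => //; apply/decays_alive => //; exact: dP.
move=> Jf; apply/PhysSolP; have [N [hP fE]] := compsP (J0_RegSol Jf).
by exists N, (comps g la f); split=> // l /(J0_comps Jf) /(decays_alive l bs).
Qed.

Lemma bound_stateP f : PhysSol g la f -> f != 0 -> bound_state.
Proof.
move=> /PhysSolP[N [P [_ -> dP]]] f0.
have [l Pl] : exists l, P l != 0.
  apply: contrapT => H; case/eqP: f0; rewrite /regsum big1 // => l _.
  by rewrite (_ : P l = 0) ?reg0 //; apply/eqP/negPn/negP => h; apply: H; exists (l : nat).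
have /decaysP[la0|[j _ Dj]] := dP l Pl; first by left.
by right; exists j.
Qed.

Lemma cst1_J0 : J0 g la%:C (reg g 0 la%:C (@cst1 R)) /\ reg g 0 la%:C (@cst1 R) != 0.
Proof.
have h1 := harm_cst1 R; split; first exact: J0_reg.
apply/eqP => /reg_eq0 e; have [h _] := h1; have := cst1_neq0 R.
by rewrite (e h) eqxx.
Qed.

Lemma physical_spectrumP : physical_spectrum g la <-> bound_state.
Proof.
split=> [[f]|bs]; first exact: bound_stateP.
by have [J1 n0] := cst1_J0; exists (reg g 0 la%:C (@cst1 R)); rewrite ?PhysSol_J0.
Qed.

End PhysicalSolutions.

Lemma nontrivial_subquot (R : realType) (V : lmodType R[i]) (U W : set V) :
  nontrivial (subquot U W) <-> exists2 u, lspan U u & ~ lspan W u.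
Proof.
split=> [[c c0]|[u Uu nWu]].
  exists (rep c) => [|Wc]; first exact: rep_mem.
  by move/eqP: c0; apply; rewrite -(sqcls_rep c); apply/sqcls_eq0 => //; exact: rep_mem.
by exists (sqcls U W u); apply/eqP => /sqcls_eq0 => /(_ Uu).
Qed.

Section JantzenQuotients.
Variables (R : realType) (g : R) (g_gt0 : 0 < g).
Variables (A : sections (@SingSol R g) -> R[i] -> fn R) (A_intw : intertwiner A).
Variable la : R.
Local Notation lc := (la%:C).

Lemma jantzenE : [/\ jantzen A lc 0 = J0 g lc, forall n, jantzen A lc (Posz n.+1) = RegSol g lc &
  forall n, jantzen A lc (Negz n) = [set 0]].
Proof.
have [G [ps Gps]] := exists_family A_intw; have [q qE] := intw_ground A_intw Gps.
split; first exact: (jantzen_zero A_intw Gps qE lc).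
  by move=> n; apply: (jantzen_pos A_intw Gps qE _ lc n); rewrite gt_eqF.
exact: jantzen_neg.
Qed.

Lemma jquotE : [/\ jquot A lc 0 = subquot (J0 g lc) [set 0],
  jquot A lc 1 = subquot (RegSol g lc) (J0 g lc),
  forall n, ~ nontrivial (jquot A lc (Posz n.+2)) &
  forall n, ~ nontrivial (jquot A lc (Negz n))].
Proof.
have [E0 E1 En] := jantzenE; split.
- by rewrite /jquot E0 (En 0%N).
- by rewrite /jquot (E1 0%N) E0.
- move=> n; rewrite /jquot (_ : Posz n.+2 - 1 = Posz n.+1) ?E1; last by rewrite -[n.+2]addn1 PoszD addrK.
  by move=> /nontrivial_subquot[u].
- move=> n; rewrite /jquot (_ : Negz n - 1 = Negz n.+1) ?En; last by rewrite !NegzE -opprD -PoszD addn1.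
  by move=> /nontrivial_subquot[u].
Qed.

Lemma unitary_jquot0 : bound_state g la -> unitary_jquot A lc 0.
Proof.
move=> bs; have [E0 _ En] := jantzenE.
rewrite /unitary_jquot /jquot E0 (En 0%N); apply: unitary_J0 => l al j jl.
rewrite Dl_dcoef ltcR; have [la0|la0] := leP 0 la; first exact: dcoef_gt0.
case: bs => [|[n Dn]]; first by rewrite leNgt la0.
have ln : (l <= n)%N by rewrite leqNgt; apply/negP => /al; rewrite Dn eqxx.
have jn := leq_trans jl ln.
have j0 m : 0 < m%:R + 1 :> R by rewrite ltr_wpDl ?ler0n.
have e : la * (n%:R + 1) ^+ 2 + g ^+ 2 = 0.
  apply: (@complexI R); move/eqP: Dn; rewrite Dl_eq0 => /eqP Dn.
  by rewrite rmorphD rmorphM !rmorphXn rmorphD rmorph_nat rmorph1.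
apply: divr_gt0; last by rewrite mulr_gt0 // ltr_wpDl ?mulr_ge0 ?ler0n.
rewrite -[ltLHS]e ltrD2r ltr_nM2l //.
rewrite ltr_pXn2r ?nnegrE ?ltW //.
by rewrite ltrD2r ltr_nat.
Qed.

Lemma J0_all : (forall j, Dl g j lc != 0) -> J0 g lc = RegSol g lc.
Proof.
move=> D0; apply/seteqP; split=> f; first exact: J0_RegSol.
rewrite RegSolE; apply: lspan_sub => _ [l [P [hP ->]]].
by apply: J0_reg => // j _.
Qed.

Lemma jantzen_unitary_neg p : la < 0 -> nontrivial (jquot A lc p) -> unitary_jquot A lc p ->
  p = 0 /\ bound_state g la.
Proof.
move=> la0; have [E0 E1 En] := jantzenE; have [_ _ n2 nN] := jquotE.
have lspanR : lspan (RegSol g lc) = RegSol g lc.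
  by apply/seteqP; split=> f; [exact: RegSol_span|exact: lspan_gen].
have lspanJ : lspan (J0 g lc) = J0 g lc.
  by apply/seteqP; split=> f; [apply: lspan_sub|exact: lspan_gen].
have [bs|nbs] := pselect (bound_state g la); last first.
  have D0 j : Dl g j lc != 0 by apply/eqP => Dj; apply: nbs; right; exists j.
  case: p => [[|[|n]]|n]; [|by rewrite /jquot (E1 0%N) E0 J0_all // => /nontrivial_subquot[]|by move/n2|by move/nN].
  move=> _; rewrite /unitary_jquot /jquot E0 (En 0%N) J0_all // => /(not_unitary la0 (N := 0)) [] //.
  - by move=> f /lspan_set0 ->; exact: lspan0.
  - by move=> i f /lspan_set0 ->; rewrite rungelenz0; exact: lspan0.
  - by move=> l P _ [hP _] /lspan_set0; exact: reg_eq0.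
case: bs => [|[n Dn]]; first by rewrite leNgt la0.
case: p => [[|[|m]]|m]; [by split=> //; right; exists n| |by move/n2|by move/nN].
move=> _; rewrite /unitary_jquot /jquot (E1 0%N) E0 => /(not_unitary la0 (N := n.+1)) [] //.
- by rewrite lspanJ lspanR => f; exact: J0_RegSol.
- by rewrite lspanJ => i f; exact: J0_rungelenz.
- move=> l P nl hP; rewrite lspanJ => /J0_comps => /(_ l); rewrite comps_reg // eqxx => H.
  by apply/eqP/negPn/negP => /H/(_ n nl); rewrite Dn eqxx.
Qed.

Lemma jantzen_unitary p : nontrivial (jquot A lc p) -> unitary_jquot A lc p ->
  p = 0 /\ bound_state g la.
Proof.
have [la0|la0] := ltP la 0; first exact: jantzen_unitary_neg.
have [E0 E1 _] := jantzenE; have [_ _ n2 nN] := jquotE.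
have D0 j : Dl g j lc != 0 by rewrite Dl_eq0_dcoef gt_eqF // dcoef_gt0.
case: p => [[|[|n]]|n]; [by split=> //; left| |by move/n2|by move/nN].
by rewrite /jquot (E1 0%N) E0 J0_all // => /nontrivial_subquot[].
Qed.

Lemma nontrivial_jquot0 : nontrivial (jquot A lc 0).
Proof.
have [E0 _ En] := jantzenE; rewrite /jquot E0 (En 0%N); apply/nontrivial_subquot.
have [J1 n0] := cst1_J0 g la; exists (reg g 0 lc (@cst1 R)); first exact: lspan_gen.
by move/lspan_set0/eqP; rewrite (negbTE n0).
Qed.

End JantzenQuotients.

Theorem theorem6p4p2 (R : realType) (g : R) (g_gt0 : 0 < g)
    (A : sections (@SingSol R g) -> R[i] -> fn R) (A_intw : intertwiner A) :
  physical_spectrum g =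
    [set la : R | exists p : int,
       nontrivial (jquot A la%:C p) /\ unitary_jquot A la%:C p]
  /\
  forall la : R, physical_spectrum g la ->
    exists p : int,
      [/\ nontrivial (jquot A la%:C p),
          unitary_jquot A la%:C p,
          forall q : int,
            nontrivial (jquot A la%:C q) -> unitary_jquot A la%:C q -> q = p,
          jantzen A la%:C p = PhysSol g la &
          jantzen A la%:C (p - 1) = [set 0]].
Proof.
split.
  apply/seteqP; split=> la.
    move=> /(physical_spectrumP la g_gt0) bs; exists 0; split.
      exact: nontrivial_jquot0.
    exact: unitary_jquot0.
  by move=> [p [np up]]; apply/physical_spectrumP => //; have [] := jantzen_unitary g_gt0 A_intw np up.
move=> la /(physical_spectrumP la g_gt0) bs; have [E0 _ En] := jantzenE g_gt0 A_intw la; exists 0; split.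
- exact: nontrivial_jquot0.
- exact: unitary_jquot0.
- by move=> q nq uq; have [] := jantzen_unitary g_gt0 A_intw nq uq.
- by rewrite E0 PhysSol_J0.
- exact: (En 0%N).
Qed.
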